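(* Let $\gamma\in(-1,0)$, $\nu\in(0,1)$ with $\gamma+\nu>0$, and let $\beta$ be an angular kernel satisfying the assumption in the context. Let $q\ge 2$ be such that $q>\gamma^2/(\gamma+\nu)$. Assume that $f_0\in\mathcal P_q(\mathbb R^3)$ has a density with finite entropy, i.e. $\int_{\mathbb R^3} f_0(v)|\log f_0(v)|\,dv<\infty$. Let $p\in\big(3/(3+\gamma),p_0(\gamma,\nu,q)\big)$, where $$p_0(\gamma,\nu,q)=\frac{q-\gamma}{q(3-\nu)/3-\gamma},$$ and let $(f_t)_{t\ge 0}\in L^\infty\big([0,\infty),\mathcal P_2(\mathbb R^3)\big)\cap L^1_{loc}\big([0,\infty),L^p(\mathbb R^3)\big)$ be the unique weak solution to the Boltzmann equation in this class starting from $f_0$. Then there is a constant $C_{\gamma,p}>0$ (depending only on $\gamma$, $p$ and the fixed kernel) such that for any other weak solution $(\tilde f_t)_{t\ge 0}\in L^\infty\big([0,\infty),\mathcal P_2(\mathbb R^3)\big)$ to the Boltzmann equation (with possibly different initial condition $\tilde f_0$) and for any $t\ge 0$, $$\mathcal W_2^2(f_t,\tilde f_t)\le \mathcal W_2^2(f_0,\tilde f_0)\exp\Big(C_{\gamma,p}\int_0^t\big(1+\|f_s\|_{L^p}\big)ds\Big).$$ In particular, uniqueness holds for the Boltzmann equation starting from $f_0$ in the class of all weak solutions.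
   Context: **Kernel.** $\beta:(0,\pi]\to\mathbb R_+$ is measurable, there are constants $0<c_0<c_1$ with $c_0\theta^{-1-\nu}\le\beta(\theta)\le c_1\theta^{-1-\nu}$ for all $\theta\in(0,\pi/2)$, and $\beta(\theta)=0$ for $\theta\in[\pi/2,\pi]$. The collision kernel $B$ of the Boltzmann equation is given by $B(|v-v_*|,\theta)\sin\theta=|v-v_*|^\gamma\beta(\theta)$. **Parameterization.** For $x\in\mathbb R^3\setminus\{0\}$ fix (measurably in $x$) a vector $I(x)$ with $|I(x)|=|x|$ and $I(x)\perp x$; set $J(x)=\frac{x}{|x|}\wedge I(x)$ and $\Gamma(x,\varphi)=(\cos\varphi)I(x)+(\sin\varphi)J(x)$, with $\Gamma(0,\varphi)=0$. Set $a(v,v_*,\theta,\varphi)=-\frac{1-\cos\theta}{2}(v-v_* )+\frac{\sin\theta}{2}\Gamma(v-v_*,\varphi)$. **Spaces.** $\mathcal P(\mathbb R^3)$ is the set of probability measures on $\mathbb R^3$; $m_q(f)=\int|v|^qf(dv)$; $\mathcal P_q(\mathbb R^3)=\{f\in\mathcal P(\mathbb R^3):m_q(f)<\infty\}$. A measure with a density is identified with its density. $\mathcal W_2$ is the Wasserstein distance with quadratic cost: $\mathcal W_2^2(g,\tilde g)=\inf_R\int|v-\tilde v|^2R(dv,d\tilde v)$ over couplings $R$ of $g,\tilde g$. $(f_t)\in L^\infty([0,\infty),\mathcal P_2(\mathbb R^3))$ means $\sup_t m_2(f_t)<\infty$. **Weak solution.** A measurable family $(f_t)_{t\ge0}$ of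 probability measures on $\mathbb R^3$ is a weak solution to the Boltzmann equation if: (1) for all $t\ge 0$, $\int v f_t(dv)=\int vf_0(dv)$ and $\int|v|^2f_t(dv)=\int|v|^2f_0(dv)<\infty$; (2) for every bounded globally Lipschitz $\phi:\mathbb R^3\to\mathbb R$ and every $t\ge 0$, $$\int\phi(v)f_t(dv)=\int\phi(v)f_0(dv)+\int_0^t\int\int\mathcal A\phi(v,v_* )f_s(dv_* )f_s(dv)ds,$$ where $\mathcal A\phi(v,v_* )=|v-v_*|^\gamma\int_0^{\pi/2}\beta(\theta)d\theta\int_0^{2\pi}[\phi(v+a(v,v_*,\theta,\varphi))-\phi(v)]d\varphi$ (and $\mathcal A\phi(v,v)=0$). **Known well-posedness.** Under the stated assumptions on $f_0$, $q$ and $p$, one has $p_0(\gamma,\nu,q)\in(3/(3+\gamma),3/(3-\nu))$, and there is a unique weak solution in $L^\infty([0,\infty),\mathcal P_2(\mathbb R^3))\cap L^1_{loc}([0,\infty),L^p(\mathbb R^3))$ starting from $f_0$. *)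

(* Defs.v *)
From HB Require Import structures.
From mathcomp Require Import all_boot all_order all_algebra.
From mathcomp Require Import all_classical all_reals all_analysis.
From mathcomp Require Import measurable_realfun.

Set Implicit Arguments.
Unset Strict Implicit.
Unset Printing Implicit Defensive.

Import Order.TTheory GRing.Theory Num.Theory.
Import numFieldNormedType.Exports.

Local Open Scope classical_set_scope.
Local Open Scope ring_scope.

(* R^3 with the product (i.e. Borel) sigma-algebra; [measurableTypeR R] is R with
   its Borel sigma-algebra, the type on which [lebesgue_measure] is defined.  The
   norm that the library puts on a product is the sup norm, hence [enorm] for
   the Euclidean one. *)
Notation vec R :=
  (measurableTypeR R * measurableTypeR R * measurableTypeR R)%type.

Definition dotv (R : realType) (x y : vec R) : R :=
  x.1.1 * y.1.1 + x.1.2 * y.1.2 + x.2 * y.2.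

Definition enorm (R : realType) (x : vec R) : R := Num.sqrt (dotv x x).

Definition crossv (R : realType) (x y : vec R) : vec R :=
  (x.1.2 * y.2 - x.2 * y.1.2,
   x.2 * y.1.1 - x.1.1 * y.2,
   x.1.1 * y.1.2 - x.1.2 * y.1.1).

Definition leb3 (R : realType) : {measure set (vec R) -> \bar R} :=
  ((@lebesgue_measure R \x @lebesgue_measure R) \x @lebesgue_measure R)%E.

(* Measures are compared on measurable sets: a [probability] is a total function
   on sets whose values outside the sigma-algebra carry no information. *)
Definition same_measure d (T : measurableType d) (R : realType)
    (g h : probability T R) : Prop :=
  forall A : set T, measurable A -> g A = h A.

Definition angular_kernel (R : realType) (nu : R) (beta : R -> R) : Prop :=
  [/\ measurable_fun `]0, pi] beta,
      {in `]0, pi], forall theta, 0 <= beta theta},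
      exists c0 c1 : R, 0 < c0 < c1 /\
        {in `]0, pi / 2[, forall theta,
          c0 * theta `^ (- 1 - nu) <= beta theta <= c1 * theta `^ (- 1 - nu)} &
      {in `[pi / 2, pi], forall theta, beta theta = 0}].

Definition orthogonal_selection (R : realType) (I : vec R -> vec R) : Prop :=
  measurable_fun [set x : vec R | x != 0] I /\
  forall x : vec R, x != 0 -> enorm (I x) = enorm x /\ dotv (I x) x = 0.

Definition J_vec (R : realType) (I : vec R -> vec R) (x : vec R) : vec R :=
  crossv ((enorm x)^-1 *: x) (I x).

Definition Gamma_vec (R : realType) (I : vec R -> vec R) (x : vec R) (phi : R)
    : vec R :=
  if x == 0 then 0 else cos phi *: I x + sin phi *: J_vec I x.

Definition deviation (R : realType) (I : vec R -> vec R) (v w : vec R)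
    (theta phi : R) : vec R :=
  - ((1 - cos theta) / 2) *: (v - w) + (sin theta / 2) *: Gamma_vec I (v - w) phi.

(* At v = w the deviation vanishes, so the value is 0, as the usual convention
   A psi (v, v) = 0 requires. *)
Definition collision_op (R : realType) (gamma : R) (beta : R -> R)
    (I : vec R -> vec R) (psi : vec R -> R) (v w : vec R) : R :=
  enorm (v - w) `^ gamma *
  \int[lebesgue_measure]_(theta in `]0, pi / 2])
    (beta theta *
     \int[lebesgue_measure]_(phi in `[0, 2 * pi])
       (psi (v + deviation I v w theta phi) - psi v)).

Definition moment (R : realType) (q : R) (g : probability (vec R) R) : \bar R :=
  (\int[g]_v ((enorm v `^ q)%:E))%E.

Definition is_density (R : realType) (g : probability (vec R) R)
    (h : vec R -> R) : Prop :=
  [/\ measurable_fun setT h, (forall v, 0 <= h v) &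
      forall A : set (vec R), measurable A ->
        g A = (\int[leb3 R]_(v in A) (h v)%:E)%E].

Definition finite_entropy (R : realType) (g : probability (vec R) R) : Prop :=
  exists h : vec R -> R, is_density g h /\
    (\int[leb3 R]_v (h v * `|ln (h v)|)%:E < +oo)%E.

(* The L^p norm of the density of g.  Densities being a.e. unique, the set has
   at most one element; if g has no density it is empty and the norm is +oo. *)
Definition Lp_norm (R : realType) (p : R) (g : probability (vec R) R) : \bar R :=
  ereal_inf [set Lnorm (leb3 R) p%:E (EFin \o h) | h in is_density g].

Definition coupling (R : realType) (g h : probability (vec R) R)
    (P : probability (vec R * vec R)%type R) : Prop :=
  forall A : set (vec R), measurable A ->
    P (A `*` setT) = g A /\ P (setT `*` A) = h A.

Definition W2_sq (R : realType) (g h : probability (vec R) R) : \bar R :=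
  ereal_inf [set (\int[P]_z (enorm (z.1 - z.2) ^+ 2)%:E)%E | P in coupling g h].

(* A family (f_t), t >= 0, is a function on R whose values at negative times are
   never used. *)
Definition Linfty_P2 (R : realType) (f : R -> probability (vec R) R) : Prop :=
  (ereal_sup [set moment 2%R (f t) | t in [set t : R | (0 <= t)%R]] < +oo)%E.

(* Integrability (which includes measurability) of the norm forces f_t to
   have a density in L^p for a.e. t. *)
Definition L1loc_Lp (R : realType) (p : R) (f : R -> probability (vec R) R)
    : Prop :=
  forall T : R, 0 <= T ->
    (@lebesgue_measure R).-integrable `[0, T] (fun t => Lp_norm p (f t)).

(* All the real-valued integrals below converge absolutely: the second moments
   are finite and, for psi K-Lipschitz,
   |psi (v + deviation) - psi v| <= K * theta * |v - w|. *)
Definition weak_solution (R : realType) (gamma : R) (beta : R -> R)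
    (I : vec R -> vec R) (f : R -> probability (vec R) R) : Prop :=
  [/\ forall A : set (vec R), measurable A ->
        measurable_fun `[(0 : R), +oo[ (fun t => f t A),
      forall t : R, 0 <= t ->
        [/\ \int[f t]_v v.1.1 = \int[f 0]_v v.1.1,
            \int[f t]_v v.1.2 = \int[f 0]_v v.1.2 &
            \int[f t]_v v.2 = \int[f 0]_v v.2],
      (moment 2%R (f 0%R) < +oo)%E /\
      forall t : R, 0 <= t -> moment 2 (f t) = moment 2 (f 0) &
      forall psi : vec R -> R,
        (exists M : R, forall v, `|psi v| <= M) ->
        (exists K : R, forall v w, `|psi v - psi w| <= K * enorm (v - w)) ->
        forall t : R, 0 <= t ->
          \int[f t]_v psi v =
          \int[f 0]_v psi v +
          \int[lebesgue_measure]_(s in `[0, t])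
            \int[f s]_v \int[f s]_w collision_op gamma beta I psi v w].

Definition p0 (R : realType) (gamma nu q : R) : R :=
  (q - gamma) / (q * (3 - nu) / 3 - gamma).

(* Main.v *)
Require Import Defs.
From HB Require Import structures.
From mathcomp Require Import all_boot all_order all_algebra.
From mathcomp Require Import all_classical all_reals all_analysis.
From mathcomp Require Import measurable_realfun.
From mathcomp Require Import ring lra.

Set Implicit Arguments.
Unset Strict Implicit.
Unset Printing Implicit Defensive.

Import Order.TTheory GRing.Theory Num.Theory.
Import numFieldNormedType.Exports.

Local Open Scope classical_set_scope.
Local Open Scope ring_scope.

(* Stability is proved through Kantorovich duality instead of a coupling of stochastic
   processes.  Fix optimal potentials (phi, psi) for the cost at the final time t of a short
   interval [s, t]: their means are at most the cost at time s, and by the weak formulation they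
   vary by the integral of A phi (v, v') + A psi (w, w') against R_u (x) R_u, where R_u is an
   optimal plan at time u.  Matching the two collisions by Tanaka's choice of azimuths and by the
   inverse of the angular kernel, the constraint phi + psi <= c bounds this sum by
   C |v - v'|^gamma (|v - w|^2 + |v' - w'|^2) plus N times the gap c - phi - psi at (v, w), plus
   the contribution of the collisions beyond a cutoff N.  The mean gap is O(t - s), so it
   disappears when the time mesh is refined before N tends to infinity, and
   sup_v \int |v - v'|^gamma f_u(dv') <= C (1 + ||f_u||_p) by Hoelder's inequality on dyadic
   balls.  The approximate duality is obtained from a finite dual problem in which the constraint
   is penalized: the first-order condition of the penalized problem is exactly that the positive
   parts of the violations form a coupling.  The cost is truncated at level M, and M tends to
   infinity at the end by conservation of energy.  Uniqueness is the case W_2(f_0, g_0) = 0. *)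

(** * Vectors and the truncated cost *)

Section vectors.
Context {R : realType}.
Implicit Types (x y z u v w a b : vec R) (k : R).

(** The plan [R_u] is chosen separately for each u and enters only through an inequality between
    quantities that do not mention it, so no measurable selection of plans in time is made. The
    price is that potentials frozen at time t are not optimal for [R_u]. After two matched
    collisions phi + psi is at most the cost, but the value subtracted before them falls short of
    the cost by the gap; as the total intensity of collisions is infinite, the gap can be charged
    only to the finite part z <= N. Only f has an L^p bound, so the singular factor must be carried
    by v - v' alone. For relative velocities x and y the mismatch of the two angles is multiplied by
    the length of the shorter one, and since gamma lies in ]-1, 0[ the total is controlled by
    |x|^gamma whichever of x, y is shorter. This uses both power bounds on beta. The condition gamma
    + nu > 0 enters beyond the cutoff, where displacements are of order |x|^(1 + gamma / nu). *)

Lemma vec_ext x y : x.1.1 = y.1.1 -> x.1.2 = y.1.2 -> x.2 = y.2 -> x = y.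
Proof. by move: x y => [[? ?] ?] [[? ?] ?] /= -> -> ->. Qed.

Lemma dotvE x y : dotv x y = x.1.1 * y.1.1 + x.1.2 * y.1.2 + x.2 * y.2.
Proof. by []. Qed.

Lemma dotvC x y : dotv x y = dotv y x.
Proof. by rewrite !dotvE; ring. Qed.

Lemma dotvDl x y z : dotv (x + y) z = dotv x z + dotv y z.
Proof. by rewrite !dotvE /=; ring. Qed.

Lemma dotvDr x y z : dotv z (x + y) = dotv z x + dotv z y.
Proof. by rewrite !dotvE /=; ring. Qed.

Lemma dotvNl x y : dotv (- x) y = - dotv x y.
Proof. by rewrite !dotvE /=; ring. Qed.

Lemma dotvNr x y : dotv x (- y) = - dotv x y.
Proof. by rewrite !dotvE /=; ring. Qed.

Lemma dotvZl k x y : dotv (k *: x) y = k * dotv x y.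
Proof. by rewrite !dotvE /= /GRing.scale /=; ring. Qed.

Lemma dotvZr k x y : dotv x (k *: y) = k * dotv x y.
Proof. by rewrite dotvC dotvZl dotvC. Qed.

Definition dotv_lin := (dotvDl, dotvDr, dotvNl, dotvNr, dotvZl, dotvZr).

Lemma dotv_ge0 x : 0 <= dotv x x.
Proof. by rewrite dotvE -!expr2 !addr_ge0 ?sqr_ge0. Qed.

Lemma enorm_ge0 x : 0 <= enorm x.
Proof. exact: sqrtr_ge0. Qed.

Lemma enorm_sqr x : enorm x ^+ 2 = dotv x x.
Proof. by rewrite sqr_sqrtr ?dotv_ge0. Qed.

Lemma enorm0 : enorm (0 : vec R) = 0.
Proof. by rewrite /enorm /dotv /= !mulr0 !addr0 sqrtr0. Qed.

Lemma enorm_eq0 x : (enorm x == 0) = (x == 0).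
Proof.
apply/eqP/eqP => [h|->]; last exact: enorm0.
have : dotv x x = 0 by rewrite -enorm_sqr h expr0n.
rewrite dotvE -!expr2 => H.
have [h1 h2 h3] : [/\ x.1.1 ^+ 2 = 0, x.1.2 ^+ 2 = 0 & x.2 ^+ 2 = 0].
  have := sqr_ge0 x.1.1; have := sqr_ge0 x.1.2; have := sqr_ge0 x.2.
  by split; lra.
by apply: vec_ext; apply/eqP; rewrite -sqrf_eq0; apply/eqP.
Qed.

Lemma enorm_gt0 x : (0 < enorm x) = (x != 0).
Proof. by rewrite lt_neqAle enorm_ge0 andbT eq_sym enorm_eq0. Qed.

Lemma enormZ k x : enorm (k *: x) = `|k| * enorm x.
Proof.
by rewrite /enorm dotvZl dotvZr mulrA -expr2 sqrtrM ?sqr_ge0// sqrtr_sqr.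
Qed.

Lemma enormN x : enorm (- x) = enorm x.
Proof. by rewrite /enorm dotvNl dotvNr opprK. Qed.

Lemma enormBC x y : enorm (x - y) = enorm (y - x).
Proof. by rewrite -enormN opprB. Qed.

Lemma enorm_le x c : 0 <= c -> dotv x x <= c ^+ 2 -> enorm x <= c.
Proof.
by move=> c0 h; rewrite -(ler_pXn2r (_ : (0 < 2)%N)) ?nnegrE ?enorm_ge0// enorm_sqr.
Qed.

Lemma lagrange_id x y :
  dotv x x * dotv y y = dotv x y ^+ 2 + dotv (crossv x y) (crossv x y).
Proof. by rewrite !dotvE /=; ring. Qed.

(** Cauchy-Schwarz: by [lagrange_id] the defect of the squares is the squared norm of the cross
    product. *)
Lemma dotv_le x y : `|dotv x y| <= enorm x * enorm y.
Proof.
rewrite -(ler_pXn2r (_ : (0 < 2)%N)) ?nnegrE ?mulr_ge0 ?enorm_ge0//.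
by rewrite exprMn !enorm_sqr lagrange_id real_normK ?num_real// lerDl dotv_ge0.
Qed.

Lemma dotv_ub x y : dotv x y <= enorm x * enorm y.
Proof. exact: le_trans (ler_norm _) (dotv_le _ _). Qed.

Lemma enormD x y : enorm (x + y) <= enorm x + enorm y.
Proof.
apply: enorm_le; first by rewrite addr_ge0 ?enorm_ge0.
rewrite !dotv_lin (dotvC y x) sqrrD !enorm_sqr.
have := dotv_ub x y; lra.
Qed.

Lemma enormB x y : enorm (x - y) <= enorm x + enorm y.
Proof. by rewrite -(enormN y) enormD. Qed.

Lemma enorm_triangle z x y : enorm (x - y) <= enorm (x - z) + enorm (z - y).
Proof. by rewrite -(subrKA z x (- y)) enormD. Qed.

Lemma enorm_sub_ge x y : enorm x - enorm y <= enorm (x - y).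
Proof. by have := enormD (x - y) y; rewrite subrK; lra. Qed.

Lemma dotvB_sqr x y :
  enorm (x - y) ^+ 2 = enorm x ^+ 2 + enorm y ^+ 2 - 2 * dotv x y.
Proof. by rewrite !enorm_sqr !dotv_lin (dotvC y x); ring. Qed.

Lemma dotvD_sqr x y :
  enorm (x + y) ^+ 2 = enorm x ^+ 2 + enorm y ^+ 2 + 2 * dotv x y.
Proof. by rewrite !enorm_sqr !dotv_lin (dotvC y x); ring. Qed.

Lemma norm_coord x :
  [/\ `|x.1.1 : R| <= enorm x, `|x.1.2 : R| <= enorm x & `|x.2 : R| <= enorm x].
Proof.
have h (t s : R) : 0 <= s -> t ^+ 2 <= s ^+ 2 -> `|t| <= s.
  by move=> s0 ts; rewrite -(ler_pXn2r (_ : (0 < 2)%N)) ?nnegrE// real_normK ?num_real.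
have := sqr_ge0 x.1.1; have := sqr_ge0 x.1.2; have := sqr_ge0 x.2.
have := enorm_sqr x; rewrite dotvE -!expr2 => e.
by split; [apply: (h x.1.1)|apply: (h x.1.2)|apply: (h x.2)]; rewrite ?enorm_ge0//; lra.
Qed.

Lemma enorm_le_sum x : enorm x <= `|x.1.1 : R| + `|x.1.2 : R| + `|x.2 : R|.
Proof.
apply: enorm_le; first by rewrite !addr_ge0.
rewrite dotvE -!expr2 -(real_normK (num_real x.1.1)) -(real_normK (num_real x.1.2)).
rewrite -(real_normK (num_real x.2)).
have := normr_ge0 x.1.1; have := normr_ge0 x.1.2; have := normr_ge0 x.2.
nra.
Qed.

Definition clamp (M t : R) : R := Num.max (- M) (Num.min M t).

Lemma clampB M s t : `|clamp M s - clamp M t| <= `|s - t|.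
Proof.
wlog st : s t / s <= t.
  move=> H; case: (leP s t) => [|/ltW] st; first exact: H.
  by rewrite distrC (distrC s); apply: H.
rewrite distrC (distrC s) (ger0_norm (_ : 0 <= t - s)) ?subr_ge0//.
have cst : clamp M s <= clamp M t.
  by rewrite /clamp le_max2 ?le_min2.
rewrite ger0_norm ?subr_ge0// /clamp.
rewrite /Order.max /Order.min.
case: (ltP M s) => h1; case: (ltP M t) => h2; by repeat (case: ltP => ?); lra.
Qed.

Lemma clamp_id M t : `|t| <= M -> clamp M t = t.
Proof.
rewrite ler_norml => /andP[h1 h2]; rewrite /clamp.
by rewrite (min_idPr _)// (max_idPr _).
Qed.

Lemma clamp_bound M t : 0 <= M -> `|clamp M t| <= M.
Proof.
move=> M0; rewrite ler_norml /clamp le_max lexx /= ge_max ge_min lexx /= andbT.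
by lra.
Qed.

Definition clampv (M : R) (x : vec R) : vec R :=
  (clamp M x.1.1, clamp M x.1.2, clamp M x.2).

Lemma clampvB M x y : enorm (clampv M x - clampv M y) <= enorm (x - y).
Proof.
apply: enorm_le; rewrite ?enorm_ge0// enorm_sqr !dotvE /= -!expr2.
have h s t : (clamp M s - clamp M t) ^+ 2 <= (s - t) ^+ 2.
  rewrite -(real_normK (num_real (clamp M s - _))) -(real_normK (num_real (s - t))).
  by rewrite ler_pXn2r ?nnegrE// clampB.
by rewrite !lerD.
Qed.

Lemma clampv_id M x : enorm x <= M -> clampv M x = x.
Proof.
move=> xM; have [h1 h2 h3] := norm_coord x.
by apply: vec_ext; rewrite /= clamp_id ?(le_trans _ xM).
Qed.

Lemma clampv_bound M x : 0 <= M -> enorm (clampv M x) <= 3 * M.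
Proof.
move=> M0; apply: le_trans (enorm_le_sum _) _ => /=.
have := clamp_bound x.1.1 M0; have := clamp_bound x.1.2 M0; have := clamp_bound x.2 M0.
lra.
Qed.

(* The quadratic cost is truncated so that its Kantorovich potentials can be chosen bounded
   and Lipschitz, hence admissible as test functions in the weak formulation. *)
Definition tcost (M : R) (x y : vec R) : R := enorm (clampv M x - clampv M y) ^+ 2.

Lemma tcost_ge0 M x y : 0 <= tcost M x y.
Proof. exact: sqr_ge0. Qed.

Lemma tcost_le M x y : tcost M x y <= enorm (x - y) ^+ 2.
Proof. by rewrite ler_pXn2r ?nnegrE ?enorm_ge0// clampvB. Qed.

Lemma tcostC M x y : tcost M x y = tcost M y x.
Proof. by rewrite /tcost enormBC. Qed.

Lemma tcost_id M x y : enorm x <= M -> enorm y <= M ->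
  tcost M x y = enorm (x - y) ^+ 2.
Proof. by move=> xM yM; rewrite /tcost !clampv_id. Qed.

Lemma tcost_bound M x y : 0 <= M -> tcost M x y <= 36 * M ^+ 2.
Proof.
move=> M0; have -> : 36 * M ^+ 2 = (6 * M) ^+ 2 by ring.
rewrite ler_pXn2r ?nnegrE ?enorm_ge0 ?mulr_ge0//.
apply: le_trans (enormB _ _) _.
by have := clampv_bound x M0; have := clampv_bound y M0; lra.
Qed.

(** A difference of squares: the two distances differ by at most |x - x'|, and each is at most 6 * M
    because [clampv] takes values of norm at most 3 * M. *)
Lemma tcost_lip M x x' y : 0 <= M ->
  `|tcost M x y - tcost M x' y| <= 12 * M * enorm (x - x').
Proof.
move=> M0; rewrite /tcost subr_sqr mulrC normrM ler_pM//.
- rewrite ger0_norm ?addr_ge0 ?enorm_ge0//.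
  have := enormB (clampv M x) (clampv M y); have := enormB (clampv M x') (clampv M y).
  have := clampv_bound x M0; have := clampv_bound x' M0; have := clampv_bound y M0.
  by lra.
- apply: le_trans (clampvB M _ _); rewrite ler_norml.
  have := enorm_triangle (clampv M x') (clampv M x) (clampv M y).
  have := enorm_triangle (clampv M x) (clampv M x') (clampv M y).
  rewrite (enormBC (clampv M x') (clampv M x)); lra.
Qed.

(** The share of the second moment that the truncation at level M loses; every truncation error is
    expressed through it. *)
Definition tail2 (M : R) (x : vec R) : R := if enorm x <= M then 0 else enorm x ^+ 2.

Lemma tail2_ge0 M x : 0 <= tail2 M x.
Proof. by rewrite /tail2; case: ifP => // _; exact: sqr_ge0. Qed.

(** If both points lie in the ball of radius M the truncation is invisible. If only one lies
    outside, it is the longer one, so |x - y|^2 is at most four times its square; if both do, |x -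
    y|^2 <= 2 (|x|^2 + |y|^2). *)
Lemma sqr_le_tcost M x y :
  enorm (x - y) ^+ 2 <= tcost M x y + 4 * (tail2 M x + tail2 M y).
Proof.
have hB : enorm (x - y) ^+ 2 <= (enorm x + enorm y) ^+ 2.
  by rewrite ler_pXn2r ?nnegrE ?addr_ge0 ?enorm_ge0// enormB.
have := enorm_ge0 x; have := enorm_ge0 y; have := tcost_ge0 M x y.
rewrite /tail2; case: (leP (enorm x) M) => hx; case: (leP (enorm y) M) => hy.
- by rewrite tcost_id//; lra.
- have h : enorm x <= enorm y by lra.
  by nra.
- have h : enorm y <= enorm x by lra.
  by nra.
- have := sqr_ge0 (enorm x - enorm y); have := sqr_ge0 (enorm x).
  by have := sqr_ge0 (enorm y); lra.
Qed.

(* Binet-Cauchy and Parseval in the frames (a, x ^ a / |x|, x) and (b, y ^ b / |y|, y). *)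
Lemma frame_identity x y a b : x != 0 -> y != 0 ->
  enorm a = enorm x -> dotv a x = 0 -> enorm b = enorm y -> dotv b y = 0 ->
  let j := crossv ((enorm x)^-1 *: x) a in
  let l := crossv ((enorm y)^-1 *: y) b in
  (dotv a b + dotv j l) ^+ 2 + (dotv a l - dotv j b) ^+ 2 =
  (enorm x * enorm y + dotv x y) ^+ 2.
Proof.
move=> x0 y0 ax aox bY boy j l.
have nx : enorm x != 0 by rewrite enorm_eq0.
have ny : enorm y != 0 by rewrite enorm_eq0.
set n := enorm x in ax nx *; set m := enorm y in bY ny *.
have xx : dotv x x = n ^+ 2 by rewrite enorm_sqr.
have yy : dotv y y = m ^+ 2 by rewrite enorm_sqr.
have aa : dotv a a = n ^+ 2 by rewrite -ax enorm_sqr.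
have bb : dotv b b = m ^+ 2 by rewrite -bY enorm_sqr.
have crossZ c u v : crossv (c *: u) v = c *: crossv u v.
  by apply: vec_ext; rewrite /= /GRing.scale /=; ring.
(* Parseval for u in the orthogonal frame made of q, r and their cross product, with the component
   along q moved to the right. The component along the cross product comes from a Gram
   determinant. *)
have par u (p : R) q r : p != 0 -> dotv q q = p ^+ 2 -> dotv r r = p ^+ 2 -> dotv r q = 0 ->
    dotv u r ^+ 2 + dotv u (crossv (p^-1 *: q) r) ^+ 2 = p ^+ 2 * dotv u u - dotv u q ^+ 2.
  move=> p0 qq rr rq; rewrite crossZ dotvZr exprMn.
  have gram : dotv u (crossv q r) ^+ 2 = dotv u u * dotv q q * dotv r r
     + 2 * dotv u q * dotv r q * dotv r u - dotv u u * dotv r q ^+ 2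
     - dotv q q * dotv u r ^+ 2 - dotv r r * dotv u q ^+ 2.
    by rewrite !dotvE /=; ring.
  by rewrite gram qq rr rq; field.
have h1 := par b n x a nx xx aa aox.
have h2 := par x m y b ny yy bb boy.
have h3 := par l n x a nx xx aa aox.
have ll : dotv l l = m ^+ 2.
  rewrite /l crossZ dotvZl dotvZr.
  have := lagrange_id y b; rewrite yy bb (dotvC y b) boy expr0n /= add0r => <-.
  by rewrite -/m; field.
rewrite -/j in h1 h3; rewrite -/l in h2; rewrite bb in h1; rewrite ll in h3.
rewrite xx in h2.
have det : dotv a b * dotv j l - dotv a l * dotv j b = n * m * dotv x y.
  have -> : dotv a b * dotv j l - dotv a l * dotv j b =
            (n^-1 * m^-1) * dotv (crossv a (crossv x a)) (crossv b (crossv y b)).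
    by rewrite /j /l !crossZ !dotv_lin -/n -/m !dotvE /=; ring.
  have cc u v : crossv u (crossv v u) = dotv u u *: v - dotv u v *: u.
    by apply: vec_ext; rewrite /= !dotvE /= /GRing.scale /=; ring.
  rewrite !cc aa bb aox boy !scale0r !subr0 !dotv_lin.
  by field; rewrite nx ny.
have := h1; have := h2; have := h3; have := det.
rewrite (dotvC b a) (dotvC b j) (dotvC l a) (dotvC l j) (dotvC l x) (dotvC b x).
rewrite (dotvC x l) (dotvC x b).
move=> e1 e2 e3 e4.
have -> : (n * m + dotv x y) ^+ 2 = n ^+ 2 * m ^+ 2 + dotv x y ^+ 2 + 2 * (n * m * dotv x y) by ring.
rewrite -e1; lra.
Qed.

Lemma polar_angle (c s : R) : c ^+ 2 + s ^+ 2 = 1 ->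
  exists phi : R, [/\ 0 <= phi <= 2 * pi, cos phi = c & sin phi = s].
Proof.
move=> cs.
have c1 : -1 <= c <= 1 by rewrite -ler_norml -(ler_pXn2r (_ : (0 < 2)%N)) ?nnegrE//
   real_normK ?num_real// expr1n -cs lerDl sqr_ge0.
have sE : Num.sqrt (1 - c ^+ 2) = `|s|.
  by rewrite -cs addrAC subrr add0r sqrtr_sqr.
case: (leP 0 s) => s0.
  exists (acos c); rewrite acosK// sin_acos// sE ger0_norm//; split => //.
  by have := acos_ge0 c1; have := acos_lepi c1; have := pi_ge0 R; lra.
exists (- acos c + pi *+ 2); rewrite cosD2pi sinD2pi cosN sinN acosK// sin_acos// sE ltr0_norm// opprK.
split => //; rewrite mulr2n.
by have := acos_ge0 c1; have := acos_lepi c1; have := pi_ge0 R; lra.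
Qed.

(** The right-hand side is maximal over phi when (cos phi, sin phi) is parallel to (P, Q). The
    maximum is the norm of (P, Q), which [frame_identity] evaluates to |x||y| + x.y, and |x||y| >=
    x.y. *)
Lemma tanaka_angle x y a b : x != 0 -> y != 0 ->
  enorm a = enorm x -> dotv a x = 0 -> enorm b = enorm y -> dotv b y = 0 ->
  let j := crossv ((enorm x)^-1 *: x) a in
  let l := crossv ((enorm y)^-1 *: y) b in
  exists phi : R, 0 <= phi <= 2 * pi /\
    2 * dotv x y <= cos phi * (dotv a b + dotv j l) + sin phi * (dotv a l - dotv j b).
Proof.
move=> x0 y0 ax aox bY boy j l.
have := frame_identity x0 y0 ax aox bY boy.
rewrite /= -/j -/l; set P := dotv a b + _; set Q := dotv a l - _ => PQ.
set r := enorm x * enorm y + dotv x y in PQ.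
have xy := dotv_ub x y.
have xy' := dotv_le x y.
have r0 : 0 <= r by move: xy'; rewrite ler_norml /r => /andP[]; lra.
(* Here x and y point in opposite directions and P = Q = 0, so every angle will do. *)
have [re|rn] := eqVneq r 0.
  exists 0; rewrite cos0 sin0 mul1r mul0r addr0 lexx mulr_ge0 ?pi_ge0//; split => //.
  have : P ^+ 2 + Q ^+ 2 = 0 by rewrite PQ re expr0n.
  move=> h; have : P ^+ 2 = 0 by have := sqr_ge0 P; have := sqr_ge0 Q; lra.
  move/eqP; rewrite sqrf_eq0 => /eqP ->.
  by have := enorm_ge0 x; have := enorm_ge0 y; rewrite /r in re; nra.
have [|phi [phi2 ce se]] := @polar_angle (P / r) (Q / r).
  by rewrite !exprMn -mulrDl PQ -exprMn divff// expr1n.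
exists phi; split => //; rewrite ce se.
have -> : P / r * P + Q / r * Q = (P ^+ 2 + Q ^+ 2) / r by ring.
by rewrite PQ expr2 mulfK// /r; lra.
Qed.

(* Averaging over phi, phi + pi/2, phi + pi, phi + 3pi/2 cancels the first order terms and
   computes the quadratic one without any trigonometric integral. *)
Lemma four_point_average (U a j b l : vec R) (n2 m2 s t C S c0 s0 : R) :
  dotv a a = n2 -> dotv j j = n2 -> dotv a j = 0 ->
  dotv b b = m2 -> dotv l l = m2 -> dotv b l = 0 ->
  C ^+ 2 + S ^+ 2 = 1 -> c0 ^+ 2 + s0 ^+ 2 = 1 ->
  let C' := C * c0 - S * s0 in let S' := S * c0 + C * s0 in
  let W := fun c s1 c' s1' => U + (s *: (c *: a + s1 *: j) - t *: (c' *: b + s1' *: l)) in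
  enorm (W C S C' S') ^+ 2 + enorm (W (- S) C (- S') C') ^+ 2 +
  (enorm (W (- C) (- S) (- C') (- S')) ^+ 2 + enorm (W S (- C) S' (- C')) ^+ 2) =
  4 * (enorm U ^+ 2 + s ^+ 2 * n2 + t ^+ 2 * m2 -
       s * t * (c0 * (dotv a b + dotv j l) + s0 * (dotv a l - dotv j b))).
Proof.
move=> aa jj aj bb ll bl CS cs C' S' W.
have CS' : C' ^+ 2 + S' ^+ 2 = 1.
  by transitivity ((C ^+ 2 + S ^+ 2) * (c0 ^+ 2 + s0 ^+ 2)); [rewrite /C' /S'; ring | rewrite CS cs mulr1].
have norm4 c s1 c' s1' : enorm (W c s1 c' s1') ^+ 2 = enorm U ^+ 2
   + 2 * (s * (c * dotv U a + s1 * dotv U j) - t * (c' * dotv U b + s1' * dotv U l))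
   + (s ^+ 2 * n2 * (c ^+ 2 + s1 ^+ 2) + t ^+ 2 * m2 * (c' ^+ 2 + s1' ^+ 2))
   - 2 * (s * t * (c * c' * dotv a b + c * s1' * dotv a l + s1 * c' * dotv j b + s1 * s1' * dotv j l)).
  rewrite /W !enorm_sqr !dotv_lin aa jj bb ll aj bl (dotvC j a) aj (dotvC l b) bl.
  rewrite (dotvC a U) (dotvC j U) (dotvC b U) (dotvC l U) (dotvC b a) (dotvC l a) (dotvC b j) (dotvC l j).
  ring.
have e1 : C * C' + S * S' = c0.
  by transitivity (c0 * (C ^+ 2 + S ^+ 2)); [rewrite /C' /S'; ring | rewrite CS mulr1].
have e2 : C * S' - S * C' = s0.
  by transitivity (s0 * (C ^+ 2 + S ^+ 2)); [rewrite /C' /S'; ring | rewrite CS mulr1].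
rewrite !norm4 !sqrrN (addrC (S ^+ 2)) (addrC (S' ^+ 2)) CS CS' -e1 -e2.
ring.
Qed.

End vectors.

(** * Finite Kantorovich duality *)

Definition posp {R : realType} (x : R) : R := Num.max x 0.

Section posp.
Context {R : realType}.
Implicit Types x t : R.

Lemma posp_ge0 x : 0 <= posp x.
Proof. by rewrite /posp le_max lexx orbT. Qed.

Lemma posp_ge x : x <= posp x.
Proof. by rewrite /posp le_max lexx. Qed.

Lemma posp_le0 x : x <= 0 -> posp x = 0.
Proof. by move=> h; rewrite /posp; exact/max_idPr. Qed.

Lemma posp_ge0E x : 0 <= x -> posp x = x.
Proof. by move=> h; rewrite /posp; exact/max_idPl. Qed.

(** Second order Taylor bound: [posp] squared is C^1 with derivative 2 * posp, and its second
    derivative is at most 2 where it exists. *)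
Lemma posp_sqrD x t : posp (x + t) ^+ 2 <= posp x ^+ 2 + 2 * t * posp x + t ^+ 2.
Proof.
case: (leP 0 x) => x0; case: (leP 0 (x + t)) => xt0.
- by rewrite !posp_ge0E//; lra.
- rewrite (posp_ge0E x0) (posp_le0 (ltW xt0)) expr2 mul0r.
  by have := sqr_ge0 (x + t); lra.
- rewrite (posp_ge0E xt0) (posp_le0 (ltW x0)) mulr0 (expr2 0) mul0r !add0r.
  by rewrite ler_pXn2r ?nnegrE//; lra.
- by rewrite (posp_le0 (ltW x0)) (posp_le0 (ltW xt0)) mulr0 (expr2 0) mul0r !add0r sqr_ge0.
Qed.

Lemma linear_sqr_le (d n : R) : (forall t, t * d <= n * t ^+ 2) -> d = 0.
Proof.
move=> H; apply/eqP; rewrite -sqrf_eq0 eq_le sqr_ge0 andbT.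
have [n0|n0] := leP n 0.
  by have := H d; have := sqr_ge0 d; nra.
have := H (d / (2 * n)).
have -> : n * (d / (2 * n)) ^+ 2 = (d ^+ 2 / (2 * n)) / 2 by field; rewrite gt_eqF.
have -> : d / (2 * n) * d = d ^+ 2 / (2 * n) by ring.
have := sqr_ge0 d; move=> d0 h.
have : d ^+ 2 / (2 * n) <= 0 by lra.
by rewrite pmulr_lle0// invr_gt0 mulr_gt0.
Qed.

(** No derivative is taken: one coordinate is perturbed by t. By [posp_sqrD] the objective changes
    by a linear term in t up to a multiple of t^2, and maximality for all t of both signs kills the
    linear coefficient. *)
Lemma penalized_foc {I J : finType} (a : I -> R) (w : I -> J -> R) (k : R) (u : I -> R) :
  0 <= k ->
  (forall u', \sum_i (u' i * a i - k * \sum_j posp (u' i + w i j) ^+ 2) <=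
              \sum_i (u i * a i - k * \sum_j posp (u i + w i j) ^+ 2)) ->
  forall i, a i = 2 * k * \sum_j posp (u i + w i j).
Proof.
move=> k0 H i; apply/eqP; rewrite -subr_eq0; apply/eqP.
apply: (@linear_sqr_le _ (k * #|J|%:R)) => t.
have := H (fun l => if l == i then u i + t else u l).
rewrite (bigD1 i)//= eqxx [leRHS](bigD1 i)//=.
rewrite [X in _ + X](eq_bigr (fun i => u i * a i - k * \sum_j posp (u i + w i j) ^+ 2));
  last by move=> l /negbTE ->.
rewrite lerD2r => {}H.
have h : \sum_j posp (u i + t + w i j) ^+ 2 <=
    \sum_j posp (u i + w i j) ^+ 2 + 2 * t * (\sum_j posp (u i + w i j)) + #|J|%:R * t ^+ 2.
  have -> : #|J|%:R * t ^+ 2 = \sum_(j : J) t ^+ 2 by rewrite sumr_const mulr_natl.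
  rewrite mulr_sumr -!big_split /=.
  by apply: ler_sum => j _; rewrite (addrAC (u i) t) posp_sqrD.
have := ler_wpM2l k0 h; lra.
Qed.

End posp.

Section finite_duality.
Context {R : realType} {I J : finType}.
Variables (a : I -> R) (b : J -> R) (c : I -> J -> R) (e : R).
Hypotheses (e0 : 0 < e) (a0 : forall i, 0 < a i) (b0 : forall j, 0 < b j)
  (c0 : forall i j, 0 <= c i j) (a1 : \sum_i a i = 1) (b1 : \sum_j b j = 1).

Let dual (u : I -> R) (v : J -> R) : R :=
  \sum_i u i * a i + \sum_j v j * b j -
  (2 * e)^-1 * \sum_i \sum_j posp (u i + v j - c i j) ^+ 2.

Let term (u : I -> R) (v : J -> R) i j : R :=
  a i * b j * (u i + v j) - (2 * e)^-1 * posp (u i + v j - c i j) ^+ 2.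

Let dualE u v : dual u v = \sum_i \sum_j term u v i j.
Proof.
rewrite /dual /term.
under [RHS]eq_bigr do rewrite sumrB.
rewrite sumrB mulr_sumr; congr (_ - _); last first.
  by apply: eq_bigr => i _; rewrite mulr_sumr.
transitivity (\sum_i \sum_j (u i * a i * b j + a i * (v j * b j))); last first.
  by apply: eq_bigr => i _; apply: eq_bigr => j _; ring.
under [RHS]eq_bigr do rewrite big_split -mulr_sumr -mulr_sumr b1 mulr1.
by rewrite big_split /= -mulr_suml a1 mul1r.
Qed.

Let a_le1 i : a i <= 1.
Proof.
by rewrite -a1 (bigD1 i)//= lerDl sumr_ge0// => k _; exact: ltW.
Qed.

Let b_le1 j : b j <= 1.
Proof.
by rewrite -b1 (bigD1 j)//= lerDl sumr_ge0// => k _; exact: ltW.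
Qed.

Let C : R := \sum_i \sum_j c i j.

Let c_le i j : c i j <= C.
Proof.
rewrite /C (bigD1 i)//= (bigD1 j)//= -addrA lerDl addr_ge0// ?sumr_ge0// => k _.
by rewrite sumr_ge0.
Qed.

Let C0 : 0 <= C. Proof. by rewrite /C sumr_ge0// => i _; rewrite sumr_ge0. Qed.

Let ab01 i j : 0 < a i * b j <= 1.
Proof. by rewrite mulr_gt0//= mulr_ile1// ltW. Qed.

Let term_ub u v i j : term u v i j <= C + e.
Proof.
rewrite /term; set x := u i + v j; set p := posp _.
have p0 : 0 <= p := posp_ge0 _.
have px : x - c i j <= p := posp_ge _.
have /andP[al0 al1] := ab01 i j; set al := a i * b j in al0 al1 *.
have cC := c_le i j; have := c0 i j => cij.
(* Completing the square in p: the quadratic penalty beats the linear gain al * p up to e * al^2 /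
   2. *)
have e2 : (2 * e)^-1 * p ^+ 2 >= al * p - e * al ^+ 2 / 2.
  have -> : (2 * e)^-1 * p ^+ 2 = al * p - e * al ^+ 2 / 2 + (p - e * al) ^+ 2 / (2 * e).
    by field; rewrite gt_eqF.
  by rewrite lerDl divr_ge0 ?sqr_ge0// mulr_ge0// ltW.
have h1 : al * x <= al * (c i j + p) by rewrite ler_pM2l//; lra.
have h2 : al * c i j <= C by apply: le_trans cC; rewrite ler_piMl.
have h3 : e * al ^+ 2 <= e by rewrite (ler_piMr (ltW e0))// exprn_ile1 ?(ltW al0).
move: h1 e2; rewrite mulrDr; set E := _^-1 * _ => h1 e2; have := e0; lra.
Qed.

Let N : R := (#|I| * #|J|)%:R.

(** Each of the N terms is at most C + e, so when their sum is nonnegative none can be very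
    negative. *)
Let term_lb u v i j : 0 <= dual u v -> - (N * (C + e)) <= term u v i j.
Proof.
rewrite dualE => D0.
have Ce : 0 <= C + e by rewrite addr_ge0// ltW.
have -> : N * (C + e) = \sum_(i : I) \sum_(j : J) (C + e).
  rewrite /N; under eq_bigr do rewrite sumr_const.
  by rewrite sumr_const -mulrnA mulr_natl mulnC.
move: D0; rewrite (bigD1 i)//= (bigD1 j)//= => D0.
rewrite (bigD1 i)//= [X in - (X + _)](bigD1 j)//=.
have h1 : \sum_(j0 | j0 != j) term u v i j0 <= \sum_(j0 | j0 != j) (C + e).
  by apply: ler_sum => *; exact: term_ub.
have h2 : \sum_(i0 | i0 != i) \sum_j0 term u v i0 j0 <= \sum_(i0 | i0 != i) \sum_(j0 : J) (C + e).
  by apply: ler_sum => k _; apply: ler_sum => *; exact: term_ub.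
lra.
Qed.

(** A positive lower bound for all products a i * b j: as every weight is at most 1, the product of
    all of them lies below each pair. *)
Let al0 : R := \prod_i a i * \prod_j b j.

Let al0_gt0 : 0 < al0.
Proof. by rewrite mulr_gt0// prodr_gt0. Qed.

Let prod_le (K : finType) (f : K -> R) k : (forall k, 0 < f k <= 1) -> \prod_k f k <= f k.
Proof.
move=> f01; rewrite (bigD1 k)//=; have /andP[/ltW fk0 _] := f01 k.
rewrite (ler_piMr fk0)// big_seq_cond prodr_ile1// => l _.
by have /andP[/ltW -> ->] := f01 l.
Qed.

Let al0_le i j : al0 <= a i * b j.
Proof.
rewrite /al0 ler_pM ?prodr_ge0//.
- by move=> k _; exact: ltW.
- by move=> k _; exact: ltW.
- by apply: prod_le => k; rewrite a0 a_le1.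
- by apply: prod_le => k; rewrite b0 b_le1.
Qed.

(** A bound for |u i + v j| on the set where the dual value is nonnegative. The first summand
    controls negative sums, through the linear term and [term_lb]. The last one controls positive
    sums: beyond 4 * e the penalty exceeds twice the violation, and a violation larger than 4 * (N +
    1) * (C + e) contradicts [term_lb]. *)
Let S : R := N * (C + e) / al0 + C + 4 * (N + 1) * (C + e).

Let bound_sum u v i j : 0 <= dual u v -> `|u i + v j| <= S.
Proof.
move=> /(term_lb i j); rewrite /term; set x := u i + v j; set p := posp _.
have /andP[al0' al1] := ab01 i j; have := al0_le i j; set al := a i * b j in al0' al1 *.
move=> al0l H.
have N0 : 0 <= N by rewrite /N.
have Ce : 0 < C + e by rewrite ltr_wpDl.
have NC : 0 <= N * (C + e) by rewrite mulr_ge0// ltW.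
have p0 : 0 <= p := posp_ge0 _.
have px : x - c i j <= p := posp_ge _.
have pe0 : 0 <= (2 * e)^-1 * p ^+ 2 by rewrite mulr_ge0 ?sqr_ge0// invr_ge0 mulr_ge0// ltW.
have cC := c_le i j; have := c0 i j => cij.
have S1 : 0 <= N * (C + e) / al0 by rewrite divr_ge0// ltW.
have S2 : 0 <= 4 * (N + 1) * (C + e).
  by rewrite mulr_ge0// ?(ltW Ce)// mulr_ge0// addr_ge0.
rewrite ler_norml; apply/andP; split.
- have [x0|x0] := leP 0 x; first by rewrite (le_trans _ x0)// oppr_le0 /S !addr_ge0.
  have h : N * (C + e) / al0 >= - x.
    rewrite ler_pdivlMr//; apply: (@le_trans _ _ (- x * al)); last by lra.
    by rewrite ler_wpM2l// oppr_ge0 ltW.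
  by rewrite /S; lra.
- rewrite leNgt; apply/negP => xS.
  set Q := 4 * (N + 1) * (C + e) in S2 *.
  have xQ : Q < x - c i j by move: xS; rewrite /S -/Q; lra.
  have pE : p = x - c i j by rewrite /p posp_ge0E//; lra.
  have Qe : 4 * e <= Q.
    rewrite /Q -mulrA ler_pM2l// mulrDl mul1r.
    by apply: (@le_trans _ _ (C + e)); [lra | rewrite lerDr].
  have h1 : 2 * p <= (2 * e)^-1 * p ^+ 2.
    rewrite [leRHS]mulrC ler_pdivlMr ?mulr_gt0//.
    have -> : 2 * p * (2 * e) = p * (4 * e) by ring.
    by rewrite expr2 ler_wpM2l//; lra.
  have h2 : al * x <= C + p.
    rewrite (_ : x = c i j + p); last by rewrite pE; ring.
    rewrite mulrDr lerD//; first by apply: le_trans cC; rewrite ler_piMl.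
    by rewrite ler_piMl.
  have : Q < p by rewrite pE.
  rewrite /Q (_ : 4 * (N + 1) * (C + e) = 4 * (N * (C + e)) + 4 * (C + e)); last ring.
  have Ce1 : C <= C + e by rewrite lerDl ltW.
  move: H h1; set E := _^-1 * _ => H h1.
  clear -h1 H h2 NC Ce Ce1; move: H h1 h2 NC Ce Ce1; move: (N * (C + e)) => NCe; move: (C + e) (al * x) (E) (C) (p) => ? ? ? ? ? ? ? ? ? ? ?; lra.
Qed.

Let shiftE u v k : dual (fun i => u i - k) (fun j => v j + k) = dual u v.
Proof.
rewrite /dual; congr (_ - _ * _); last first.
  by apply: eq_bigr => i _; apply: eq_bigr => j _; congr (posp _ ^+ 2); ring.
under eq_bigr do rewrite mulrBl.
under [X in _ + X]eq_bigr do rewrite mulrDl.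
by rewrite sumrB big_split /= -!mulr_sumr a1 b1; ring.
Qed.

Let dual0 : dual (fun=> 0) (fun=> 0) = 0.
Proof.
rewrite /dual !big1 ?addr0 ?mulr0 ?subr0// => i _; rewrite ?mul0r//.
by apply: big1 => j _; rewrite posp_le0 ?expr0n// !add0r oppr_le0.
Qed.

Let K : finType := (I + J)%type.
Let space := prod_topology (fun _ : K => R).
Let dualk (s : space) : R := dual (fun i => s (inl i)) (fun j => s (inr j)).

Let posp_continuous : continuous (@posp R).
Proof.
move=> x; apply: (@continuous_max R R id (fun=> 0) x) => //; exact: cvg_cst.
Qed.

Let dualk_continuous : continuous dualk.
Proof.
have sumc (L : finType) (F : L -> space -> R) : (forall l, continuous (F l)) ->
    continuous (fun s => \sum_l F l s).
  by move=> h; apply: continuous_big => // x; exact: add_continuous.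
have coord (k : K) : continuous (fun s : space => s k) by exact: proj_continuous.
have cI : continuous (fun s : space => \sum_i s (inl i) * a i).
  apply: (sumc _ (fun i (s : space) => s (inl i) * a i)) => i t.
  exact: (@cvgM _ _ (nbhs t) _ (fun s : space => s (inl i)) (fun=> a i) _ _ (coord (inl i) t) (@cvg_cst _ _ _ _ _)).
have cJ : continuous (fun s : space => \sum_j s (inr j) * b j).
  apply: (sumc _ (fun j (s : space) => s (inr j) * b j)) => j t.
  exact: (@cvgM _ _ (nbhs t) _ (fun s : space => s (inr j)) (fun=> b j) _ _ (coord (inr j) t) (@cvg_cst _ _ _ _ _)).
have cIJ : continuous (fun s : space => \sum_i \sum_j posp (s (inl i) + s (inr j) - c i j) ^+ 2).
  apply: (sumc _ (fun i (s : space) => \sum_j posp (s (inl i) + s (inr j) - c i j) ^+ 2)) => i.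
  apply: (sumc _ (fun j (s : space) => posp (s (inl i) + s (inr j) - c i j) ^+ 2)) => j t.
  apply: (@continuous_comp _ _ _ (fun s : space => posp (s (inl i) + s (inr j) - c i j)) (fun x => x ^+ 2)); last exact: exprn_continuous.
  apply: (@continuous_comp _ _ _ (fun s : space => s (inl i) + s (inr j) - c i j) (@posp R)); last exact: posp_continuous.
  exact: (cvgB (cvgD (coord (inl i) t) (coord (inr j) t)) (@cvg_cst _ _ _ _ _)).
move=> s; exact: (cvgB (cvgD (cI s) (cJ s)) (cvgM (@cvg_cst _ _ _ _ _) (cIJ s))).
Qed.

(** The dual value is invariant under u - k, v + k, so it is coercive only in the sums u i + v j.
    Normalizing u i0 = 0 turns the bound S on the sums into the bound 2 * S on every coordinate, and
    a maximum over the compact cube is a global one. *)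
Let dual_max (i0 : I) (j0 : J) : exists u v, forall u' v', dual u' v' <= dual u v.
Proof.
have S0 : 0 <= S.
  apply: le_trans (@bound_sum (fun=> 0) (fun=> 0) i0 j0 _) => //.
  by rewrite dual0.
pose A := [set f : space | forall k, [set` `[- (2 * S), 2 * S]] (f k)].
have cA : compact A by exact: (@tychonoff K (fun=> R) (fun=> [set` `[- (2 * S), 2 * S]]) (fun=> @segment_compact _ _ _)).
have A0 : A !=set0.
  by exists (fun=> 0) => k /=; rewrite in_itv /= oppr_le0 andbb mulr_ge0.
have [s _ sM] := compact_EVT_max A0 cA (continuous_subspaceT dualk_continuous).
exists (fun i => s (inl i)), (fun j => s (inr j)) => u v.
have D0 : 0 <= dualk s.
  rewrite -dual0; apply: (sM (fun=> 0)); rewrite inE => k /=.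
  by rewrite in_itv /= oppr_le0 andbb mulr_ge0.
have [uv0|uv0] := ltP (dual u v) 0.
  by apply: le_trans (ltW uv0) D0.
rewrite -(shiftE u v (u i0)).
pose t : space := fun k => match k with inl i => u i - u i0 | inr j => v j + u i0 end.
have tA : t \in A.
  rewrite inE => -[i|j] /=; rewrite in_itv /= -ler_norml.
    have -> : u i - u i0 = (u i + v j0) - (u i0 + v j0) by ring.
    apply: le_trans (ler_normB _ _) _.
    by have := bound_sum i j0 uv0; have := bound_sum i0 j0 uv0; lra.
  have := bound_sum i0 j uv0; rewrite addrC; move: S0; lra.
exact: sM tA.
Qed.

Lemma finite_duality : exists (u : I -> R) (v : J -> R) (p : I -> J -> R),
  [/\ forall i j, 0 <= p i j, forall i, \sum_j p i j = a i, forall j, \sum_i p i j = b j,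
      forall i j, u i + v j <= c i j &
      \sum_i \sum_j c i j * p i j <= \sum_i u i * a i + \sum_j v j * b j + e].
Proof.
have [i0 _] : exists i : I, true.
  case: (pickP (@predT I)) => [i _|I0]; first by exists i.
  by exfalso; move: a1; rewrite big_pred0// => /esym/eqP; rewrite oner_eq0.
have [j0 _] : exists j : J, true.
  case: (pickP (@predT J)) => [j _|J0]; first by exists j.
  by exfalso; move: b1; rewrite big_pred0// => /esym/eqP; rewrite oner_eq0.
have [u [v uvM]] := dual_max i0 j0.
have e20 : 0 <= (2 * e)^-1 by rewrite invr_ge0 mulr_ge0// ltW.
(* The multiplier of the penalized constraint. The first-order conditions in u and in v, with k = 1
   / (2 * e), are its two marginal conditions. *)
pose p i j := posp (u i + v j - c i j) / e.
have p0 i j : 0 <= p i j by rewrite divr_ge0 ?posp_ge0// ltW.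
have pa i : \sum_j p i j = a i.
  rewrite (@penalized_foc _ _ _ a (fun i j => v j - c i j) _ u e20 _ i).
    rewrite /p -mulr_suml mulrC; under eq_bigr do rewrite -addrA.
    by rewrite invfM mulrA divff// mul1r.
  have dE u' : \sum_i (u' i * a i - (2 * e)^-1 * \sum_j posp (u' i + (v j - c i j)) ^+ 2)
      = dual u' v - \sum_j v j * b j.
    rewrite sumrB -mulr_sumr /dual.
    rewrite (_ : \sum_i \sum_j posp (u' i + (v j - c i j)) ^+ 2 =
                 \sum_i \sum_j posp (u' i + v j - c i j) ^+ 2); first ring.
    by apply: eq_bigr => k _; apply: eq_bigr => j _; rewrite addrA.
  by move=> u'; rewrite !dE lerD2r.
have pb j : \sum_i p i j = b j.
  rewrite (@penalized_foc _ _ _ b (fun j i => u i - c i j) _ v e20 _ j).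
    rewrite /p -mulr_suml mulrC; under eq_bigr do rewrite addrAC addrC.
    by rewrite invfM mulrA divff// mul1r.
  have dE v' : \sum_j (v' j * b j - (2 * e)^-1 * \sum_i posp (v' j + (u i - c i j)) ^+ 2)
      = dual u v' - \sum_i u i * a i.
    rewrite sumrB -mulr_sumr /dual.
    rewrite (_ : \sum_j \sum_i posp (v' j + (u i - c i j)) ^+ 2 =
                 \sum_i \sum_j posp (u i + v' j - c i j) ^+ 2); first ring.
    rewrite exchange_big; apply: eq_bigr => i _; apply: eq_bigr => k _.
    by rewrite addrA [v' _ + _]addrC.
  by move=> v'; rewrite !dE lerD2r.
(* Complementary slackness: p charges only the pairs where the constraint is violated or
   saturated. *)
have pc i j : c i j * p i j <= (u i + v j) * p i j.
  have [h|/ltW h] := leP (u i + v j - c i j) 0.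
    by rewrite /p posp_le0// mul0r !mulr0.
  by rewrite (ler_wpM2r (p0 i j))// -subr_ge0.
(* Since p i j <= a i <= 1, no violation exceeds e. Lowering u by e restores the constraint and
   costs exactly e in the dual value. *)
exists (fun i => u i - e), v, p; split=> //.
- move=> i j; have : p i j <= 1.
    rewrite (le_trans _ (a_le1 i))// -pa (bigD1 j)//= lerDl sumr_ge0// => *.
  rewrite /p ler_pdivrMr// mul1r => h.
  by have := posp_ge (u i + v j - c i j); lra.
- have -> : \sum_i (u i - e) * a i = \sum_i u i * a i - e.
    under eq_bigr do rewrite mulrBl.
    by rewrite sumrB -mulr_sumr a1 mulr1.
  apply: (@le_trans _ _ (\sum_i \sum_j (u i + v j) * p i j)).
    by apply: ler_sum => i _; apply: ler_sum => j _; exact: pc.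
  have -> : \sum_i \sum_j (u i + v j) * p i j = \sum_i u i * a i + \sum_j v j * b j.
    under eq_bigr do under eq_bigr do rewrite mulrDl.
    under eq_bigr do rewrite big_split /= -mulr_sumr pa.
    rewrite big_split /= exchange_big /=; congr (_ + _).
    by apply: eq_bigr => j _; rewrite -mulr_sumr pb.
  by lra.
Qed.

End finite_duality.

(** * Integration against densities and powers *)

Section ge0_induction.
Import HBNNSimple.
Local Open Scope ereal_scope.
Context d (T : measurableType d) (R : realType).
Variable P : (T -> \bar R) -> Prop.
Let good (f : T -> \bar R) := measurable_fun setT f /\ forall x, 0 <= f x.
Hypothesis Pindic : forall A : set T, measurable A -> P (fun x => (\1_A x)%:E).
Hypothesis PZ : forall (r : R) f, (0 <= r)%R -> good f -> P f -> P (fun x => r%:E * f x).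
Hypothesis PD : forall f g, good f -> good g -> P f -> P g -> P (fun x => f x + g x).
Hypothesis Plim : forall f : (T -> \bar R)^nat,
  (forall n, good (f n)) -> (forall x, nondecreasing_seq (f ^~ x)) ->
  (forall n, P (f n)) -> P (fun x => limn (f ^~ x)).

(** Monotone class induction through the standard approximation by simple functions. *)
Lemma ge0_measurable_ind f : measurable_fun setT f -> (forall x, 0 <= f x) -> P f.
Proof.
move=> mf f0.
have Pnn (h : {nnsfun T >-> R}) : P (fun x => (h x)%:E).
  (* The test 0 <= y, always true on the range of h, makes each summand fit the sign condition of
     [PZ] without recording that y is a value of h. *)
  have hE : (fun x => (h x)%:E) = (fun x => \sum_(y <- finmap.enum_fset (fset_set (range h)))
      (if (0 <= y)%R then y%:E * (\1_(h @^-1` [set y]) x)%:E else 0)).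
    apply/funext => x /=; rewrite [in LHS]fimfunE fsbig_finite//= -sumEFin; apply: eq_big_seq => y.
    rewrite in_fset_set// inE => -[z _ <-].
    by rewrite fun_ge0.
  rewrite hE; elim: (finmap.enum_fset _) => [|y s IH].
    have -> : (fun x : T => \sum_(y <- [::]) (if (0 <= y)%R then y%:E * (\1_(h @^-1` [set y]) x)%:E else 0)) = (fun x => (\1_(set0 : set T) x)%:E).
      by apply/funext => x; rewrite big_nil indic0.
    exact: Pindic.
  have mind z : measurable_fun setT (fun x => (\1_(h @^-1` [set z]) x)%:E : \bar R).
    exact/measurable_EFinP.
  have gy z : good (fun x => if (0 <= z)%R then z%:E * (\1_(h @^-1` [set z]) x)%:E else 0).
    case: (boolP (0 <= z)%R) => z0; split => // x.
    - by apply: emeasurable_funM.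
    - by rewrite mule_ge0 ?lee_fin.
  have Py : P (fun x => if (0 <= y)%R then y%:E * (\1_(h @^-1` [set y]) x)%:E else 0).
    case: (boolP (0 <= y)%R) => y0; last first.
      rewrite (_ : (fun _ => _) = (fun x => (\1_(set0 : set T) x)%:E)); first exact: Pindic.
      by apply/funext => x; rewrite indic0.
    by apply: PZ => //; exact: Pindic.
  rewrite (_ : (fun x => _) = (fun x => (if (0 <= y)%R then y%:E * (\1_(h @^-1` [set y]) x)%:E else 0) + \sum_(z <- s) (if (0 <= z)%R then z%:E * (\1_(h @^-1` [set z]) x)%:E else 0))); last first.
    by apply/funext => x; rewrite big_cons.
  apply: PD => //; split=> [|x].
    by apply: emeasurable_sum => z; have [] := gy z.
  by apply: sume_ge0 => z _; have [_] := gy z.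
pose h := nnsfun_approx measurableT mf.
have -> : f = (fun x => limn ((fun n => EFin \o h n) ^~ x)).
  apply/funext => x; apply/esym/cvg_lim => //.
  by apply: cvg_nnsfun_approx => //.
apply: Plim => [n|x|n]; last exact: Pnn.
  split=> [|x /=]; last by rewrite lee_fin.
  exact/measurable_EFinP.
by move=> m n mn; rewrite lee_fin; exact/lefP/nd_nnsfun_approx.
Qed.

End ge0_induction.

Section density.
Local Open Scope ereal_scope.
Context d (T : measurableType d) (R : realType).
Variables (mu nu : {measure set T -> \bar R}) (g : T -> \bar R).
Hypotheses (mg : measurable_fun setT g) (g0 : forall x, 0 <= g x)
  (nuE : forall A, measurable A -> nu A = \int[mu]_(x in A) g x).

Lemma ge0_integral_density f : measurable_fun setT f -> (forall x, 0 <= f x) ->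
  \int[nu]_x f x = \int[mu]_x (f x * g x).
Proof.
move: f; apply: (@ge0_measurable_ind _ _ _ (fun f => \int[nu]_x f x = \int[mu]_x (f x * g x))).
- move=> A mA; rewrite integral_indic// setIT nuE// integral_mkcond.
  apply: eq_integral => x _; rewrite patchE indicE.
  by case: (x \in A); rewrite ?mul1e ?mul0e.
- move=> r f r0 [mf f0] IH; rewrite ge0_integralZl ?lee_fin//.
  rewrite IH -ge0_integralZl//.
  + by apply: eq_integral => x _; rewrite muleA.
  + exact: emeasurable_funM.
  + by move=> x _; rewrite mule_ge0.
- move=> f h [mf f0] [mh h0] IHf IHh.
  rewrite ge0_integralD// IHf IHh -ge0_integralD//.
  + by apply: eq_integral => x _; rewrite ge0_muleDl.
  + by move=> x _; rewrite mule_ge0.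
  + exact: emeasurable_funM.
  + by move=> x _; rewrite mule_ge0.
  + exact: emeasurable_funM.
- move=> f gf ndf IH.
  have mf n : measurable_fun setT (f n) by case: (gf n).
  have f0 n x : setT x -> 0 <= f n x by case: (gf n).
  have ndf' x : setT x -> nondecreasing_seq (f ^~ x) by move=> _; exact: ndf.
  rewrite monotone_convergence//.
  under eq_fun do rewrite IH.
  have mfg n : measurable_fun setT (fun x => f n x * g x) by exact: emeasurable_funM.
  have fg0 n x : setT x -> 0 <= f n x * g x by move=> _; rewrite mule_ge0// f0.
  have ndfg x : setT x -> nondecreasing_seq (fun n => f n x * g x).
    by move=> _ m n mn; rewrite lee_wpmul2r//; exact: ndf.
  rewrite -monotone_convergence//.
  apply: eq_integral => x _.
  have cf : cvgn (f ^~ x) by apply: ereal_nondecreasing_is_cvgn; exact: ndf.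
  (* Multiplication by g x commutes with the limit when g x is finite. For g x = +oo the products
     are 0 or +oo, and they are constantly +oo from the first n with f n x > 0. *)
  have [gx|gx] := boolP (g x \is a fin_num).
    by apply/cvg_lim => //; exact: cvgeZr.
  have {gx} gE : g x = +oo by move: gx (g0 x); case: (g x).
  rewrite gE.
  have [f00|[n fn]] : (forall n, f n x = 0) \/ exists n, 0 < f n x.
    case: (pselect (exists n, 0 < f n x)); first by right.
    move=> H; left=> n; apply/eqP; rewrite eq_le; have [_ ->] := gf n; rewrite andbT.
    by rewrite leNgt; apply/negP => h; apply: H; exists n.
  + under [in LHS]eq_fun do rewrite f00 mul0e.
    have -> : f ^~ x = (fun=> 0) by apply/funext.
    by rewrite !lim_cst// mul0e.
  + transitivity (+oo : \bar R); last first.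
      apply/esym/gt0_muley.
      apply: lt_le_trans fn _; have /cvg_lim -> // := ereal_nondecreasing_cvgn (ndf x).
      by apply: ereal_sup_ubound; exists n.
    apply/cvg_lim => //; apply: (cvg_near_cst (+oo : \bar R)).
    exists n => // m /= nm; rewrite gt0_muley//.
    by apply: lt_le_trans fn _; exact: ndf.
Qed.

End density.

Section mdensity.
Local Open Scope ereal_scope.
Context d (T : measurableType d) (R : realType).
Variables (mu : {measure set T -> \bar R}) (g : T -> \bar R).
Hypotheses (mg : measurable_fun setT g) (g0 : forall x, 0 <= g x).

(** The two proofs are arguments so that the measure structure can be inferred from the term
    itself. *)
Definition mdensity of measurable_fun setT g & (forall x, 0 <= g x) :=
  fun A : set T => \int[mu]_(x in A) g x.

Local Notation md := (mdensity mg g0).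

Let md0 : md set0 = 0.
Proof. by rewrite /mdensity integral_set0. Qed.

Let md_ge0 A : 0 <= md A.
Proof. by apply: integral_ge0 => x _; exact: g0. Qed.

Let md_sigma_additive : semi_sigma_additive md.
Proof.
move=> /= F mF tF mUF; rewrite /mdensity; apply: cvg_toP.
  apply: ereal_nondecreasing_is_cvgn => m n mn.
  by apply: lee_sum_nneg_natr => // k _ _; apply: integral_ge0.
by rewrite ge0_integral_bigcup//=; exact: measurable_funTS.
Qed.

HB.instance Definition _ := isMeasure.Build _ _ _ md md0 md_ge0 md_sigma_additive.

Lemma ge0_integral_mdensity f : measurable_fun setT f -> (forall x, 0 <= f x) ->
  \int[md]_x f x = \int[mu]_x (f x * g x).
Proof. exact: ge0_integral_density. Qed.

End mdensity.

Section power_integrals.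
Context {R : realType}.
Local Notation mu := (@lebesgue_measure R).

Lemma integral_powR (r a b : R) : r != -1 -> 0 < a -> a < b ->
  (\int[mu]_(x in `[a, b]) (x `^ r)%:E = ((b `^ (r + 1) - a `^ (r + 1)) / (r + 1))%:E)%E.
Proof.
move=> r1 a0 ab.
have r10 : r + 1 != 0 by rewrite addr_eq0.
have dp (s x : R) : 0 < x -> derivable (@powR R ^~ s) x 1.
  by move=> x0; apply: derivable_powR; rewrite in_itv/= x0.
have cp (s x : R) : 0 < x -> {for x, continuous (@powR R ^~ s)}.
  by move=> x0; apply/differentiable_continuous/derivable1_diffP/dp.
rewrite (@continuous_FTC2 _ _ (fun x => x `^ (r + 1) / (r + 1)))//.
- by rewrite -EFinB -mulrBl.
- apply: continuous_in_subspaceT => x; rewrite inE /= in_itv /= => /andP[ax _].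
  by apply: cp; rewrite (lt_le_trans a0).
- split.
  + move=> x; rewrite in_itv/= => /andP[ax _]; apply: derivableM => //; first exact: dp (lt_trans a0 ax).
  + apply: cvg_at_right_filter; apply: cvgM; last exact: cvg_cst. exact: cp.
  + apply: cvg_at_left_filter; apply: cvgM; last exact: cvg_cst. exact: cp (lt_trans a0 ab).
- move=> x; rewrite in_itv/= => /andP[ax _].
  have x0 : 0 < x := lt_trans a0 ax.
  rewrite derive1E deriveM//; last exact: dp.
  rewrite derive_cst scaler0 add0r -derive1E powR_derive1 ?in_itv/= ?x0//.
  by rewrite /GRing.scale/= addrK mulrA mulVf// mul1r.
Qed.

Lemma integral_powR_near0 (s b : R) : 0 <= s < 1 -> 0 < b ->
  (\int[mu]_(x in `]0%R, b]) (x `^ (- s))%:E <= (b `^ (1 - s) / (1 - s))%:E)%E.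
Proof.
move=> /andP[s0 s1] b0.
have mp : measurable_fun setT (fun x : measurableTypeR R => ((x : R) `^ (- s))%:E).
  by apply/measurable_EFinP; exact: measurable_powR.
pose F (n : nat) : set (measurableTypeR R) := [set` `](b / n.+1%:R), b]].
have FE : [set` `]0%R, b]] = \bigcup_n F n.
  apply/seteqP; split=> x /=.
    rewrite in_itv/= => /andP[x0 xb].
    exists (Num.truncn (b / x)) => //; rewrite /F /= in_itv/= xb andbT.
    rewrite ltr_pdivrMr// mulrC -ltr_pdivrMr//.
    exact: truncnS_gt.
  move=> [n _]; rewrite /F /= !in_itv/= => /andP[h ->]; rewrite andbT.
  by apply: le_lt_trans h; rewrite divr_ge0// ltW.
have mF n : measurable (F n) by exact: measurable_itv.
rewrite FE.
have := @ge0_nondecreasing_set_cvg_integral _ _ _ F (fun x : measurableTypeR R => ((x : R) `^ (- s))%:E) mu.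
move=> /(_ _ _ _ _)/cvg_lim <- //.
- apply: lime_le; first apply: ereal_nondecreasing_is_cvgn.
    apply/nondecreasing_seqP => n; apply: ge0_subset_integral => //=.
    + exact: measurable_funTS mp.
    + by move=> x _; rewrite lee_fin powR_ge0.
    + move=> x; rewrite /F /= !in_itv/= => /andP[h ->]; rewrite andbT.
      by apply: le_lt_trans h; rewrite ler_pM2l// lef_pV2 ?posrE// ler_nat.
  apply: nearW => n.
  have [->|n0] := eqVneq n 0%N.
    rewrite /F divr1 set_itvoc0 integral_set0 lee_fin divr_ge0 ?powR_ge0//.
    by rewrite subr_ge0 ltW.
  have bd : (\int[mu]_(x in F n) ((x : R) `^ (- s))%:E <= \int[mu]_(x in [set` `[(b / n.+1%:R)%R, b]]) ((x : R) `^ (- s))%:E)%E.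
    apply: ge0_subset_integral => //.
    + exact: measurable_funTS mp.
    + by move=> x _; rewrite lee_fin powR_ge0.
    + by move=> x; rewrite /F /= !in_itv/= => /andP[/ltW -> ->].
  apply: (le_trans bd); rewrite integral_powR ?divr_gt0//.
  + rewrite lee_fin !(addrC (- s)) ler_pM2r ?invr_gt0 ?subr_gt0// gerBl powR_ge0//.
  + by rewrite eqr_opp lt_eqF.
  + by rewrite ltr_pdivrMr// ltr_pMr// ltr1n ltnS lt0n.
- apply/nondecreasing_seqP => n; rewrite subsetEset => x; rewrite /F /= !in_itv/= => /andP[h ->].
  rewrite andbT; apply: le_lt_trans h; rewrite ler_pM2l// lef_pV2 ?posrE// ler_nat//.
- by move=> n; exact: measurable_funTS mp.
- by move=> n x _; rewrite lee_fin powR_ge0.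
Qed.

Lemma integral_powR_infty (s a : R) : 1 < s -> 0 < a ->
  (\int[mu]_(x in `]a, +oo[) (x `^ (- s))%:E <= (a `^ (1 - s) / (s - 1))%:E)%E.
Proof.
move=> s1 a0.
have mp : measurable_fun setT (fun x : measurableTypeR R => ((x : R) `^ (- s))%:E).
  by apply/measurable_EFinP; exact: measurable_powR.
pose F (n : nat) : set (measurableTypeR R) := [set` `]a, (a + n%:R)]].
have FE : [set` `]a, +oo[] = \bigcup_n F n.
  apply/seteqP; split=> x /=.
    rewrite in_itv/= andbT => ax.
    exists (Num.truncn (x - a)).+1 => //; rewrite /F /= in_itv/= ax /= -lerBlDl.
    by rewrite ltW// truncnS_gt.
  by move=> [n _]; rewrite /F /= !in_itv/= andbT => /andP[].
have mF n : measurable (F n) by exact: measurable_itv.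
rewrite FE.
have := @ge0_nondecreasing_set_cvg_integral _ _ _ F (fun x : measurableTypeR R => ((x : R) `^ (- s))%:E) mu.
have sub m : F m `<=` F m.+1.
  move=> x; rewrite /F /= !in_itv/= => /andP[-> h]/=.
  by apply: (le_trans h); rewrite lerD2l ler_nat.
move=> /(_ _ _ _ _)/cvg_lim <- //.
- apply: lime_le; first apply: ereal_nondecreasing_is_cvgn.
    apply/nondecreasing_seqP => n; apply: ge0_subset_integral => //=.
    + exact: measurable_funTS mp.
    + by move=> x _; rewrite lee_fin powR_ge0.
  apply: nearW => n.
  have [->|n0] := eqVneq n 0%N.
    rewrite /F addr0 set_itvoc0 integral_set0 lee_fin divr_ge0 ?powR_ge0//.
    by rewrite subr_ge0 ltW.
  have bd : (\int[mu]_(x in F n) ((x : R) `^ (- s))%:E <= \int[mu]_(x in [set` `[a, (a + n%:R)%R]]) ((x : R) `^ (- s))%:E)%E.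
    apply: ge0_subset_integral => //.
    + exact: measurable_funTS mp.
    + by move=> x _; rewrite lee_fin powR_ge0.
    + by move=> x; rewrite /F /= !in_itv/= => /andP[/ltW -> ->].
  apply: (le_trans bd); rewrite integral_powR//.
  + rewrite lee_fin (_ : - s + 1 = - (s - 1)); last by rewrite opprB addrC.
    rewrite invrN mulrN -mulNr opprB (_ : 1 - s = - (s - 1)); last by rewrite opprB.
    by rewrite ler_pM2r ?invr_gt0 ?subr_gt0// gerBl powR_ge0.
  + by rewrite eqr_opp gt_eqF.
  + by rewrite ltrDl ltr0n lt0n.
- by apply/nondecreasing_seqP => n; rewrite subsetEset; exact: sub.
- by move=> n; exact: measurable_funTS mp.
- by move=> n x _; rewrite lee_fin powR_ge0.
Qed.

End power_integrals.

(** * The inverse of the angular kernel *)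

Section angular.
Context {R : realType} (nu : R) (beta : R -> R) (c0 c1 : R).
Hypotheses (nu01 : 0 < nu < 1) (c00 : 0 < c0)
  (mb : measurable_fun `]0, pi] beta)
  (b_ge0 : {in `]0, pi], forall t, 0 <= beta t})
  (b_bnd : {in `]0, pi / 2[, forall t, c0 * t `^ (- 1 - nu) <= beta t <= c1 * t `^ (- 1 - nu)})
  (b_zero : {in `[pi / 2, pi], forall t, beta t = 0}).
Local Notation mu := (@lebesgue_measure R).
Local Notation R' := (measurableTypeR R).

(** Extending the kernel by zero makes its tails integrals over half-lines. *)
Definition cutk (t : R') : R := if (0 < t) && (t < pi / 2) then beta t else 0.

Let pi2_gt0 : 0 < pi / 2 :> R. Proof. by rewrite divr_gt0// pi_gt0. Qed.

Let c10 : 0 < c1.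
Proof.
have h : (pi / 4 : R) \in `]0, (pi / 2 : R)[.
  by rewrite in_itv /= divr_gt0 ?pi_gt0//=; have := pi_gt0 R; lra.
have /andP[h1 h2] := b_bnd h.
have p0 : 0 < (pi / 4 : R) `^ (- 1 - nu) by rewrite powR_gt0// divr_gt0 ?pi_gt0.
by rewrite -(pmulr_lgt0 _ p0); apply: lt_le_trans (le_trans h1 h2); rewrite mulr_gt0.
Qed.

Lemma cutkE t : t \in `]0, (pi / 2 : R)] -> cutk t = beta t.
Proof.
rewrite in_itv/= /cutk => /andP[-> /=]; rewrite le_eqVlt => /orP[/eqP ->|->//].
rewrite ltxx b_zero// in_itv/= lexx/=; have := pi_gt0 R; lra.
Qed.

Lemma cutk_ge0 t : 0 <= cutk t.
Proof.
rewrite /cutk; case: ifP => // /andP[t0 t1]; apply: b_ge0.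
by rewrite in_itv/= t0 /=; have := pi_gt0 R; lra.
Qed.

Lemma cutk_le t : 0 < t -> cutk t <= c1 * t `^ (- 1 - nu).
Proof.
move=> t0; rewrite /cutk; case: ifP => [/andP[_ t1]|_].
  by have /b_bnd/andP[] : (t : R) \in `]0, (pi / 2 : R)[ by rewrite in_itv/= t0 t1.
by rewrite mulr_ge0 ?powR_ge0// ltW.
Qed.

Lemma cutk_lb t : 0 < t < pi / 2 -> c0 * t `^ (- 1 - nu) <= cutk t.
Proof.
move=> t01; rewrite /cutk t01.
by have /b_bnd/andP[] : (t : R) \in `]0, (pi / 2 : R)[ by rewrite in_itv/=.
Qed.

Lemma measurable_cutk : measurable_fun setT cutk.
Proof.
have -> : cutk = beta \_ `]0, (pi / 2 : R)[.
  apply/funext => t; rewrite /cutk patchE.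
  case: ifPn; case: ifPn => //; rewrite ?inE/= ?in_itv/=.
  - by move/negP; rewrite inE /= in_itv /=.
  - by move=> -> .
apply/(measurable_restrictT _ _).1 => //.
apply: measurable_funS mb => // t /=; rewrite !in_itv/= => /andP[-> /= h].
by have := pi_gt0 R; lra.
Qed.

Let mcutk D : measurable_fun D (EFin \o cutk).
Proof. by apply: measurable_funTS; apply/measurable_EFinP; exact: measurable_cutk. Qed.

(** The intensity of collisions with angle larger than t. It is finite for t > 0 and unbounded as t
    tends to 0, hence the extended value here and the real one [H] below. *)
Let HE (t : R) : \bar R := (\int[mu]_(x in `]t, +oo[) (cutk x)%:E)%E.

Let HE_ge0 t : (0 <= HE t)%E.
Proof. by apply: integral_ge0 => x _; rewrite lee_fin cutk_ge0. Qed.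

Lemma HE_le (t : R) : 0 < t -> (HE t <= (c1 / nu * t `^ (- nu))%:E)%E.
Proof.
move=> t0; have /andP[nu0 nu1] := nu01.
apply: (@le_trans _ _ (\int[mu]_(x in `]t, +oo[) (c1%:E * (x `^ (- (1 + nu)))%:E))%E).
  apply: ge0_le_integral => //=.
  - by move=> x _; rewrite lee_fin cutk_ge0.
  - apply: measurable_funTS; apply: emeasurable_funM => //.
    by apply/measurable_EFinP; exact: measurable_powR.
  - move=> x; rewrite in_itv/= andbT => tx; rewrite -EFinM lee_fin opprD.
    by rewrite cutk_le// (lt_trans t0).
have mpw : measurable_fun [set` `]t, +oo[] (fun x : R' => ((x : R) `^ (- (1 + nu)))%:E).
  by apply: measurable_funTS; apply/measurable_EFinP; exact: measurable_powR.
rewrite ge0_integralZl ?lee_fin ?(ltW c10)//=; last by move=> x _; rewrite lee_fin powR_ge0.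
apply: (@le_trans _ _ (c1%:E * (t `^ (1 - (1 + nu)) / (1 + nu - 1))%:E)%E).
  by rewrite lee_pmul2l// ?lte_fin//; apply: integral_powR_infty; lra.
rewrite -EFinM lee_fin (_ : 1 - (1 + nu) = - nu); last by ring.
by rewrite (_ : 1 + nu - 1 = nu); [rewrite mulrAC mulrA | ring].
Qed.

Let H (t : R) : R := fine (HE t).

Let HEE t : 0 < t -> HE t = (H t)%:E.
Proof.
move=> t0; rewrite fineK// ge0_fin_numE//.
by apply: le_lt_trans (HE_le t0) _; rewrite ltry.
Qed.

Let H_ge0 t : 0 <= H t. Proof. exact: fine_ge0. Qed.

Let H_le t : 0 < t -> H t <= c1 / nu * t `^ (- nu).
Proof. by move=> t0; rewrite -lee_fin -HEE// HE_le. Qed.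

Let H_zero t : pi / 2 <= t -> H t = 0.
Proof.
move=> t2; rewrite /H /HE integral0_eq// => x /=; rewrite in_itv/= andbT => tx.
by rewrite /cutk [x < _]ltNge (ltW (le_lt_trans t2 tx)) andbF.
Qed.

Let HEB s t : 0 < s -> s <= t ->
  ((H s - H t)%:E = \int[mu]_(x in `]s, t]) (cutk x)%:E)%E.
Proof.
move=> s0 st; have t0 := lt_le_trans s0 st.
have : HE s = (\int[mu]_(x in `]s, t]) (cutk x)%:E + HE t)%E.
  rewrite /HE (_ : [set` `]s, +oo[] = [set` `]s, t]] `|` [set` `]t, +oo[]); last first.
    apply/seteqP; split => x /=; rewrite !in_itv/= !andbT.
      by move=> ->/=; case: (leP x t); [left|right].
    by move=> [/andP[]//|/(le_lt_trans st)].
  rewrite ge0_integral_setU//=.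
  - by move=> x _; rewrite lee_fin cutk_ge0.
  - apply/disj_setPS => x /=; rewrite !in_itv/= andbT => -[/andP[_ xt] tx].
    by have := lt_le_trans tx xt; rewrite ltxx.
rewrite !HEE// EFinB => ->; rewrite addeK//.
Qed.

Let H_noninc s t : 0 < s -> s <= t -> H t <= H s.
Proof.
move=> s0 st; rewrite -subr_ge0 -lee_fin HEB//.
by apply: integral_ge0 => x _; rewrite lee_fin cutk_ge0.
Qed.

Let H_lip s t : 0 < s -> s <= t -> H s - H t <= c1 * s `^ (- 1 - nu) * (t - s).
Proof.
move=> s0 st; rewrite -lee_fin HEB//.
apply: (@le_trans _ _ (\int[mu]_(x in `]s, t]) (c1 * s `^ (- 1 - nu))%:E)%E).
  apply: ge0_le_integral => //=.
  - by move=> x _; rewrite lee_fin cutk_ge0.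
  - move=> x; rewrite in_itv/= => /andP[sx _]; rewrite lee_fin.
    apply: le_trans (cutk_le (lt_trans s0 sx)) _; rewrite ler_pM2l//.
    rewrite -opprD !powRN lef_pV2 ?posrE ?powR_gt0//; last exact: lt_trans sx.
    have /andP[n0 _] := nu01.
    by apply: ge0_ler_powR; rewrite ?nnegrE ?addr_ge0// ltW//; apply: lt_trans sx.
rewrite integral_cst//= lebesgue_measure_itv/= lte_fin; case: ltP => [_|ts].
  by rewrite -EFinB -EFinM.
by rewrite mule0 lee_fin mulr_ge0 ?mulr_ge0 ?powR_ge0 ?subr_ge0// ltW.
Qed.

Let H_lb s t : 0 < s -> s <= t -> t <= pi / 2 -> c0 * t `^ (- 1 - nu) * (t - s) <= H s - H t.
Proof.
move=> s0 st t2; rewrite -lee_fin HEB//.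
apply: (@le_trans _ _ (\int[mu]_(x in `]s, t[) (c0 * t `^ (- 1 - nu))%:E)%E).
  rewrite integral_cst//= lebesgue_measure_itv/= lte_fin; case: ltP => [_|ts].
    by rewrite -EFinB -EFinM.
  by rewrite mule0 lee_fin pmulr_rle0 ?subr_le0// mulr_gt0// powR_gt0// (lt_le_trans s0).
apply: (@le_trans _ _ (\int[mu]_(x in `]s, t[) (cutk x)%:E)%E); last first.
  apply: ge0_subset_integral => //=.
  - by move=> x _; rewrite lee_fin cutk_ge0.
  - by move=> x /=; rewrite !in_itv/= => /andP[-> /ltW].
apply: ge0_le_integral => //=.
- by move=> x _; rewrite lee_fin mulr_ge0 ?powR_ge0// ltW.
- move=> x; rewrite in_itv/= => /andP[sx xt]; rewrite lee_fin.
  have x0 := lt_trans s0 sx.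
  apply: (@le_trans _ _ (c0 * x `^ (- 1 - nu))); last first.
    by apply: cutk_lb; rewrite x0 (lt_le_trans xt).
  rewrite ler_pM2l// -opprD !powRN lef_pV2 ?posrE ?powR_gt0//; last exact: lt_trans xt.
  have /andP[n0 _] := nu01.
  by apply: ge0_ler_powR; rewrite ?nnegrE ?addr_ge0// ltW//; apply: lt_trans xt.
Qed.

Let H_unbounded (z : R) : exists t, 0 < t /\ z < H t.
Proof.
have /andP[n0 n1] := nu01.
(* H t >= c0 t (2 t)^(-1-nu) = c0 2^(-1-nu) t^(-nu) *)
pose k := c0 * 2 `^ (- 1 - nu).
have k0 : 0 < k by rewrite mulr_gt0// powR_gt0.
pose y := Num.max (z + 1) 1 / k.
have y0 : 0 < y by rewrite divr_gt0// lt_max ltr01 orbT.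
(* The power of y solves k * t^(-nu) = max (z + 1, 1); the cap pi / 4 keeps 2 * t in the range where
   the lower bound on beta holds. *)
pose t := Num.min (y `^ (- nu^-1)) (pi / 4).
have p4 : 0 < (pi / 4 : R) by rewrite divr_gt0 ?pi_gt0.
have t0 : 0 < t by rewrite lt_min powR_gt0.
exists t; split => //.
have h : c0 * (2 * t) `^ (- 1 - nu) * (2 * t - t) <= H t.
  have : c0 * (2 * t) `^ (- 1 - nu) * (2 * t - t) <= H t - H (2 * t).
    apply: H_lb => //; first by rewrite ler_peMl ?ltW// ltr1n.
    have : t <= pi / 4 by rewrite /t ge_min lexx orbT.
    by have := pi_gt0 R; lra.
  by have := H_ge0 (2 * t); lra.
apply: lt_le_trans h.
have -> : c0 * (2 * t) `^ (- 1 - nu) * (2 * t - t) = k * t `^ (- nu).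
  rewrite powRM ?ltW// /k (_ : 2 * t - t = t); last by ring.
  rewrite -!mulrA; congr (_ * (_ * _)).
  have -> : t `^ (- nu) = t `^ (- 1 - nu) * t `^ 1.
    rewrite -powRD; last by rewrite (gt_eqF t0) implybT.
    by congr (_ `^ _); ring.
  by rewrite (powRr1 (ltW t0)).
have : y <= t `^ (- nu).
  have ty : t <= y `^ (- nu^-1) by rewrite /t ge_min lexx.
  have -> : y = (y `^ (- nu^-1)) `^ (- nu).
    by rewrite -powRrM mulrNN mulVf ?gt_eqF// powRr1// ltW.
  rewrite powRN [leRHS]powRN lef_pV2 ?posrE ?powR_gt0 ?powR_gt0//.
  by apply: ge0_ler_powR; rewrite ?nnegrE ?powR_ge0// ltW.
rewrite -(ler_pM2l k0); apply: lt_le_trans.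
by rewrite /y mulrCA divff ?gt_eqF// mulr1 lt_max ltrDl ltr01.
Qed.

Definition Ginv (z : R) : R := sup [set t | 0 < t /\ z < H t].

(** As H is nonincreasing and right-continuous, the set where z < H t is an open interval ending at
    [Ginv z]. All properties of [Ginv] are read off from this equivalence. *)
Lemma lt_Ginv (t z : R) : 0 < t -> 0 <= z -> (t < Ginv z) = (z < H t).
Proof.
move=> t0 z0.
have ub : ubound [set t | 0 < t /\ z < H t] (pi / 2).
  move=> s /= [s0 zs]; rewrite leNgt; apply/negP => /ltW/H_zero hs.
  by move: zs; rewrite hs ltNge z0.
have ne : [set t | 0 < t /\ z < H t] !=set0.
  by have [s hs] := H_unbounded z; exists s.
have hs : has_sup [set t | 0 < t /\ z < H t] by split => //; exists (pi / 2).
apply/idP/idP => [tG|zH].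
  have [s [s0 zs] ts] : exists2 s, (0 < s /\ z < H s) & t < s.
    by have [s Hs ts] := sup_gt ne tG; exists s.
  by apply: lt_le_trans zs _; apply: H_noninc => //; exact: ltW.
(* H is right-continuous at t *)
set L := c1 * t `^ (- 1 - nu).
have L0 : 0 < L by rewrite mulr_gt0// powR_gt0.
(* Over this step H drops by at most half of the excess H t - z, so s still belongs to the set. *)
pose s := t + (H t - z) / (2 * L).
have st : t < s by rewrite ltrDl divr_gt0 ?subr_gt0// mulr_gt0.
apply: (lt_le_trans st); apply: sup_ubound; first by exists (pi / 2).
split; first exact: lt_trans t0 st.
have := H_lip t0 (ltW st); rewrite -/L /s (addrC t) addrK.
have -> : L * ((H t - z) / (2 * L)) = (H t - z) / 2 by field; rewrite gt_eqF.
by rewrite addrC; lra.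
Qed.

Lemma Ginv_gt0 (z : R) : 0 <= z -> 0 < Ginv z.
Proof.
move=> z0; have [t [t0 zt]] := H_unbounded z.
by apply: (lt_trans t0); rewrite lt_Ginv.
Qed.

Lemma Ginv_le (z : R) : 0 <= z -> Ginv z <= pi / 2.
Proof. by move=> z0; rewrite leNgt lt_Ginv// H_zero// ltNge z0. Qed.

Lemma Ginv_noninc (y z : R) : 0 <= y -> y <= z -> Ginv z <= Ginv y.
Proof.
move=> y0 yz; rewrite leNgt; apply/negP => h.
have g0 := Ginv_gt0 y0.
have := lt_Ginv g0 y0; rewrite ltxx => /esym/negbT; rewrite -leNgt => h1.
have : z < H (Ginv y) by rewrite -lt_Ginv// (le_trans y0).
by rewrite ltNge (le_trans h1).
Qed.

Lemma Ginv_decay (z : R) : 0 < z -> Ginv z <= (c1 / (nu * z)) `^ (nu^-1).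
Proof.
have /andP[n0 _] := nu01.
move=> z0; rewrite leNgt; apply/negP; set s := _ `^ _ => h.
have s0 : 0 < s by rewrite powR_gt0// divr_gt0// mulr_gt0.
move: h; rewrite lt_Ginv ?ltW// => h.
have := lt_le_trans h (H_le s0); rewrite /s -powRrM mulrN mulVf ?gt_eqF//.
rewrite powR_inv1; last by rewrite divr_ge0 ?mulr_ge0// ltW.
by rewrite invf_div (_ : c1 / nu * (nu * z / c1) = z) ?ltxx//; field; rewrite !gt_eqF.
Qed.

(** Between [Ginv (l * z)] and [Ginv z] the function H varies by at most (l - 1) * z. The lower
    bound on beta converts this into a length, and z is in turn at most (c1 / nu) * t^(-nu) by the
    upper bound, so the length is at most C * (l - 1) * Ginv z. For l <= 2 one has l - 1 <= 2 * (1 -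
    1 / l); for l > 2 the difference is at most [Ginv z] while 1 - 1 / l >= 1 / 2. The form 1 - 1 /
    l is the relative difference of two collision rates of ratio l. *)
Lemma Ginv_ratio (z l : R) : 0 <= z -> 1 <= l ->
  Ginv z - Ginv (l * z) <= 2 * (c1 / (nu * c0) + 1) * (1 - l^-1) * Ginv z.
Proof.
move=> z0 l1; have /andP[n0 _] := nu01.
have l0 : 0 < l by lra.
have lz : z <= l * z by rewrite ler_peMl.
have g0 := Ginv_gt0 z0.
set C := c1 / (nu * c0).
have C0 : 0 < C by rewrite divr_gt0// mulr_gt0.
have h1 : Ginv z - Ginv (l * z) <= C * (l - 1) * Ginv z.
  rewrite leNgt; apply/negP => h.
  (* [lt_Ginv] speaks of strict inequalities, so both endpoints are moved inwards by a quarter of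
     the supposed excess d. *)
  pose d := Ginv z - Ginv (l * z) - C * (l - 1) * Ginv z.
  have d0 : 0 < d by rewrite subr_gt0.
  have Cl : 0 <= C * (l - 1) by rewrite mulr_ge0 ?subr_ge0// ltW.
  pose s := Ginv (l * z) + d / 4; pose t := Ginv z - d / 4.
  have lz0 : 0 <= l * z by rewrite (le_trans z0).
  have gl0 := Ginv_gt0 lz0.
  have Cg : 0 <= C * (l - 1) * Ginv z by rewrite mulr_ge0// ltW.
  have st : s < t by rewrite /s /t; move: d0 Cg; rewrite /d; lra.
  have s0 : 0 < s by rewrite /s; lra.
  have t0 : 0 < t := lt_trans s0 st.
  have tz : z < H t by rewrite -lt_Ginv// /t; lra.
  have sz : H s <= l * z by rewrite leNgt -lt_Ginv// -leNgt /s; lra.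
  have t2 : t <= pi / 2 by have := Ginv_le z0; rewrite /t; lra.
  have hl := H_lb s0 (ltW st) t2.
  have hu := H_le t0.
  have e1 : c0 * t `^ (- 1 - nu) * (t - s) <= (l - 1) * (c1 / nu * t `^ (- nu)).
    apply: (le_trans hl); apply: (@le_trans _ _ ((l - 1) * z)); first lra.
    by rewrite ler_wpM2l ?subr_ge0//; lra.
  have e2 : t `^ (- nu) = t `^ (- 1 - nu) * t.
    rewrite -[X in _ = _ * X](powRr1 (ltW t0)) -powRD; last by rewrite (gt_eqF t0) implybT.
    by congr (_ `^ _); ring.
  have e3 : c0 * (t - s) <= (l - 1) * (c1 / nu) * t.
    rewrite -(ler_pM2l (powR_gt0 (- 1 - nu) t0)).
    move: e1; rewrite e2; set P := t `^ _.
    move=> e1; rewrite (_ : P * (c0 * (t - s)) = c0 * P * (t - s)); last ring.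
    by apply: (le_trans e1); rewrite le_eqVlt; apply/orP; left; apply/eqP; ring.
  have e4 : t - s <= C * (l - 1) * t.
    rewrite -(ler_pM2l c00) /C.
    by rewrite (_ : c0 * (c1 / (nu * c0) * (l - 1) * t) = (l - 1) * (c1 / nu) * t)//; field; rewrite !gt_eqF.
  have tG : C * (l - 1) * t <= C * (l - 1) * Ginv z.
    by rewrite ler_wpM2l// /t gerBl divr_ge0// ltW.
  have e5 := le_trans e4 tG.
  have e6 : t - s = Ginv z - Ginv (l * z) - d / 2 by rewrite /t /s; field.
  have e7 : d = Ginv z - Ginv (l * z) - C * (l - 1) * Ginv z by [].
  move: e5; rewrite e6 => e5; clearbody s t d; lra.
have gl : 0 <= Ginv (l * z) by rewrite ltW// Ginv_gt0// (le_trans z0).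
have [l2|l2] := leP l 2.
  apply: (le_trans h1); rewrite ler_wpM2r ?(ltW g0)//.
  have : l - 1 <= 2 * (1 - l^-1).
    rewrite -(ler_pM2r l0) (_ : 2 * (1 - l^-1) * l = 2 * (l - 1)); last by field; rewrite gt_eqF.
    by nra.
  have : 0 <= l - 1 by lra.
  move: C0; move: (C) (l^-1) => x y; nra.
have : l^-1 <= 2^-1 by rewrite lef_pV2 ?posrE// ltW.
move=> l2'; have h2 : 1 <= 2 * (C + 1) * (1 - l^-1).
  by move: C0 l2'; move: (C) (l^-1) => x y x0 y2; nra.
by apply: (@le_trans _ _ (Ginv z)); [lra | rewrite ler_peMl// ltW].
Qed.

Lemma measurable_Ginv (A : R) : 0 < A -> measurable_fun `[(0 : R), +oo[ (fun z : R' => Ginv (z / A) : R').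
Proof.
move=> A0.
apply: (@eq_measurable_fun _ _ _ _ _ (fun z : R' => Ginv (Num.max (z / A) 0))).
  move=> z; rewrite inE/= in_itv/= andbT => z0.
  by rewrite (max_idPl _)// divr_ge0// ltW.
apply: nonincreasing_measurable => // x y xy.
apply: Ginv_noninc; first by rewrite le_max lexx orbT.
by rewrite ge_max !le_max lexx orbT andbT ler_pM2r ?invr_gt0// xy.
Qed.

(** The maximum with 0 makes the function monotone on the whole line, hence measurable, without
    changing it on the half-line. *)
Let GA (A : R) (z : R') : R' := Ginv (Num.max (z / A) 0).

Let GAE A z : 0 < A -> 0 <= z -> GA A z = Ginv (z / A).
Proof. by move=> A0 z0; rewrite /GA (max_idPl _)// divr_ge0// ltW. Qed.

Let mGA A : 0 < A -> measurable_fun setT (GA A).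
Proof.
move=> A0; apply: nonincreasing_measurable => // x y xy.
apply: Ginv_noninc; first by rewrite le_max lexx orbT.
by rewrite ge_max !le_max lexx orbT andbT ler_pM2r ?invr_gt0// xy.
Qed.

Let halfline (z : R') : \bar R := (\1_[set` `[(0 : R), +oo[] z)%:E.

Let mhalf : measurable_fun setT halfline.
Proof. by apply/measurable_EFinP; exact: measurable_indic. Qed.

Let half0 z : (0 <= halfline z)%E.
Proof. by rewrite lee_fin. Qed.

Let pushG A (A0 : 0 < A) : {measure set R' -> \bar R} :=
  measure_function_pushforward__canonical__measure_function_Measure
    (mdensity mu mhalf half0) (mGA A0).

Let mAk A : measurable_fun setT (fun t : R' => (A * cutk t)%:E).
Proof. by apply/measurable_EFinP; apply: measurable_funM => //; exact: measurable_cutk. Qed.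

Let Ak0 A : 0 < A -> forall t, (0 <= (A * cutk t)%:E)%E.
Proof. by move=> A0 t; rewrite lee_fin mulr_ge0 ?cutk_ge0// ltW. Qed.

Let denK A (A0 : 0 < A) : {measure set R' -> \bar R} := mdensity mu (mAk A) (Ak0 A0).

Let pushGE A (A0 : 0 < A) E : measurable E ->
  pushG A0 E = mu ([set` `[(0 : R), +oo[] `&` GA A @^-1` E).
Proof.
move=> mE; rewrite /pushG /= /pushforward /mdensity.
have mGE : measurable (GA A @^-1` E).
  by rewrite -[X in measurable X]setTI; exact: mGA.
by rewrite integral_indic.
Qed.

Let tail_eq A (A0 : 0 < A) (t : R) : 0 < t -> pushG A0 [set` `]t, +oo[] = (A * H t)%:E /\
  denK A0 [set` `]t, +oo[] = (A * H t)%:E.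
Proof.
move=> t0; split.
  rewrite pushGE//.
  rewrite (_ : _ `&` _ = [set` `[(0 : R), (A * H t)[]); last first.
    apply/seteqP; split => z /=; rewrite !in_itv/= !andbT.
      move=> [z0]; rewrite GAE// lt_Ginv ?divr_ge0 ?(ltW A0)// ltr_pdivrMr// => ?.
      by rewrite z0 /= mulrC.
    move=> /andP[z0 zA]; split => //.
    by rewrite GAE// lt_Ginv ?divr_ge0 ?(ltW A0)// ltr_pdivrMr// mulrC.
  rewrite lebesgue_measure_itv/= lte_fin; case: ltP => h.
    by rewrite -EFinB subr0.
  by apply/eqP; rewrite eq_sym eqe eq_le h mulr_ge0 ?H_ge0// ltW.
rewrite /denK /= /mdensity EFinM -HEE// /HE.
under eq_integral do rewrite EFinM.
by rewrite ge0_integralZl ?lee_fin ?(ltW A0)//= => x _; rewrite lee_fin cutk_ge0.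
Qed.

(** By [lt_Ginv] both measures give the mass A * H t to the ray above t > 0. Their total mass is
    infinite, so uniqueness from a pi-system is applied to the restrictions to ]1 / (n + 1), +oo[,
    where they are finite, and n tends to infinity. Neither charges the nonpositive half-line. *)
Let push_eq A (A0 : 0 < A) E : measurable E -> pushG A0 E = denK A0 E.
Proof.
move=> mE.
pose D (n : nat) : set R' := [set` `](n.+1%:R^-1 : R), +oo[].
have mD n : measurable (D n) by exact: measurable_itv.
have agree n : pushG A0 (E `&` D n) = denK A0 (E `&` D n).
  pose m1 : {measure set R' -> \bar R} := mrestr (pushG A0) (mD n).
  pose m2 : {measure set R' -> \bar R} := mrestr (denK A0) (mD n).
  suff : forall E, measurable E -> m1 E = m2 E by exact.
  have Grest (x : R) : [set` `]x, +oo[] `&` D n = [set` `](Num.max x n.+1%:R^-1), +oo[].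
    apply/seteqP; split => y; rewrite /D /= !in_itv/= !andbT gt_max; first by move=> [-> ->].
    by move/andP.
  have mx0 (x : R) : 0 < Num.max x n.+1%:R^-1 by rewrite lt_max invr_gt0 ltr0n orbT.
  apply: (@measure_unique _ R R' (@RGenOInfty.G R : set (set R')) (fun k => [set` `](- k%:R : R), +oo[] : set R')).
  - exact: RGenOInfty.measurableE.
  - move=> _ _ [x ->] [y ->]; exists (Num.max x y).
    by apply/seteqP; split => z /=; rewrite !in_itv/= !andbT gt_max; [move=> [-> ->]|move/andP].
  - by move=> k; eexists; reflexivity.
  - apply/seteqP; split => // x _; exists (Num.truncn `|x|).+1 => //=.
    rewrite in_itv/= andbT ltrNl; apply: (@le_lt_trans _ _ `|x|).
      by rewrite -normrN ler_norm.
    exact: truncnS_gt.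
  - move=> _ [x ->]; rewrite /m1 /m2 /= /mrestr Grest.
    by have [-> ->] := tail_eq A0 (mx0 x).
  - move=> k; rewrite /m1 /= /mrestr Grest.
    by have [-> _] := tail_eq A0 (mx0 (- k%:R)); rewrite ltry.
pose D0 : set R' := [set` `](0 : R), +oo[].
have D0E : \bigcup_n (E `&` D n) = E `&` D0.
  rewrite -setI_bigcupr; congr (_ `&` _); apply/seteqP; split => x /=.
    move=> [n _]; rewrite /D /D0 /= !in_itv/= !andbT; apply: le_lt_trans.
    by rewrite invr_ge0.
  rewrite /D0 /= in_itv/= andbT => x0; exists (Num.truncn x^-1) => //.
  rewrite /D /= in_itv/= andbT -[X in _ < X]invrK ltf_pV2 ?posrE ?invr_gt0//.
  exact: truncnS_gt.
have ndD : nondecreasing_seq (fun n => E `&` D n).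
  apply/nondecreasing_seqP => n; rewrite subsetEset; apply: setIS => x.
  rewrite /D /= !in_itv/= !andbT; apply: le_lt_trans.
  by rewrite lef_pV2 ?posrE ?ltr0n// ler_nat.
have mED n : measurable (E `&` D n) by exact: measurableI.
have pos : pushG A0 (E `&` D0) = denK A0 (E `&` D0).
  have mU : measurable (\bigcup_n (E `&` D n)) by exact: bigcup_measurable.
  have c1' := @nondecreasing_cvg_mu _ _ _ (pushG A0) _ mED mU ndD.
  have c2' := @nondecreasing_cvg_mu _ _ _ (denK A0) _ mED mU ndD.
  rewrite D0E in c1' c2'; move/cvg_lim : c1' => <- //; move/cvg_lim : c2' => <- //.
  by congr (limn _); apply/funext => n /=; exact: agree.
have mD0 : measurable D0 by exact: measurable_itv.
have split_ (m : {measure set R' -> \bar R}) : m (~` D0) = 0%E -> m E = m (E `&` D0).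
  move=> h; rewrite -{1}(setIT E) -(setUv D0) setIUr measureU//.
  - rewrite [X in (_ + X)%E](_ : _ = 0%E) ?adde0//.
    have mC : measurable (~` D0) by exact: measurableC.
    by apply: (@subset_measure0 _ _ _ m (E `&` ~` D0) (~` D0)) => //; exact: measurableI.
  - exact: measurableI.
  - by apply: measurableI => //; exact: measurableC.
  - by rewrite setIACA setICr !setI0.
rewrite (split_ (pushG A0)) ?(split_ (denK A0))//.
- rewrite /denK /= /mdensity integral0_eq// => x; rewrite /D0 /= in_itv/= andbT => /negP.
  by rewrite -leNgt => x0; rewrite /cutk ltNge x0 /= mulr0.
- rewrite pushGE; last exact: measurableC.
  rewrite (_ : _ `&` _ = set0) ?measure0//.
  apply/seteqP; split => // z /=; rewrite /D0 /= !in_itv/= !andbT => -[z0].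
  by rewrite GAE// Ginv_gt0// divr_ge0// ltW.
Qed.

Lemma Ginv_pushforward A (F : R -> \bar R) : 0 < A ->
  measurable_fun (setT : set R') F -> (forall t, (0 <= F t)%E) ->
  (\int[mu]_(t in `](0 : R)%R, (pi / 2)%R]) ((A * beta t)%:E * F t) =
   \int[mu]_(z in `[(0 : R)%R, +oo[) F (Ginv (z / A)))%E.
Proof.
move=> A0 mF F0.
transitivity (\int[mu]_t (F t * (A * cutk t)%:E))%E.
  rewrite integral_mkcond; apply: eq_integral => t _; rewrite patchE.
  case: ifPn => [|/negP]; rewrite inE /= => t01.
    by rewrite cutkE// muleC.
  rewrite /cutk ifF ?mulr0 ?mule0//; apply/negbTE/negP => /andP[t0 t1]; apply: t01.
  by rewrite in_itv/= t0 ltW.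
rewrite -(@ge0_integral_density _ _ _ mu (pushG A0) _ (mAk A) (Ak0 A0) (push_eq A0))//.
rewrite ge0_integral_pushforward//; last exact: mGA.
have mFG : measurable_fun setT (F \o GA A) by exact: measurableT_comp mF (mGA A0).
rewrite preimage_setT ge0_integral_mdensity//; last by move=> x; exact: F0.
rewrite [RHS]integral_mkcond; apply: eq_integral => z _; rewrite patchE.
rewrite /halfline indicE; case: ifPn => [|]; last by rewrite mule0.
by rewrite inE /= in_itv/= andbT => z0; rewrite mule1 GAE.
Qed.

(** The singularity theta^(-1 - nu) becomes integrable after multiplication by theta because nu <
    1. *)
Lemma angular_moment : (\int[mu]_(t in `](0 : R)%R, (pi / 2)%R]) (beta t * t)%:E <=
   (c1 * ((pi / 2) `^ (1 - nu) / (1 - nu)))%:E)%E.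
Proof.
have /andP[n0 n1] := nu01.
have mp : measurable_fun [set` `](0 : R), (pi / 2)]] (fun x : R' => ((x : R) `^ (- nu))%:E).
  by apply: measurable_funTS; apply/measurable_EFinP; exact: measurable_powR.
apply: (@le_trans _ _ (\int[mu]_(x in `](0 : R)%R, (pi / 2)%R]) (c1%:E * (x `^ (- nu))%:E))%E).
  apply: ge0_le_integral => //=.
  - move=> t; rewrite in_itv/= => /andP[t0 t1]; rewrite lee_fin mulr_ge0 ?(ltW t0)//.
    by apply: b_ge0; rewrite in_itv/= t0 /=; have := pi_gt0 R; lra.
  - apply/measurable_EFinP; apply: measurable_funM => //.
    apply: measurable_funS mb => //= t /=; rewrite !in_itv/= => /andP[-> /=].
    by have := pi_gt0 R; lra.
  - by apply: emeasurable_funM.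
  - move=> t t01; rewrite -EFinM lee_fin -cutkE//; move: t01 => /=; rewrite in_itv/= => /andP[t0 _].
    apply: (@le_trans _ _ (c1 * t `^ (- 1 - nu) * t)); first by rewrite ler_pM2r// cutk_le.
    rewrite -mulrA ler_pM2l// -{2}(powRr1 (ltW t0)) -powRD; last by rewrite (gt_eqF t0) implybT.
    by rewrite (_ : -1 - nu + 1 = - nu)//; ring.
rewrite ge0_integralZl ?lee_fin ?(ltW c10)//=; last by move=> x _; rewrite lee_fin powR_ge0.
by rewrite EFinM lee_pmul2l// ?lte_fin//; apply: integral_powR_near0 => //; rewrite ltW.
Qed.

End angular.

(** * Pointwise comparison of two collisions *)

Section real_lemmas.
Context {R : realType}.
Implicit Types (x y s a b L : R) (f P : R -> R).
Local Notation mu := (@lebesgue_measure R).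

Lemma lipschitz_continuous1 f L : (forall x y, `|f x - f y| <= L * `|x - y|) -> continuous f.
Proof.
move=> fL x; apply/cvgrPdist_lt => e e0.
have L1 : 0 < `|L| + 1 by rewrite ltr_wpDl.
near=> y; apply: (le_lt_trans (fL x y)).
apply: (@le_lt_trans _ _ ((`|L| + 1) * `|x - y|)).
  by rewrite ler_wpM2r// (le_trans (ler_norm L))// lerDl.
rewrite mulrC -ltr_pdivlMr//; near: y.
by apply: (@cvgr_dist_lt _ _ _ (nbhs x) _ id x cvg_id); rewrite divr_gt0.
Unshelve. all: by end_near.
Qed.

Lemma derive_bound_lipschitz f (df : R -> R) : (forall x, is_derive x 1 f (df x)) ->
  (forall x, `|df x| <= 1) -> forall x y, `|f x - f y| <= `|x - y|.
Proof.
move=> fd fb x y; wlog xy : x y / x <= y.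
  by move=> H; case: (leP x y) => [|/ltW] h; [|rewrite distrC (distrC x)]; exact: H.
have cf : {within `[x, y], continuous f}.
  apply: continuous_subspaceT => z; apply/differentiable_continuous/derivable1_diffP.
  by have := fd z => -[].
have [c _ fE] := @MVT_segment _ f df x y xy (fun z _ => fd z) cf.
rewrite distrC fE normrM [leRHS]distrC; apply: ler_piMl => //.
Qed.

Lemma sin_lipschitz x y : `|sin x - sin y| <= `|x - y|.
Proof.
by apply: (@derive_bound_lipschitz sin cos) => z; rewrite ler_norml cos_le1 cos_geN1.
Qed.

Lemma cos_lipschitz x y : `|cos x - cos y| <= `|x - y|.
Proof.
apply: (@derive_bound_lipschitz cos (fun z => - sin z)) => z.
by rewrite normrN sin_max.
Qed.

Lemma abs_sin_le x : `|sin x| <= `|x|.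
Proof. by have := sin_lipschitz x 0; rewrite sin0 !subr0. Qed.

Lemma one_sub_cos x : (1 - cos x) / 2 = sin (x / 2) ^+ 2.
Proof.
have -> : cos x = 1 - sin (x / 2) ^+ 2 *+ 2.
  by rewrite {1}(_ : x = (x / 2) *+ 2) ?cos_mulr2n ?cos2sin2 ?mulrnBl; rewrite mulr2n; field.
by rewrite mulr2n; field.
Qed.

Lemma continuous_Rint P a b : continuous P -> mu.-integrable `[a, b] (EFin \o P).
Proof.
move=> cP; apply: continuous_compact_integrable; first exact: segment_compact.
exact: continuous_subspaceT.
Qed.

Lemma Rintegral_translate P s a b : a <= b -> continuous P ->
  \int[mu]_(x in `[a, b]) P (x + s) = \int[mu]_(x in `[a + s, b + s]) P x.
Proof.
move=> ab cP; rewrite /Rintegral.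
have dF (x : R) : is_derive x 1 (fun x => x + s) (1 : R).
  by apply: is_derive_eq; rewrite addr0.
have FE : ((fun x : R => x + s)^`())%classic = fun=> 1.
  by apply/funext => x; rewrite derive1E; have [_ ->] := dF x.
rewrite (@integration_by_substitution_increasing _ (fun x => x + s))//.
- by congr fine; apply: eq_integral => x _; rewrite FE /= mulr1.
- by move=> x y _ _; rewrite ltrD2r.
- by rewrite FE => x _; exact: cvg_cst.
- by rewrite FE; exact: is_cvg_cst.
- by rewrite FE; exact: is_cvg_cst.
- split.
  + by move=> x _; have [] := dF x.
  + by apply: cvg_at_right_filter; apply: cvgD; [exact: cvg_id|exact: cvg_cst].
  + by apply: cvg_at_left_filter; apply: cvgD; [exact: cvg_id|exact: cvg_cst].
- exact: continuous_subspaceT.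
Qed.

Lemma Rintegral_periodic_shift P s : continuous P -> (forall x, P (x + 2 * pi) = P x) ->
  0 <= s <= 2 * pi ->
  \int[mu]_(x in `[0, 2 * pi]) P (x + s) = \int[mu]_(x in `[0, 2 * pi]) P x.
Proof.
move=> cP pP /andP[s0 sp].
have p0 : 0 <= 2 * pi :> R by rewrite mulr_ge0// pi_ge0.
rewrite Rintegral_translate// add0r.
have e1 := @Rintegral_itvB _ P (BLeft s) (BRight (2 * pi + s)) (2 * pi) (continuous_Rint _ _ cP).
have e2 := @Rintegral_itvB _ P (BLeft 0) (BRight (2 * pi)) s (continuous_Rint _ _ cP).
rewrite !bnd_simp in e1 e2.
have {}e1 := e1 sp; rewrite lerDl in e1; have {}e1 := e1 s0.
have {}e2 := e2 s0 sp.
have iP a b : mu.-integrable `]a, b] (EFin \o P).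
  by apply: integrableS (continuous_Rint a b cP) => //; exact: subset_itv_oc_cc.
rewrite Rintegral_itv_obnd_cbnd// in e1; rewrite Rintegral_itv_obnd_cbnd// in e2.
have e3 : \int[mu]_(x in `[(2 * pi), (2 * pi + s)]) P x = \int[mu]_(x in `[0, s]) P x.
  rewrite -{1}(add0r (2 * pi)) (addrC _ s) -Rintegral_translate//.
  by apply: eq_Rintegral => x _; rewrite pP.
rewrite e3 in e1; lra.
Qed.

End real_lemmas.

(** * Orthogonal frames and the size of deviations *)

Section deviation.
Context {R : realType} (I : vec R -> vec R).
Hypothesis hI : orthogonal_selection I.
Implicit Types (x y v w : vec R) (t p : R).

(** The frame vectors are set to 0 at x = 0, so that the norm and scalar product formulas hold for
    every x. *)
Definition GI x : vec R := if x == 0 then 0 else I x.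
Definition GJ x : vec R := if x == 0 then 0 else J_vec I x.

Lemma dotv0 x : dotv 0 x = 0.
Proof. by rewrite dotvE /= !mul0r !addr0. Qed.

Lemma frame_GI x : [/\ dotv (GI x) (GI x) = enorm x ^+ 2,
  dotv (GJ x) (GJ x) = enorm x ^+ 2, dotv (GI x) (GJ x) = 0,
  dotv (GI x) x = 0 & dotv (GJ x) x = 0].
Proof.
rewrite /GI /GJ; have [->|x0] := eqVneq x 0.
  by rewrite !dotv0 enorm0 expr0n.
have [nI oI] := hI.2 x x0.
have nx : enorm x != 0 by rewrite enorm_eq0.
have II : dotv (I x) (I x) = enorm x ^+ 2 by rewrite -nI enorm_sqr.
have crossE c u z y : dotv (crossv (c *: u) z) y = c * dotv (crossv u z) y.
  by rewrite !dotvE /= /GRing.scale /=; ring.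
have o1 u z : dotv (crossv u z) u = 0 by rewrite !dotvE /=; ring.
have o2 u z : dotv (crossv u z) z = 0 by rewrite !dotvE /=; ring.
split => //.
- rewrite /J_vec crossE dotvC crossE.
  have := lagrange_id x (I x); rewrite II -enorm_sqr (dotvC x) oI expr0n /= add0r => <-.
  by field.
- by rewrite dotvC /J_vec crossE o2 mulr0.
- by rewrite /J_vec crossE o1 mulr0.
Qed.

Lemma deviationE v w t p : deviation I v w t p =
  - ((1 - cos t) / 2) *: (v - w) + (sin t / 2) *: (cos p *: GI (v - w) + sin p *: GJ (v - w)).
Proof.
rewrite /deviation /Gamma_vec /GI /GJ; congr (_ + _ *: _).
by case: eqVneq => // _; rewrite !scaler0 addr0.
Qed.

Lemma frame_norm x (a b c : R) :
  enorm (a *: x + (b *: GI x + c *: GJ x)) ^+ 2 = enorm x ^+ 2 * (a ^+ 2 + b ^+ 2 + c ^+ 2).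
Proof.
have [h1 h2 h3 h4 h5] := frame_GI x.
rewrite [in LHS]enorm_sqr !dotv_lin h1 h2 h3 h4 h5 (dotvC (GJ x) (GI x)) h3.
by rewrite (dotvC x (GI x)) h4 (dotvC x (GJ x)) h5 -enorm_sqr; ring.
Qed.

Lemma sqr_norm_le (a b : R) : 0 <= b -> `|a| <= b -> a ^+ 2 <= b ^+ 2.
Proof. by move=> b0 ab; rewrite -(real_normK (num_real a)) ler_pXn2r ?nnegrE. Qed.

Lemma enorm_le_sqr x (c : R) : 0 <= c -> enorm x ^+ 2 <= c ^+ 2 -> enorm x <= c.
Proof. by move=> c0 h; rewrite -(ler_pXn2r (_ : (0 < 2)%N)) ?nnegrE ?enorm_ge0. Qed.

(** In the orthogonal frame the squared norm is |v - w|^2 (1 - cos t) / 2 = |v - w|^2 sin^2 (t / 2),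
    whatever the azimuth. *)
Lemma deviation_le v w t p : enorm (deviation I v w t p) <= enorm (v - w) * `|t|.
Proof.
apply: enorm_le_sqr; first by rewrite mulr_ge0 ?enorm_ge0.
rewrite deviationE (scalerDr (sin t / 2)) !scalerA frame_norm [leRHS]exprMn ler_wpM2l ?sqr_ge0//.
have := cos2Dsin2 p; have := cos2Dsin2 t; move=> h1 h2.
have -> : (- ((1 - cos t) / 2)) ^+ 2 + (sin t / 2 * cos p) ^+ 2 + (sin t / 2 * sin p) ^+ 2 =
   (1 - cos t) / 2.
  transitivity ((1 - cos t) ^+ 2 / 4 + sin t ^+ 2 / 4 * (cos p ^+ 2 + sin p ^+ 2)).
    by field.
  have -> : sin t ^+ 2 = 1 - cos t ^+ 2 by lra.
  by rewrite h2; field.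
rewrite one_sub_cos real_normK ?num_real// -(real_normK (num_real t)).
apply: sqr_norm_le => //; apply: (le_trans (abs_sin_le _)).
by rewrite normrM (ger0_norm (_ : 0 <= 2^-1))// ler_piMr// invf_le1// ler1n.
Qed.

Lemma deviation_lip_angle v w t t' p :
  enorm (deviation I v w t p - deviation I v w t' p) <= enorm (v - w) * `|t - t'|.
Proof.
apply: enorm_le_sqr; first by rewrite mulr_ge0 ?enorm_ge0.
rewrite !deviationE.
rewrite (_ : _ - _ = (- ((1 - cos t) / 2) + (1 - cos t') / 2) *: (v - w) +
   (((sin t - sin t') / 2 * cos p) *: GI (v - w) + ((sin t - sin t') / 2 * sin p) *: GJ (v - w))).
  rewrite frame_norm [leRHS]exprMn ler_wpM2l ?sqr_ge0//.
  have h := cos2Dsin2 p.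
  have -> : (- ((1 - cos t) / 2) + (1 - cos t') / 2) ^+ 2 +
    ((sin t - sin t') / 2 * cos p) ^+ 2 + ((sin t - sin t') / 2 * sin p) ^+ 2 =
    (cos t - cos t') ^+ 2 / 4 + (sin t - sin t') ^+ 2 / 4.
    transitivity ((cos t - cos t') ^+ 2 / 4 + (sin t - sin t') ^+ 2 / 4 * (cos p ^+ 2 + sin p ^+ 2)).
      by field.
    by rewrite h mulr1.
  have := sqr_norm_le (normr_ge0 _) (cos_lipschitz t t').
  have := sqr_norm_le (normr_ge0 _) (sin_lipschitz t t').
  have := sqr_ge0 `|t - t'|; lra.
by apply: vec_ext; rewrite /= /GRing.scale /=; field.
Qed.

Lemma deviation_lip_phi v w t p p' :
  enorm (deviation I v w t p - deviation I v w t p') <= enorm (v - w) * `|p - p'|.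
Proof.
apply: enorm_le_sqr; first by rewrite mulr_ge0 ?enorm_ge0.
rewrite !deviationE.
rewrite (_ : _ - _ = 0 *: (v - w) +
   ((sin t / 2 * (cos p - cos p')) *: GI (v - w) + (sin t / 2 * (sin p - sin p')) *: GJ (v - w))).
  rewrite frame_norm [leRHS]exprMn ler_wpM2l ?sqr_ge0//.
  have := sqr_norm_le (normr_ge0 _) (cos_lipschitz p p').
  have := sqr_norm_le (normr_ge0 _) (sin_lipschitz p p').
  have st : sin t ^+ 2 <= 1 by have := cos2Dsin2 t; have := sqr_ge0 (cos t); lra.
  move=> h1 h2.
  have h3 : (sin t ^+ 2 * (cos p - cos p') ^+ 2 <= (cos p - cos p') ^+ 2) by rewrite ler_piMl ?sqr_ge0.
  have h4 : (sin t ^+ 2 * (sin p - sin p') ^+ 2 <= (sin p - sin p') ^+ 2) by rewrite ler_piMl ?sqr_ge0.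
  have -> : 0 ^+ 2 + (sin t / 2 * (cos p - cos p')) ^+ 2 + (sin t / 2 * (sin p - sin p')) ^+ 2 =
    (sin t ^+ 2 * (cos p - cos p') ^+ 2) / 4 + (sin t ^+ 2 * (sin p - sin p') ^+ 2) / 4 by field.
  have := sqr_ge0 `|p - p'|; lra.
by apply: vec_ext; rewrite /= /GRing.scale /=; field.
Qed.

Lemma deviation_periodic v w t p : deviation I v w t (p + 2 * pi) = deviation I v w t p.
Proof. by rewrite !deviationE mulr_natl cosD2pi sinD2pi. Qed.

End deviation.

Section increments.
Context {R : realType} (I : vec R -> vec R).
Hypothesis hI : orthogonal_selection I.
Implicit Types (x y v w : vec R) (t p K M : R) (f h : vec R -> R).
Local Notation mu := (@lebesgue_measure R).

Definition lipv K f := forall v w, `|f v - f w| <= K * enorm (v - w).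

Definition inc f v w t : R :=
  \int[mu]_(p in `[0, 2 * pi]) (f (v + deviation I v w t p) - f v).

Lemma lipv_ge0 K f : lipv K f -> 0 <= K.
Proof.
move=> fK; have := fK (1, 0, 0) 0; rewrite subr0.
have -> : enorm ((1, 0, 0) : vec R) = 1 by rewrite /enorm /dotv /= !mulr0 !addr0 mulr1 sqrtr1.
by rewrite mulr1; apply: le_trans.
Qed.

Lemma Rint_le_cst (P : R -> R) (B : R) : continuous P -> (forall p, P p <= B) ->
  \int[mu]_(p in `[0, 2 * pi]) P p <= 2 * pi * B.
Proof.
move=> cP PB.
have -> : 2 * pi * B = \int[mu]_(p in `[0, 2 * pi]) B.
  rewrite Rintegral_cst//= lebesgue_measure_itv/= lte_fin mulr_gt0 ?pi_gt0//=.
  by rewrite subr0 mulrC.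
apply: le_Rintegral => //; first exact: continuous_Rint.
by apply: (@continuous_Rint _ (fun=> B)) => x; exact: cvg_cst.
Qed.

Lemma Rint_norm_le (P : R -> R) (B : R) : continuous P -> (forall p, `|P p| <= B) ->
  `|\int[mu]_(p in `[0, 2 * pi]) P p| <= 2 * pi * B.
Proof.
move=> cP PB; apply: (le_trans (le_normr_Rintegral _ _)) => //.
  exact: continuous_Rint.
by apply: Rint_le_cst => // p; apply: continuous_comp; [exact: cP|exact: norm_continuous].
Qed.

Lemma sum4_bound (s1 s2 s3 s4 W1 W2 W3 W4 fv hw u2 a2 b2 c c' : R) :
  s1 <= W1 - fv - hw -> s2 <= W2 - fv - hw -> s3 <= W3 - fv - hw -> s4 <= W4 - fv - hw ->
  W1 + W2 + (W3 + W4) = 4 * (u2 + a2 + b2 - c) -> c' <= c ->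
  s1 + s2 + (s3 + s4) <= 4 * (u2 + (a2 + b2 - c') - fv - hw).
Proof. lra. Qed.

Lemma scaled_diff_sqr (s t : R) x y : enorm (s *: x - t *: y) ^+ 2 / 4 =
   (s / 2) ^+ 2 * enorm x ^+ 2 + (t / 2) ^+ 2 * enorm y ^+ 2 - s / 2 * (t / 2) * (2 * dotv x y).
Proof. by rewrite dotvB_sqr dotvZl dotvZr !enormZ !exprMn !real_normK ?num_real//; field. Qed.

Lemma Rint_sum4 (a b c d : R -> R) : continuous a -> continuous b -> continuous c -> continuous d ->
  \int[mu]_(p in `[0, 2 * pi]) (a p + b p + (c p + d p)) =
  \int[mu]_(p in `[0, 2 * pi]) a p + \int[mu]_(p in `[0, 2 * pi]) b p +
  (\int[mu]_(p in `[0, 2 * pi]) c p + \int[mu]_(p in `[0, 2 * pi]) d p).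
Proof.
move=> ca cb cc cd.
have cab : continuous (fun p => a p + b p) by move=> p; exact: (cvgD (ca p) (cb p)).
have ccd : continuous (fun p => c p + d p) by move=> p; exact: (cvgD (cc p) (cd p)).
have i1 := continuous_Rint 0 (2 * pi) ca; have i2 := continuous_Rint 0 (2 * pi) cb.
have i3 := continuous_Rint 0 (2 * pi) cc; have i4 := continuous_Rint 0 (2 * pi) cd.
have i5 := continuous_Rint 0 (2 * pi) cab; have i6 := continuous_Rint 0 (2 * pi) ccd.
by rewrite RintegralD// RintegralD// RintegralD.
Qed.

Section one.
Variables (K : R) (f : vec R -> R).
Hypothesis fK : lipv K f.

Let K0 : 0 <= K := lipv_ge0 fK.

Lemma inc_continuous v w t : continuous (fun p => f (v + deviation I v w t p) - f v).
Proof.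
apply: (@lipschitz_continuous1 _ _ (K * enorm (v - w))) => p p'.
rewrite opprB addrA subrK; apply: (le_trans (fK _ _)); rewrite -mulrA ler_wpM2l//.
by rewrite opprD addrACA subrr add0r; exact: deviation_lip_phi.
Qed.

Lemma inc_periodic v w t p : f (v + deviation I v w t (p + 2 * pi)) - f v =
  f (v + deviation I v w t p) - f v.
Proof. by rewrite deviation_periodic. Qed.

Lemma inc_le v w t : `|inc f v w t| <= 2 * pi * (K * enorm (v - w) * `|t|).
Proof.
apply: Rint_norm_le; first exact: inc_continuous.
move=> p; apply: (le_trans (fK _ _)); rewrite addrAC subrr add0r -mulrA ler_wpM2l//.
exact: deviation_le.
Qed.

Lemma inc_lipschitz v w t t' :
  `|inc f v w t - inc f v w t'| <= 2 * pi * (K * enorm (v - w)) * `|t - t'|.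
Proof.
rewrite /inc -RintegralB//; try (by apply: continuous_Rint; exact: inc_continuous).
rewrite -mulrA; apply: Rint_norm_le.
  by move=> p; apply: cvgB; exact: inc_continuous.
move=> p; rewrite opprB addrA subrK; apply: (le_trans (fK _ _)).
rewrite -mulrA ler_wpM2l// opprD addrACA subrr add0r; exact: deviation_lip_angle.
Qed.

Lemma inc_diag v t : inc f v v t = 0.
Proof.
apply/eqP; rewrite -normr_le0; apply: (le_trans (inc_le _ _ _)).
by rewrite subrr enorm0 mulr0 mul0r mulr0.
Qed.

End one.

(** The second azimuth is turned by the angle of [tanaka_angle], and the integrand is replaced by
    its mean over four quarter turns. At each of the four points the constraint f + h <= [tcost] is
    applied after the collisions; [four_point_average] evaluates the sum of the squared distances,
    and the chosen angle bounds its cross term. The signs of the sines allow the angle inequality to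
    be multiplied by them. *)
Lemma inc_pair K f h M v v' w w' t t' : lipv K f -> lipv K h ->
  (forall a b, f a + h b <= tcost M a b) -> 0 <= sin t -> 0 <= sin t' ->
  inc f v v' t + inc h w w' t' <=
  2 * pi * (enorm (v - w + ((1 - cos t') / 2 *: (w - w') - (1 - cos t) / 2 *: (v - v'))) ^+ 2
   + enorm (sin t *: (v - v') - sin t' *: (w - w')) ^+ 2 / 4 - f v - h w).
Proof.
move=> fK hK fh st st'.
have pi0 := pi_ge0 R.
have q1 : 0 <= (pi / 2 : R) <= 2 * pi by apply/andP; split; lra.
have q2 : 0 <= (pi : R) <= 2 * pi by apply/andP; split; lra.
have q3 : 0 <= (pi + pi / 2 : R) <= 2 * pi by apply/andP; split; lra.
set x := v - v'; set y := w - w'.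
have [aa jj aj ax jx] := frame_GI hI x.
have [bb ll bl _ _] := frame_GI hI y.
have [phi [phi2 angle]] : exists phi : R, 0 <= phi <= 2 * pi /\
    2 * dotv x y <= cos phi * (dotv (GI I x) (GI I y) + dotv (GJ I x) (GJ I y)) +
                    sin phi * (dotv (GI I x) (GJ I y) - dotv (GJ I x) (GI I y)).
  have [x0|x0] := eqVneq x 0.
    exists 0; rewrite lexx mulr_ge0 ?pi_ge0//; split => //.
    by rewrite x0 /GI /GJ eqxx !dotv0 mulr0 !addr0 subrr !mulr0 addr0.
  have [y0|y0] := eqVneq y 0.
    exists 0; rewrite lexx mulr_ge0 ?pi_ge0//; split => //.
    by rewrite y0 /GI /GJ eqxx !(dotvC _ 0) !dotv0 mulr0 !addr0 subrr !mulr0 addr0.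
  have [nx ox] := hI.2 x x0; have [ny oy] := hI.2 y y0.
  rewrite /GI /GJ (negbTE x0) (negbTE y0).
  exact: tanaka_angle.
(* Both increments at one azimuth, the second turned by phi; by periodicity this changes neither
   integral. *)
pose S p := (f (v + deviation I v v' t p) - f v) + (h (w + deviation I w w' t' (p + phi)) - h w).
have cS : continuous S.
  move=> p; apply: cvgD; first exact: (inc_continuous fK).
  apply: (@continuous_comp _ _ _ (fun p => p + phi) (fun p => h (w + deviation I w w' t' p) - h w)).
    by apply: cvgD; [exact: cvg_id|exact: cvg_cst].
  exact: (inc_continuous hK).
have cSs s : continuous (fun p => S (p + s)).
  move=> p; apply: (@continuous_comp _ _ _ (fun p => p + s) S); last exact: cS.
  by apply: cvgD; [exact: cvg_id|exact: cvg_cst].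
have pS p : S (p + 2 * pi) = S p.
  by rewrite /S (addrAC p) !deviation_periodic.
have -> : inc f v v' t + inc h w w' t' = \int[mu]_(p in `[0, 2 * pi]) S p.
  have cH : continuous (fun p => h (w + deviation I w w' t' p) - h w) by exact: (inc_continuous hK).
  rewrite /inc -(Rintegral_periodic_shift cH (inc_periodic h w w' t') phi2).
  rewrite -RintegralD//; first by apply: continuous_Rint; exact: (inc_continuous fK).
  apply: continuous_Rint => p.
  apply: (@continuous_comp _ _ _ (fun p => p + phi) (fun p => h (w + deviation I w w' t' p) - h w)).
    by apply: cvgD; [exact: cvg_id|exact: cvg_cst].
  exact: (inc_continuous hK).
have e1 : \int[mu]_(p in `[0, 2 * pi]) S (p + pi / 2) = \int[mu]_(p in `[0, 2 * pi]) S p.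
  exact: (Rintegral_periodic_shift cS pS q1).
have e2 : \int[mu]_(p in `[0, 2 * pi]) S (p + pi) = \int[mu]_(p in `[0, 2 * pi]) S p.
  exact: (Rintegral_periodic_shift cS pS q2).
have e3 : \int[mu]_(p in `[0, 2 * pi]) S (p + pi + pi / 2) = \int[mu]_(p in `[0, 2 * pi]) S p.
  rewrite -[RHS](Rintegral_periodic_shift cS pS q3).
  apply: eq_Rintegral => p _. congr (S _); exact/esym/addrA.
pose S4 p := S p + S (p + pi / 2) + (S (p + pi) + S (p + pi + pi / 2)).
have cS3 : continuous (fun p => S (p + pi + pi / 2)).
  have -> : (fun p => S (p + pi + pi / 2)) = (fun p => S (p + (pi + pi / 2))).
    apply/funext => p; congr (S _); exact/esym/addrA.
  exact: cSs.
have e4 : \int[mu]_(p in `[0, 2 * pi]) S4 p = 4 * \int[mu]_(p in `[0, 2 * pi]) S p.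
  rewrite (Rint_sum4 cS (cSs (pi / 2)) (cSs pi) cS3) e1 e2 e3.
  by move: (\int[mu]_(_ in _) _) => u; ring.
set rhs := (X in _ <= 2 * pi * X).
suff H p : S4 p <= 4 * rhs.
  have cS4 : continuous S4.
    by move=> p; exact: (cvgD (cvgD (cS p) (cSs (pi / 2) p)) (cvgD (cSs pi p) (cS3 p))).
  have := Rint_le_cst cS4 H; rewrite e4.
  by rewrite mulrCA ler_pM2l.
(* The part of the separation after the collisions that does not depend on the azimuth; the
   transverse parts are in W. *)
pose U := v - w + ((1 - cos t') / 2 *: y - (1 - cos t) / 2 *: x).
pose W c s1 c' s1' : vec R := U + ((sin t / 2) *: (c *: GI I x + s1 *: GJ I x) -
                            (sin t' / 2) *: (c' *: GI I y + s1' *: GJ I y)).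
have SW q : S q <= enorm (W (cos q) (sin q) (cos (q + phi)) (sin (q + phi))) ^+ 2 - f v - h w.
  have -> : W (cos q) (sin q) (cos (q + phi)) (sin (q + phi)) =
     (v + deviation I v v' t q) - (w + deviation I w w' t' (q + phi)).
    rewrite !deviationE -/x -/y /W /U.
    move: (cos q *: _ + _) (cos (q + phi) *: _ + _) => p1 p2.
    by apply: vec_ext; rewrite /= /GRing.scale /=; ring.
  rewrite /S addrACA -opprD -[leRHS]addrA -opprD lerD2r.
  exact: le_trans (fh (v + deviation I v v' t q) (w + deviation I w w' t' (q + phi))) (tcost_le _ _ _).
have E := four_point_average U (sin t / 2) (sin t' / 2) aa jj aj bb ll bl (cos2Dsin2 p) (cos2Dsin2 phi).
rewrite /= -cosD -sinD in E.
have h2 := SW (p + pi / 2).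
rewrite cosDpihalf sinDpihalf (addrAC p (pi / 2) phi) cosDpihalf sinDpihalf in h2.
have h3 := SW (p + pi).
rewrite cosDpi sinDpi (addrAC p pi phi) cosDpi sinDpi in h3.
have h4 := SW (p + pi + pi / 2).
rewrite cosDpihalf sinDpihalf cosDpi sinDpi opprK (addrAC (p + pi) (pi / 2) phi) in h4.
rewrite (addrAC p pi phi) cosDpihalf sinDpihalf cosDpi sinDpi opprK in h4.
have ang := ler_wpM2l (mulr_ge0 (divr_ge0 st (ler0n R 2)) (divr_ge0 st' (ler0n R 2))) angle.
rewrite /S4 /rhs -/U scaled_diff_sqr.
exact: sum4_bound (SW p) h2 h3 h4 E ang.
Qed.

End increments.

(* G is the generalized inverse of t |-> \int_t^(pi/2) beta.  The image of Lebesgue measure on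
   [0, +oo[ under z |-> G (z / A) is A * beta(t)dt, so that two collisions of intensities A and
   A' are driven by the same variable z and can be compared pointwise. *)
Definition inverse_angle (R : realType) (nu : R) (beta G : R -> R) (Cr Cd k1 : R) : Prop :=
  [/\ [/\ 0 <= Cr, 0 <= Cd & 0 <= k1],
    (forall z, 0 <= z -> 0 < G z <= pi / 2),
    (forall A, 0 < A -> measurable_fun `[(0 : R), +oo[ (fun z : measurableTypeR R => G (z / A))),
    (forall y z, 0 <= y -> y <= z -> G z <= G y) /\
    (forall z l, 0 <= z -> 1 <= l -> G z - G (l * z) <= Cr * (1 - l^-1) * G z) &
    [/\ (forall z, 0 < z -> G z <= Cd * z `^ (- nu^-1)),
     (forall A (F : R -> \bar R), 0 < A ->
      measurable_fun (setT : set (measurableTypeR R)) F -> (forall t, (0 <= F t)%E) ->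
      (\int[lebesgue_measure]_(t in `](0 : R)%R, (pi / 2)%R]) ((A * beta t)%:E * F t) =
       \int[lebesgue_measure]_(z in `[(0 : R)%R, +oo[) F (G (z / A)%R))%E) &
     (forall A, 0 < A -> (\int[lebesgue_measure]_(z in `[(0 : R)%R, +oo[) (G (z / A)%R)%:E <= (A * k1)%:E)%E)]].

Lemma angular_inverse (R : realType) (nu : R) (beta : R -> R) :
  0 < nu < 1 -> angular_kernel nu beta ->
  exists (G : R -> R) (Cr Cd k1 : R), inverse_angle nu beta G Cr Cd k1.
Proof.
move=> nu01 [mb b0 [c0 [c1 [/andP[c00 c01] bnd]]] bz].
have /andP[n0 n1] := nu01.
have c10 : 0 < c1 by exact: lt_trans c00 c01.
pose G := Ginv beta.
have push A F A0 := @Ginv_pushforward R nu beta c0 c1 nu01 c00 mb b0 bnd bz A F A0.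
have mom := @angular_moment R nu beta c0 c1 nu01 c00 mb b0 bnd bz.
pose k1 := c1 * ((pi / 2) `^ (1 - nu) / (1 - nu)).
have p2 : 0 < pi / 2 :> R by rewrite divr_gt0 ?pi_gt0.
exists G, (2 * (c1 / (nu * c0) + 1)), ((c1 / nu) `^ (nu^-1)), k1.
split.
- split; first by rewrite mulr_ge0// addr_ge0// divr_ge0 ?mulr_ge0// ltW.
    exact: powR_ge0.
  by rewrite /k1 mulr_ge0 ?(ltW c10)// divr_ge0 ?powR_ge0// subr_ge0 ltW.
- move=> z z0; rewrite (@Ginv_gt0 R nu beta c0 c1)//=.
  exact: (@Ginv_le R nu beta c0 c1).
- move=> A A0; exact: (@measurable_Ginv R nu beta c0 c1).
- split; first by move=> y z; exact: (@Ginv_noninc R nu beta c0 c1).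
  move=> z l; exact: (@Ginv_ratio R nu beta c0 c1).
- split=> //.
    move=> z z0; have h : Ginv beta z <= (c1 / (nu * z)) `^ (nu^-1) by exact: (@Ginv_decay R nu beta c0 c1).
    apply: (le_trans h).
    rewrite invfM (mulrA c1) powRM ?divr_ge0 ?invr_ge0 ?(ltW c10) ?(ltW n0) ?(ltW z0)//.
    have e : z^-1 = z `^ (- 1) by rewrite powR_inv1// ltW.
    by rewrite e -powRrM mulN1r.
  move=> A A0.
  (* The transfer formula asks for a function that is nonnegative on the whole line, hence the
     absolute value. *)
  have mF : measurable_fun (setT : set (measurableTypeR R)) (fun t : R => (`|t|)%:E : \bar R).
    by apply/measurable_EFinP; exact: normr_measurable.
  have nF (t : R) : (0 <= (`|t|)%:E :> \bar R)%E by rewrite lee_fin.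
  have e : (\int[lebesgue_measure]_(z in `[(0 : R)%R, +oo[) (G (z / A)%R)%:E =
      \int[lebesgue_measure]_(z in `[(0 : R)%R, +oo[) (`|G (z / A)%R|)%:E)%E.
    apply: eq_integral => z; rewrite inE/= in_itv/= andbT => z0; rewrite ger0_norm// ltW//.
    by apply: (@Ginv_gt0 R nu beta c0 c1) => //; rewrite divr_ge0// ltW.
  rewrite e -(push A (fun t : R => (`|t|)%:E) A0 mF nF).
  apply: (@le_trans _ _ (A%:E * \int[lebesgue_measure]_(t in `](0 : R)%R, (pi / 2)%R]) (beta t * t)%:E)%E).
    have sub : `]0, (pi / 2)] `<=` `](0 : R), pi].
      by move=> t /=; rewrite !in_itv/= => /andP[-> h]/=; have := pi_gt0 R; lra.
    rewrite -ge0_integralZl ?lee_fin ?(ltW A0)//=.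
    + apply: ge0_le_integral => //=.
      * move=> t t01; rewrite -EFinM lee_fin mulr_ge0// mulr_ge0 ?(ltW A0)//.
        by apply: b0; exact: sub.
      * apply: emeasurable_funM; last exact: measurable_funTS.
        apply/measurable_EFinP; apply: measurable_funM => //.
        exact: measurable_funS mb.
      * apply: emeasurable_funM => //; apply/measurable_EFinP; apply: measurable_funM => //.
        exact: measurable_funS mb.
      * move=> t; rewrite in_itv/= => /andP[t0 _]; rewrite ger0_norm ?(ltW t0)//.
        by rewrite -!EFinM mulrA.
    + apply/measurable_EFinP; apply: measurable_funM => //.
      exact: measurable_funS mb.
    + move=> t t01; rewrite lee_fin mulr_ge0//; first by apply: b0; exact: sub.
      by move: t01; rewrite in_itv/= => /andP[/ltW].
  by rewrite EFinM lee_pmul2l ?lte_fin.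
Qed.

Section generator.
Context {R : realType} (gamma nu : R) (beta G : R -> R) (Cr Cd k1 : R) (I : vec R -> vec R).
Hypotheses (hgamma : -1 < gamma < 0) (nu01 : 0 < nu < 1) (hgn : 0 < gamma + nu)
  (mb : measurable_fun `](0 : R), pi] beta) (b_ge0 : {in `](0 : R), pi], forall t, 0 <= beta t})
  (hG : inverse_angle nu beta G Cr Cd k1) (hI : orthogonal_selection I).
Local Notation mu := (@lebesgue_measure R).
Local Notation R' := (measurableTypeR R).
Local Notation pos := ([set` `[(0 : R), +oo[] : set (measurableTypeR R)).
Local Notation dom := ([set` `](0 : R), (pi / 2)%R]] : set (measurableTypeR R)).
Let mpos : measurable pos. Proof. exact: measurable_itv. Qed.
Let mdom : measurable dom. Proof. exact: measurable_itv. Qed.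
Implicit Types (f h : vec R -> R) (K A B : R) (v w : vec R).

Let Cr0 : 0 <= Cr. Proof. by case: hG => -[]. Qed.
Let Cd0 : 0 <= Cd. Proof. by case: hG => -[]. Qed.
Let k10 : 0 <= k1. Proof. by case: hG => -[]. Qed.

Let G_gt0 A z : 0 < A -> 0 <= z -> 0 < G (z / A).
Proof. by move=> A0 z0; case: hG => _ /(_ (z / A)) H _ _ _; have /andP[] := H (divr_ge0 z0 (ltW A0)). Qed.

Lemma G_integrable A : 0 < A -> mu.-integrable pos (fun z => (G (z / A))%:E).
Proof.
move=> A0; have [_ _ mG _ [_ _ iG]] := hG.
apply/integrableP; split; first by apply/measurable_EFinP; exact: mG.
apply: (@le_lt_trans _ _ (A * k1)%:E); last by rewrite ltry.
apply: le_trans (iG A A0); apply: ge0_le_integral => //=.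
- by apply/measurable_EFinP; apply: measurableT_comp => //; exact: mG.
- by apply/measurable_EFinP; exact: mG.
- by move=> z; rewrite in_itv/= andbT => z0; rewrite lee_fin ger0_norm// ltW// G_gt0.
Qed.

Lemma G_Rint_le A : 0 < A -> \int[mu]_(z in pos) G (z / A) <= A * k1.
Proof.
move=> A0; have [_ _ mG _ [_ _ iG]] := hG.
rewrite -lee_fin /Rintegral fineK; first exact: iG.
by apply: integrable_fin_num => //; exact: G_integrable.
Qed.

Lemma inc_measurable K f v w : lipv K f -> measurable_fun (setT : set R') (inc I f v w).
Proof.
move=> fK; apply: continuous_measurable_fun.
exact: (lipschitz_continuous1 (inc_lipschitz hI fK v w)).
Qed.

Lemma inc_G_integrable K f v w A : lipv K f -> 0 < A ->
  mu.-integrable pos (fun z => (inc I f v w (G (z / A)))%:E).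
Proof.
move=> fK A0; have [_ _ mG _ _] := hG.
have iG := integrableZl mpos (2 * pi * (K * enorm (v - w))) (G_integrable A0).
apply: (le_integrable _ _ _ iG) => //.
  apply/measurable_EFinP; apply: (@measurableT_comp _ _ _ _ _ _ (inc I f v w : R' -> R')).
    exact: inc_measurable fK.
  exact: mG.
move=> z; rewrite /= in_itv/= andbT => z0; rewrite lee_fin.
apply: (le_trans (inc_le hI fK _ _ _)).
rewrite mulrA (ger0_norm (ltW (G_gt0 A0 z0))) ger0_norm// mulr_ge0 ?(ltW (G_gt0 A0 z0))//.
by rewrite mulr_ge0 ?mulr_ge0 ?pi_ge0 ?enorm_ge0// (lipv_ge0 fK).
Qed.

(** The rate |v - w|^gamma moves from in front of the integral into the angle: all collisions are
    indexed by the same Lebesgue variable z, and the pair (v, w) only selects the angle G (z /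
    rate). *)
Lemma collision_opE K f v w : lipv K f -> v != w ->
  collision_op gamma beta I f v w =
  \int[mu]_(z in pos) inc I f v w (G (z / (enorm (v - w) `^ gamma))).
Proof.
move=> fK vw; set A := enorm (v - w) `^ gamma.
have A0 : 0 < A by rewrite powR_gt0// enorm_gt0 subr_eq0.
have [_ _ mG _ [_ push _]] := hG.
have mF := inc_measurable v w fK.
set F := inc I f v w in mF *.
have iF := inc_G_integrable v w fK A0; rewrite -/F in iF.
have mFE : measurable_fun (setT : set R') (EFin \o F) by exact/measurable_EFinP.
have sub : dom `<=` `](0 : R), pi].
  by move=> t /=; rewrite !in_itv/= => /andP[-> h]/=; have := pi_gt0 R; lra.
have mAbF : measurable_fun dom (fun t : R' => (A * (beta t * F t))%:E).
  apply/measurable_EFinP; apply: measurable_funM => //; apply: measurable_funM.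
    exact: measurable_funS mb.
  exact: measurable_funTS.
(* The transfer formula concerns nonnegative functions, so the signed F is treated through its
   positive and negative parts. *)
have ep : (\int[mu]_(t in dom) ((fun t : R' => (A * (beta t * F t))%:E)^\+ t) =
    \int[mu]_(z in pos) ((fun z => (F (G (z / A)%R))%:E)^\+ z))%E.
  transitivity (\int[mu]_(z in pos) ((EFin \o F)^\+ (G (z / A)%R)))%E; last by apply: eq_integral => z _; rewrite !funeposE.
  rewrite -(push A (EFin \o F)^\+%E A0 (measurable_funepos mFE))//.
  apply: eq_integral => t; rewrite inE => /sub t01; rewrite !funeposE /= -EFin_max -EFin_max -EFinM.
  by rewrite mulrA maxr_pMr ?mulr0// mulr_ge0 ?(ltW A0)// b_ge0.
have en : (\int[mu]_(t in dom) ((fun t : R' => (A * (beta t * F t))%:E)^\- t) =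
    \int[mu]_(z in pos) ((fun z => (F (G (z / A)%R))%:E)^\- z))%E.
  transitivity (\int[mu]_(z in pos) ((EFin \o F)^\- (G (z / A)%R)))%E; last by apply: eq_integral => z _; rewrite !funenegE.
  rewrite -(push A (EFin \o F)^\-%E A0 (measurable_funeneg mFE))//.
  apply: eq_integral => t; rewrite inE => /sub t01; rewrite !funenegE /= -EFin_max -EFin_max -EFinM.
  by rewrite mulrA -mulrN maxr_pMr ?mulr0// mulr_ge0 ?(ltW A0)// b_ge0.
have eI : (\int[mu]_(t in dom) (A * (beta t * F t))%:E =
   \int[mu]_(z in pos) (F (G (z / A)%R))%:E)%E.
  by rewrite integralE [RHS]integralE ep en.
have ibF : mu.-integrable dom (EFin \o (fun t => A * (beta t * F t))).
  have /integrableP[_ iFlt] := iF.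
  apply/integrableP; split => //.
  apply: le_lt_trans iFlt; rewrite -(push A (fun t => `|F t|%:E))//.
  - apply: ge0_le_integral => //=.
    + apply/measurable_EFinP; apply: measurableT_comp => //.
      by have /measurable_EFinP := mAbF.
    + apply: emeasurable_funM; last by apply: measurable_funTS; apply/measurable_EFinP; exact: measurableT_comp.
      by apply/measurable_EFinP; apply: measurable_funM => //; exact: measurable_funS mb.
    + move=> t /sub t01; rewrite -EFinM lee_fin !normrM (ger0_norm (ltW A0)) mulrA.
      by rewrite (ger0_norm (b_ge0 t01)).
  - by apply/measurable_EFinP; exact: measurableT_comp.
rewrite /collision_op -/A.
have ibF' : mu.-integrable dom (EFin \o (fun t => beta t * F t)).
  have := integrableZl mdom A^-1 ibF.
  apply: eq_integrable => // t _ /=.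
  by rewrite -EFinM mulKf// gt_eqF.
transitivity (\int[mu]_(t in dom) (A * (beta t * F t))); first by rewrite RintegralZl.
by rewrite /Rintegral eI.
Qed.

End generator.

Lemma powR_le_1D (R : realType) (r s : R) : 0 <= r -> 0 <= s <= 1 -> r `^ s <= 1 + r.
Proof.
move=> r0 /andP[s0 s1]; have [r1|r1] := leP r 1.
  apply: (@le_trans _ _ 1); last by rewrite lerDl.
  have [->|rn] := eqVneq r 0.
    by rewrite /powR eqxx; case: (_ == _).
  have rp : 0 < r <= 1 by rewrite lt_def rn r0.
  by rewrite -(powRr0 r); apply: ger_powR.
apply: (@le_trans _ _ r); last by rewrite lerDr.
by rewrite -[leRHS](powRr1 r0); apply: ler_powR => //; exact: ltW.
Qed.

(** * Comparison of two collisions driven by the same variable *)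

Section matching.
Context {R : realType}.
Implicit Types (x y : vec R) (t c : R).

Lemma combine_le x y (a a' d : R) : enorm x * `|a - a'| <= d ->
  enorm (a *: x - a' *: y) <= enorm (x - y) * `|a'| + d.
Proof.
move=> h; have -> : a *: x - a' *: y = a' *: (x - y) + (a - a') *: x.
  by apply: vec_ext; rewrite /= /GRing.scale /=; ring.
apply: (le_trans (enormD _ _)); rewrite !enormZ (mulrC `|a'|) lerD2l.
by rewrite mulrC.
Qed.

(** The difference of the angles multiplies the shorter vector x. With r = |x| / |y| one has |x| (1
    - r) = r (|y| - |x|) <= r |x - y|, so the mismatch is of first order in |x - y|, and the factor
    r that remains compensates the larger rate of x later on. *)
Lemma matching_le x y t t' c : y != 0 -> enorm x <= enorm y -> 0 <= c ->
  0 <= t' -> t' <= t -> t - t' <= c * (1 - enorm x / enorm y) * t ->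
  enorm (sin t *: x - sin t' *: y) <= enorm (x - y) * (t' + c * (enorm x / enorm y) * t) /\
  enorm ((1 - cos t') / 2 *: y - (1 - cos t) / 2 *: x) <=
     enorm (x - y) * (t' + c * (enorm x / enorm y) * t).
Proof.
move=> y0 xy c0 t'0 tt' h.
have ny : 0 < enorm y by rewrite enorm_gt0.
have nx := enorm_ge0 x.
have D : enorm y - enorm x <= enorm (x - y) by rewrite enormBC; exact: enorm_sub_ge.
set r := enorm x / enorm y in h *.
have r0 : 0 <= r by rewrite divr_ge0 ?enorm_ge0.
have main : enorm x * `|t - t'| <= enorm (x - y) * (c * r * t).
  rewrite ger0_norm ?subr_ge0//.
  apply: (@le_trans _ _ (enorm x * (c * (1 - r) * t))); first by rewrite ler_wpM2l.
  have -> : enorm x * (c * (1 - r) * t) = (enorm y - enorm x) * (c * r * t).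
    by rewrite /r; field; rewrite gt_eqF.
  have crt : 0 <= c * r * t by rewrite mulr_ge0 ?(le_trans t'0 tt')// mulr_ge0.
  exact: ler_wpM2r.
have lip (u u' : R) : `|u - u'| <= `|t - t'| -> enorm x * `|u - u'| <= enorm (x - y) * (c * r * t).
  by move=> hu; apply: le_trans main; rewrite ler_wpM2l.
split; rewrite mulrDr.
  have h1 := @combine_le x y _ _ _ (lip _ _ (sin_lipschitz t t')).
  apply: (le_trans h1).
  rewrite lerD2r ler_wpM2l ?enorm_ge0//.
  by apply: (le_trans (abs_sin_le _)); rewrite ger0_norm.
have half (u : R) : `|u / 2| <= `|u| by rewrite normrM ler_piMr// ger0_norm// invf_le1// ler1n.
rewrite [X in X <= _]enormBC.
have cl : `|(1 - cos t) / 2 - (1 - cos t') / 2| <= `|t - t'|.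
  rewrite -mulrBl (_ : 1 - cos t - (1 - cos t') = cos t' - cos t); last by ring.
  by apply: (le_trans (half _)); rewrite distrC; exact: cos_lipschitz.
have h1 := @combine_le x y _ _ _ (lip _ _ cl).
apply: (le_trans h1).
rewrite lerD2r ler_wpM2l ?enorm_ge0//.
apply: (le_trans (half _)); have := cos_lipschitz 0 t'.
by rewrite cos0 sub0r normrN (ger0_norm t'0).
Qed.

(* [q] is the mean displacement and [s] the transverse one; both are first order in [m]. *)
Lemma bracket_le (u q s : vec R) (D m c : R) : 0 <= D -> 0 <= m -> m <= c -> 1 <= c ->
  enorm q <= D * m -> enorm s <= D * m ->
  enorm (u + q) ^+ 2 + enorm s ^+ 2 / 4 <= enorm u ^+ 2 + 2 * c * m * (D * (enorm u + D)).
Proof.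
move=> D0 m0 mc c1 hq hs.
have hq2 : enorm q ^+ 2 <= (D * m) ^+ 2 by rewrite ler_pXn2r ?nnegrE ?enorm_ge0 ?mulr_ge0.
have hs2 : enorm s ^+ 2 <= (D * m) ^+ 2 by rewrite ler_pXn2r ?nnegrE ?enorm_ge0 ?mulr_ge0.
have dq : 2 * dotv u q <= 2 * (enorm u * (D * m)).
  by rewrite ler_pM2l//; apply: (le_trans (dotv_ub _ _)); rewrite ler_wpM2l ?enorm_ge0.
have nu0 := enorm_ge0 u.
rewrite dotvD_sqr.
have h1 : (D * m) ^+ 2 <= c * (m * D ^+ 2).
  by rewrite exprMn mulrC (expr2 m) -!mulrA ler_wpM2r// ?mulr_ge0 ?sqr_ge0.
have h2 : enorm u * (D * m) <= c * m * (D * enorm u).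
  rewrite (_ : enorm u * (D * m) = 1 * (m * (D * enorm u))); last by ring.
  by rewrite -(mulrA c) ler_wpM2r ?mulr_ge0.
have h3 : 0 <= c * (m * D ^+ 2) by rewrite !mulr_ge0 ?sqr_ge0// (le_trans _ c1).
have -> : 2 * c * m * (D * (enorm u + D)) = 2 * (c * m * (D * enorm u)) + 2 * (c * (m * D ^+ 2)) by ring.
move: hq2 hs2 dq h1 h2 h3.
move: (enorm q ^+ 2) (enorm s ^+ 2) ((D * m) ^+ 2) (c * (m * D ^+ 2)) (c * m * (D * enorm u)) (enorm u * (D * m)) (dotv u q) (enorm u ^+ 2).
by move=> *; lra.
Qed.

End matching.

Section Rint_split.
Context {R : realType}.
Local Notation mu := (@lebesgue_measure R).
Local Notation pos := ([set` `[(0 : R), +oo[] : set (measurableTypeR R)).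

(** The constant c0 will be the duality gap: it is not integrable over the half-line, which forces
    the cutoff N and the separate majorant T beyond it. *)
Lemma Rint_split_le (q m T : measurableTypeR R -> R) (N c0 c1 tau : R) :
  0 <= N -> 0 <= c1 ->
  mu.-integrable pos (EFin \o q) -> mu.-integrable pos (EFin \o m) ->
  (forall z : R, 0 <= z -> 0 <= m z) ->
  (forall z : R, 0 <= z -> z <= N -> q z <= c0 + c1 * m z) ->
  (forall z : R, N < z -> q z <= T z) ->
  mu.-integrable [set` `]N, +oo[] (EFin \o T) ->
  \int[mu]_(z in [set` `]N, +oo[]) T z <= tau ->
  \int[mu]_(z in pos) q z <= N * c0 + c1 * \int[mu]_(z in pos) m z + tau.
Proof.
move=> N0 c10 iq im m0 h1 h2 iT Ttau.
pose A : set (measurableTypeR R) := [set` `[(0 : R), N]].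
pose B : set (measurableTypeR R) := [set` `]N, +oo[].
have mA : measurable A by exact: measurable_itv.
have mB : measurable B by exact: measurable_itv.
have posE : pos = A `|` B.
  apply/seteqP; split => z; rewrite /A /B /= !in_itv/= !andbT.
    by move=> ->/=; case: (leP z N); [left|right].
  by move=> [/andP[]//|/ltW]; exact: le_trans.
have AB : [disjoint A & B].
  apply/disj_setPS => z; rewrite /A /B /= !in_itv/= andbT => -[/andP[_ zN] Nz].
  by have := lt_le_trans Nz zN; rewrite ltxx.
have sA : A `<=` pos by rewrite posE; exact: subsetUl.
have sB : B `<=` pos by rewrite posE; exact: subsetUr.
have mpos : measurable pos by exact: measurable_itv.
have iqA := integrableS mpos mA sA iq. have iqB := integrableS mpos mB sB iq.
have imA := integrableS mpos mA sA im. have imB := integrableS mpos mB sB im.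
have ic : mu.-integrable A (EFin \o cst c0).
  by apply: (@continuous_Rint _ (cst c0) 0 N) => x; exact: cvg_cst.
have muA : fine (mu A) = N.
  rewrite /A lebesgue_measure_itv/= lte_fin; case: ltP => [_|N0'].
    by rewrite -EFinB /= subr0.
  by apply/eqP; rewrite eq_le N0 N0'.
have icm : mu.-integrable A (EFin \o (fun z => c1 * m z)).
  by have := integrableZl mA c1 imA; apply: eq_integrable => // z _; rewrite /= EFinM.
rewrite posE Rintegral_setU//; last by rewrite -posE.
rewrite [in X in _ <= X]Rintegral_setU//; last by rewrite -posE.
have e1 : \int[mu]_(z in A) q z <= N * c0 + c1 * \int[mu]_(z in A) m z.
  apply: (@le_trans _ _ (\int[mu]_(z in A) (cst c0 z + c1 * m z))).
    apply: le_Rintegral => //.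
      have := integrableD mA ic icm; apply: eq_integrable => // z _ /=.
    by move=> z; rewrite /A /= in_itv/= => /andP[z0 zN]; exact: h1.
  rewrite RintegralD// RintegralZl// Rintegral_cst// lerD2r.
  by rewrite muA mulrC.
have e2 : \int[mu]_(z in B) q z <= tau.
  apply: le_trans Ttau; apply: le_Rintegral => // z.
  by rewrite /B /= in_itv/= andbT; exact: h2.
have e3 : 0 <= c1 * \int[mu]_(z in B) m z.
  rewrite mulr_ge0// Rintegral_ge0// => z /sB; rewrite /= in_itv/= andbT; exact: m0.
rewrite mulrDr.
move: e1 e2 e3; move: (\int[mu]_(z in A) q z) (\int[mu]_(z in B) q z) (c1 * \int[mu]_(z in B) m z) (c1 * \int[mu]_(z in A) m z) => *.
lra.
Qed.

End Rint_split.

Lemma matching_bound (R : realType) (c r g g' : R) : 0 <= c -> 0 <= r -> r <= 1 ->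
  0 <= g' -> g' <= 2 -> g <= 2 -> g + c * r * g' <= 4 * (1 + c).
Proof.
move=> c0 r0 r1 h0 h1 h2; have : c * r * g' <= c * 1 * 2 by rewrite !ler_pM// mulr_ge0.
lra.
Qed.

Lemma distance_product (R : realType) (D a b : R) : 0 <= D -> 0 <= a -> 0 <= b ->
  D <= a + b -> D * (a + D) <= 8 * (a ^+ 2 + b ^+ 2).
Proof.
move=> D0 a0 b0 h; apply: (@le_trans _ _ ((a + b) * (a + (a + b)))).
  by rewrite ler_pM ?addr_ge0// lerD2l.
have := sqr_ge0 (a - b); have := sqr_ge0 a; have := sqr_ge0 b; nra.
Qed.

Lemma matching_mass (R : realType) (a b c r k : R) : 0 <= c -> 0 <= k -> r * b <= a ->
  a * k + c * r * (b * k) <= k * (1 + c) * a.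
Proof.
move=> c0 k0 h; rewrite (_ : a * k + c * r * (b * k) = k * (a + c * (r * b))); last by ring.
by rewrite -mulrA ler_wpM2l// mulrDl mul1r lerD// ler_wpM2l.
Qed.

Section generator_bounds.
Context {R : realType} (gamma nu : R) (beta G : R -> R) (Cr Cd k1 : R) (I : vec R -> vec R).
Hypotheses (hgamma : -1 < gamma < 0) (nu01 : 0 < nu < 1) (hgn : 0 < gamma + nu)
  (mb : measurable_fun `](0 : R), pi] beta) (b_ge0 : {in `](0 : R), pi], forall t, 0 <= beta t})
  (hG : inverse_angle nu beta G Cr Cd k1) (hI : orthogonal_selection I).
Local Notation mu := (@lebesgue_measure R).
Local Notation pos := ([set` `[(0 : R), +oo[] : set (measurableTypeR R)).
Implicit Types (f h : vec R -> R) (K A B N M : R) (v w x y : vec R).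

Let Cr0 : 0 <= Cr. Proof. by case: hG => -[]. Qed.
Let Cd0 : 0 <= Cd. Proof. by case: hG => -[]. Qed.
Let k10 : 0 <= k1. Proof. by case: hG => -[]. Qed.

Let G_ge0 A z : 0 < A -> 0 <= z -> 0 <= G (z / A).
Proof. by move=> A0 z0; case: hG => _ /(_ (z / A)) H _ _ _; have /andP[/ltW] := H (divr_ge0 z0 (ltW A0)). Qed.

Let G_le2 A z : 0 < A -> 0 <= z -> G (z / A) <= 2.
Proof.
move=> A0 z0; case: hG => _ /(_ (z / A)) H _ _ _; have /andP[_ h] := H (divr_ge0 z0 (ltW A0)).
by apply: (le_trans h); exact/ltW/pihalf_lt2.
Qed.

Let G_sin A z : 0 < A -> 0 <= z -> 0 <= sin (G (z / A)).
Proof.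
move=> A0 z0; case: hG => _ /(_ (z / A)) H _ _ _; have /andP[/ltW h1 h2] := H (divr_ge0 z0 (ltW A0)).
apply: sin_ge0_pi; rewrite h1 /=; apply: (le_trans h2).
by rewrite ler_pdivrMr// ler_peMr ?pi_ge0// ler1n.
Qed.

(** [powR] sends 0 to 0 for every nonzero exponent, negative ones included, so the singular factor
    vanishes on the diagonal. *)
Lemma collision_op_diag f v : collision_op gamma beta I f v v = 0.
Proof.
rewrite /collision_op subrr enorm0 powR0 ?mul0r//.
by have /andP[_ g0] := hgamma; rewrite lt_eqF.
Qed.

Let powA x : x != 0 -> 0 < enorm x `^ gamma.
Proof. by move=> x0; rewrite powR_gt0// enorm_gt0. Qed.

(** The angles have total mass of order |v - w|^gamma and a collision of angle theta displaces by at
    most |v - w| theta. The product |v - w|^(1 + gamma) is at most 1 + |v - w| since the exponent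
    lies in ]0, 1[. *)
Lemma collision_op_le K f v w : lipv K f ->
  `|collision_op gamma beta I f v w| <= 2 * pi * K * k1 * (1 + enorm (v - w)).
Proof.
move=> fK; have K0 := lipv_ge0 fK.
have c0 : 0 <= 2 * pi * K * k1 by rewrite !mulr_ge0// pi_ge0.
have [->|vw] := eqVneq v w.
  by rewrite collision_op_diag normr0 mulr_ge0// addr_ge0 ?enorm_ge0.
have x0 : v - w != 0 by rewrite subr_eq0.
have A0 := powA x0; set A := _ `^ _ in A0.
rewrite (collision_opE gamma mb b_ge0 hG hI fK vw) -/A.
have iI := inc_G_integrable hG hI v w fK A0.
have mpos : measurable pos by exact: measurable_itv.
apply: (le_trans (le_normr_Rintegral mpos iI)).
apply: (@le_trans _ _ (\int[mu]_(z in pos) (2 * pi * (K * enorm (v - w)) * G (z / A)))).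
  apply: le_Rintegral => //.
  - exact: (integrable_norm iI).
  - have := integrableZl mpos (2 * pi * (K * enorm (v - w))) (G_integrable hG A0).
    by apply: eq_integrable => // z _; rewrite /= EFinM.
  - move=> z; rewrite /= in_itv/= andbT => z0; apply: (le_trans (inc_le hI fK _ _ _)).
    by rewrite (ger0_norm (G_ge0 A0 z0)) mulrA.
rewrite RintegralZl//; last exact: (G_integrable hG A0).
apply: (@le_trans _ _ (2 * pi * (K * enorm (v - w)) * (A * k1))).
  by rewrite ler_wpM2l ?(G_Rint_le hG A0)// !mulr_ge0 ?pi_ge0 ?enorm_ge0.
rewrite (_ : 2 * pi * (K * enorm (v - w)) * (A * k1) = 2 * pi * K * k1 * (enorm (v - w) * A)); last by ring.
rewrite ler_wpM2l// /A -{1}(powRr1 (enorm_ge0 (v - w))) -powRD; last first.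
  by rewrite enorm_eq0 x0 implybT.
have /andP[g1 g0] := hgamma.
by apply: powR_le_1D; [exact: enorm_ge0|apply/andP; split; lra].
Qed.

(** For a <= b and -1 < gamma < 0, (b / a)^gamma lies between a / b and 1. *)
Let speed_ratio (a b : R) : 0 < a -> a <= b ->
  b `^ gamma <= a `^ gamma /\ a / b <= b `^ gamma / a `^ gamma.
Proof.
have /andP[g1 g0] := hgamma.
move=> a0 ab; have b0 := lt_le_trans a0 ab.
have ba : 1 <= b / a by rewrite ler_pdivlMr// mul1r.
have e : b `^ gamma / a `^ gamma = (b / a) `^ gamma.
  rewrite powRM ?(ltW b0) ?invr_ge0 ?(ltW a0)//; congr (_ * _).
  by rewrite -[a^-1](powR_inv1 (ltW a0)) -powRrM mulN1r powRN.
split; last first.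
  rewrite e -invf_div -(powR_inv1 (_ : 0 <= b / a)); last by rewrite (le_trans _ ba).
  by apply: ler_powR => //; exact: ltW.
have : (b / a) `^ gamma <= 1.
  by rewrite -(powRr0 (b / a)); apply: ler_powR => //; exact: ltW.
by rewrite -e ler_pdivrMr ?mul1r// powR_gt0.
Qed.

(** The ratio property of G with l equal to the quotient of the two rates, whose inverse is at least
    a / b. *)
Let G_diff (a b z : R) : 0 < a -> a <= b -> 0 <= z ->
  G (z / b `^ gamma) <= G (z / a `^ gamma) /\
  G (z / a `^ gamma) - G (z / b `^ gamma) <= Cr * (1 - a / b) * G (z / a `^ gamma).
Proof.
move=> a0 ab z0; have b0 := lt_le_trans a0 ab.
have [h1 h2] := speed_ratio a0 ab.
have A0 : 0 < a `^ gamma by exact: powR_gt0.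
have B0 : 0 < b `^ gamma by exact: powR_gt0.
have [_ _ _ [Gd Gr] _] := hG.
have zA0 : 0 <= z / a `^ gamma by rewrite divr_ge0// ltW.
split.
  by apply: Gd => //; rewrite ler_wpM2l// lef_pV2 ?posrE.
have l1 : 1 <= a `^ gamma / b `^ gamma by rewrite ler_pdivlMr// mul1r.
have := Gr _ _ zA0 l1.
have -> : a `^ gamma / b `^ gamma * (z / a `^ gamma) = z / b `^ gamma.
  by field; rewrite !gt_eqF.
move=> h; apply: (le_trans h); rewrite invf_div.
by rewrite ler_wpM2r ?G_ge0// ler_wpM2l// lerD2l lerN2.
Qed.

(** The modulus m bounds both the transverse and the mean mismatch relative to |x - y|, and its
    integral is controlled by the rate of x alone; no information on the distribution of y will be
    needed. If x is the shorter vector its rate A is the larger one, but its angle is weighted by r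
    with r * A <= B <= A. If y is the shorter one, its larger rate B is weighted by r with r * B <=
    A. *)
Lemma exists_matching x y : x != 0 -> exists (B : R) (m : R -> R),
  [/\ 0 < B, y != 0 -> B = enorm y `^ gamma,
   forall z, 0 <= z -> [/\ 0 <= m z, m z <= 4 * (1 + Cr),
     enorm (sin (G (z / enorm x `^ gamma)) *: x - sin (G (z / B)) *: y) <= enorm (x - y) * m z &
     enorm ((1 - cos (G (z / B))) / 2 *: y - (1 - cos (G (z / enorm x `^ gamma))) / 2 *: x)
       <= enorm (x - y) * m z],
   mu.-integrable pos (EFin \o m) & \int[mu]_(z in pos) m z <= k1 * (1 + Cr) * enorm x `^ gamma].
Proof.
move=> x0; have A0 := powA x0; set A := enorm x `^ gamma in A0 *.
have nx : 0 < enorm x by rewrite enorm_gt0.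
have mpos : measurable pos by exact: measurable_itv.
have comb (a b c : R) : 0 < a -> 0 < b -> 0 <= c -> let m := (fun z => G (z / a) + c * G (z / b)) in
    mu.-integrable pos (EFin \o m) /\ \int[mu]_(z in pos) m z <= a * k1 + c * (b * k1).
  move=> a0 b0 c0 m.
  have ia := G_integrable hG a0; have ib := G_integrable hG b0.
  have icb : mu.-integrable pos (EFin \o (fun z => c * G (z / b))).
    by have := integrableZl mpos c ib; apply: eq_integrable => // z _; rewrite /= EFinM.
  split.
    by have := integrableD mpos ia icb; apply: eq_integrable => // z _; rewrite /= EFinD.
  rewrite /m RintegralD// RintegralZl// lerD ?(G_Rint_le hG)// ler_wpM2l//.
  exact: (G_Rint_le hG).
have Cr1 : 1 <= 1 + Cr by rewrite lerDl.
(* For y = 0 no rate is prescribed: B = A gives both collisions the same angle, and the summand with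
   coefficient 0 keeps the shape required by [comb]. *)
have [yE|y0] := eqVneq y 0.
  exists A, (fun z => G (z / A) + 0 * G (z / A)); split=> //.
  - move=> z z0; rewrite mul0r addr0; have g0 := G_ge0 A0 z0; have g2 := G_le2 A0 z0.
    have h0 (a : R) : enorm x * `|a - a| <= 0 by rewrite subrr normr0 mulr0.
    split => //; first lra.
    + apply: (le_trans (@combine_le _ x y _ _ _ (h0 (sin (G (z / A)))))); rewrite addr0 ler_wpM2l ?enorm_ge0//.
      by apply: (le_trans (abs_sin_le _)); rewrite ger0_norm.
    + rewrite [X in X <= _]enormBC; apply: (le_trans (@combine_le _ x y _ _ _ (h0 ((1 - cos (G (z / A))) / 2)))).
      rewrite addr0 ler_wpM2l ?enorm_ge0//.
      have := cos_lipschitz 0 (G (z / A)); rewrite cos0 sub0r normrN (ger0_norm g0) => h.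
      by rewrite normrM (ger0_norm (_ : 0 <= 2^-1))// ler_pdivrMr// (le_trans h)// ler_peMr// ler1n.
  - by have [] := comb A A 0 A0 A0 (lexx _).
  - have [_ h] := comb A A 0 A0 A0 (lexx _); apply: (le_trans h).
    by rewrite mul0r addr0 mulrC ler_wpM2r ?(ltW A0)// ler_peMr.
have B0 := powA y0; set B := enorm y `^ gamma in B0.
have ny : 0 < enorm y by rewrite enorm_gt0.
exists B.
have [xy|/ltW yx] := leP (enorm x) (enorm y).
  set r := enorm x / enorm y.
  have r0 : 0 <= r by rewrite divr_ge0 ?enorm_ge0.
  have r1 : r <= 1 by rewrite ler_pdivrMr// mul1r.
  have [s1 s2] := speed_ratio nx xy.
  have Cr' : 0 <= Cr * r by rewrite mulr_ge0.
  exists (fun z => G (z / B) + (Cr * r) * G (z / A)); split=> //.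
  - move=> z z0; have [d1 d2] := G_diff nx xy z0.
    have ga := G_ge0 A0 z0; have gb := G_ge0 B0 z0.
    have ga2 := G_le2 A0 z0; have gb2 := G_le2 B0 z0.
    have [m1 m2] := matching_le y0 xy Cr0 gb d1 d2.
    split => //; first by rewrite addr_ge0// mulr_ge0.
    exact: matching_bound Cr0 r0 r1 ga ga2 gb2.
  - by have [] := comb B A (Cr * r) B0 A0 Cr'.
  - have [_ h] := comb B A (Cr * r) B0 A0 Cr'; apply: (le_trans h).
    have rA : r * A <= B by move: s2; rewrite ler_pdivlMr.
    apply: (le_trans (matching_mass Cr0 k10 rA)).
    exact: (ler_wpM2l (mulr_ge0 k10 (le_trans ler01 Cr1)) s1).
set r := enorm y / enorm x.
have r0 : 0 <= r by rewrite divr_ge0 ?enorm_ge0.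
have r1 : r <= 1 by rewrite ler_pdivrMr// mul1r.
have [s1 s2] := speed_ratio ny yx.
have Cr' : 0 <= Cr * r by rewrite mulr_ge0.
exists (fun z => G (z / A) + (Cr * r) * G (z / B)); split=> //.
- move=> z z0; have [d1 d2] := G_diff ny yx z0.
  have ga := G_ge0 A0 z0; have gb := G_ge0 B0 z0.
  have ga2 := G_le2 A0 z0; have gb2 := G_le2 B0 z0.
  have [m1 m2] := matching_le x0 yx Cr0 ga d1 d2.
  rewrite (enormBC x y); split => //; first by rewrite addr_ge0// mulr_ge0.
  + exact: matching_bound Cr0 r0 r1 gb gb2 ga2.
  + by rewrite [X in X <= _]enormBC.
  + by rewrite [X in X <= _]enormBC.
- by have [] := comb A B (Cr * r) A0 B0 Cr'.
- have [_ h] := comb A B (Cr * r) A0 B0 Cr'; apply: (le_trans h).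
  have rA : r * B <= A by move: s2; rewrite ler_pdivlMr.
  exact: matching_mass Cr0 k10 rA.
Qed.

(** The integral of Cd * z^(-1 / nu) over z > N, which bounds the mean angle of the discarded
    collisions, times the length 2 pi of the azimuths. It tends to 0 as N grows because nu < 1. *)
Definition tail_rate N : R := 2 * pi * Cd * (N `^ (1 - nu^-1) / (nu^-1 - 1)).

(** The decay of G gives |x|^(1 + gamma / nu) z^(-1 / nu). The exponent of |x| lies in [0, 1] thanks
    to gamma + nu > 0 and gamma < 0. *)
Lemma tail_G N x z : 0 < N -> N < z -> x != 0 ->
  enorm x * G (z / enorm x `^ gamma) <= (1 + enorm x) * (Cd * z `^ (- nu^-1)).
Proof.
move=> N0 Nz x0; have z0 := lt_trans N0 Nz.
have A0 := powA x0; set A := _ `^ _ in A0 *.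
have /andP[n0 n1] := nu01; have /andP[g1 g0] := hgamma.
have nx : 0 < enorm x by rewrite enorm_gt0.
have [_ _ _ _ [dec _ _]] := hG.
have h := dec _ (divr_gt0 z0 A0).
apply: (le_trans (ler_wpM2l (ltW nx) h)).
rewrite powRM ?(ltW z0) ?invr_ge0 ?(ltW A0)//.
have e : A^-1 `^ (- nu^-1) = enorm x `^ (gamma / nu).
  by rewrite /A -[(_ `^ gamma)^-1]powR_inv1 ?powR_ge0// -!powRrM; congr (_ `^ _); ring.
rewrite e (_ : enorm x * (Cd * (z `^ (- nu^-1) * enorm x `^ (gamma / nu))) =
   (enorm x * enorm x `^ (gamma / nu)) * (Cd * z `^ (- nu^-1))); last by ring.
rewrite ler_wpM2r ?mulr_ge0 ?powR_ge0//.
rewrite -{1}(powRr1 (ltW nx)) -powRD; last by rewrite (gt_eqF nx) implybT.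
have q : gamma / nu <= 0 by rewrite pmulr_lle0 ?invr_gt0// ltW.
have q1 : -1 <= gamma / nu by rewrite ler_pdivlMr// mulN1r -subr_ge0 opprK ltW.
move: q q1; move: (gamma / nu) => r q q1.
by apply: powR_le_1D; [exact: ltW|apply/andP; split; lra].
Qed.

Lemma tail_power_integrable N (c : R) : 0 < N ->
  mu.-integrable [set` `]N, +oo[] (EFin \o (fun z : measurableTypeR R => c * (z : R) `^ (- nu^-1))) /\
  (0 <= c -> \int[mu]_(z in [set` `]N, +oo[]) (c * z `^ (- nu^-1)) <= c * (N `^ (1 - nu^-1) / (nu^-1 - 1))).
Proof.
move=> N0; have /andP[n0 n1] := nu01.
have s1 : 1 < nu^-1 by rewrite invf_gt1.
pose B : set (measurableTypeR R) := [set` `]N, +oo[].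
have mB : measurable B by exact: measurable_itv.
have mp : measurable_fun B (fun z : measurableTypeR R => ((z : R) `^ (- nu^-1))%:E).
  by apply: measurable_funTS; apply/measurable_EFinP; exact: measurable_powR.
have ub := integral_powR_infty s1 N0.
have ip : mu.-integrable B (EFin \o (fun z : measurableTypeR R => (z : R) `^ (- nu^-1))).
  apply/integrableP; split => //; apply: le_lt_trans (ltry (N `^ (1 - nu^-1) / (nu^-1 - 1))).
  apply: le_trans ub; rewrite le_eqVlt; apply/orP; left; apply/eqP.
  by apply: eq_integral => z _; rewrite /= ger0_norm ?powR_ge0.
split.
  by have := integrableZl mB c ip; apply: eq_integrable => // z _; rewrite /= EFinM.
move=> c0; rewrite RintegralZl// ler_wpM2l//.
rewrite -lee_fin /Rintegral fineK; first exact: ub.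
exact: integrable_fin_num.
Qed.

Lemma inc_pair_tail K f h v v' w w' t t' : lipv K f -> lipv K h -> 0 <= t -> 0 <= t' ->
  inc I f v v' t + inc I h w w' t' <= 2 * pi * K * (enorm (v - v') * t + enorm (w - w') * t').
Proof.
move=> fK hK t0 t'0.
have h1 := le_trans (ler_norm _) (inc_le hI fK v v' t).
have h2 := le_trans (ler_norm _) (inc_le hI hK w w' t').
rewrite (ger0_norm t0) in h1; rewrite (ger0_norm t'0) in h2.
apply: (le_trans (lerD h1 h2)); rewrite le_eqVlt; apply/orP; left; apply/eqP; ring.
Qed.

(* The collisions with z <= N are matched by rotating the azimuth of one of them; there the
   constraint f + h <= tcost is applied after the collisions, which costs the duality gap before
   them.  Those with z > N, of mean angle [tail_rate N], are only estimated by the Lipschitz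
   constants. *)
Lemma collision_pair K f h M N v v' w w' : lipv K f -> lipv K h ->
  (forall a b, f a + h b <= tcost M a b) -> 0 < N -> v != v' ->
  enorm v <= M -> enorm w <= M ->
  collision_op gamma beta I f v v' + collision_op gamma beta I h w w' <=
  64 * pi * (1 + Cr) ^+ 2 * k1 *
    (enorm (v - v') `^ gamma * (2 * (enorm (v - w) ^+ 2 + enorm (v' - w') ^+ 2))) +
  N * (2 * pi * (tcost M v w - f v - h w)) +
  K * tail_rate N * (2 + enorm (v - v') + enorm (w - w')).
Proof.
move=> fK hK fh N0 vv vM wM.
have K0 := lipv_ge0 fK.
set x := v - v'; set y := w - w'.
have x0 : x != 0 by rewrite subr_eq0.
have [B [m [B0 By mP im imle]]] := exists_matching y x0.
set A := enorm x `^ gamma in mP imle *.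
have A0 : 0 < A := powA x0.
have mpos : measurable pos by exact: measurable_itv.
have iF := inc_G_integrable hG hI v v' fK A0.
have iH := inc_G_integrable hG hI w w' hK B0.
(* If w = w' the operator and all increments vanish, so the formula holds for whatever B was
   chosen. *)
have eH : collision_op gamma beta I h w w' = \int[mu]_(z in pos) inc I h w w' (G (z / B)).
  have [ww|ww] := eqVneq w w'.
    rewrite -ww collision_op_diag /Rintegral integral0_eq// => z _.
    by rewrite (inc_diag hI hK).
  by rewrite (collision_opE gamma mb b_ge0 hG hI hK ww) By// subr_eq0.
rewrite (collision_opE gamma mb b_ge0 hG hI fK vv) -/x -/A eH -RintegralD//.
(* The factor 4 * (1 + Cr) is the uniform bound on m, used in [bracket_le] to reduce the square of m
   to its first power. *)
pose c1 := 2 * pi * (2 * (4 * (1 + Cr)) * (enorm (x - y) * (enorm (v - w) + enorm (x - y)))).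
pose c2 := 2 * pi * K * (2 + enorm x + enorm y) * Cd.
have pi0 : 0 <= 2 * pi :> R by rewrite mulr_ge0 ?pi_ge0.
have nxy := enorm_ge0 (x - y); have nvw := enorm_ge0 (v - w).
have Cr1 : 0 <= 1 + Cr by rewrite addr_ge0.
have c10 : 0 <= c1.
  exact: (mulr_ge0 pi0 (mulr_ge0 (mulr_ge0 (ler0n R 2) (mulr_ge0 (ler0n R 4) Cr1)) (mulr_ge0 nxy (addr_ge0 nvw nxy)))).
have nn : 0 <= 2 + enorm x + enorm y by rewrite !addr_ge0 ?enorm_ge0.
have c20 : 0 <= c2 := mulr_ge0 (mulr_ge0 (mulr_ge0 pi0 K0) nn) Cd0.
have [iT leT] := tail_power_integrable c2 N0.
have iq : mu.-integrable pos (EFin \o (fun z => inc I f v v' (G (z / A)) + inc I h w w' (G (z / B)))).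
  by have := integrableD mpos iF iH; apply: eq_integrable => // z _; rewrite /= EFinD.
have main := @Rint_split_le R _ m (fun z => c2 * z `^ (- nu^-1)) N
  (2 * pi * (tcost M v w - f v - h w)) c1 (c2 * (N `^ (1 - nu^-1) / (nu^-1 - 1)))
  (ltW N0) c10 iq im.
apply: (le_trans (main _ _ _ iT (leT c20))) => {main iT leT iq iF iH eH}.
- by move=> z z0; have [] := mP z z0.
- move=> z z0 zN; have [m0 m4 hs hq] := mP z z0.
  apply: (le_trans (inc_pair hI v v' w w' fK hK fh (G_sin A0 z0) (G_sin B0 z0))).
  rewrite -/x -/y (_ : 2 * pi * _ + c1 * m z = 2 * pi * (tcost M v w - f v - h w +
    2 * (4 * (1 + Cr)) * m z * (enorm (x - y) * (enorm (v - w) + enorm (x - y))))); last first.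
    by rewrite /c1; move: (tcost M v w - f v - h w) (enorm (x - y)) (enorm (v - w)) => a b c; ring.
  (* The bounds on |v| and |w| are used here: before the collisions the truncated cost must equal
     the squared distance. After the collisions [tcost_le] suffices. *)
  rewrite (ler_wpM2l pi0)// [leRHS]addrAC [X in _ <= X - _]addrAC !lerD2r tcost_id//.
  apply: bracket_le => //.
  by rewrite mulrDr mulr1 -[leLHS]addr0 lerD// ?ler1n// mulr_ge0.
- move=> z Nz; have z0 := ltW (lt_trans N0 Nz).
  apply: (le_trans (inc_pair_tail v v' w w' fK hK (G_ge0 A0 z0) (G_ge0 B0 z0))).
  rewrite /c2 -(mulrA _ _ Cd) -(mulrA _ _ (z `^ _)) -(mulrA _ Cd).
  rewrite (ler_wpM2l (mulr_ge0 pi0 K0))// -/x -/y.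
  have p0 : 0 <= Cd * z `^ (- nu^-1) by rewrite mulr_ge0 ?powR_ge0.
  have hx := tail_G N0 Nz x0.
  have hy : enorm y * G (z / B) <= (1 + enorm y) * (Cd * z `^ (- nu^-1)).
    have [yE|y0] := eqVneq y 0.
      by rewrite yE enorm0 mul0r addr0 mul1r; exact: p0.
    by rewrite (By y0); exact: (tail_G N0 Nz y0).
  apply: (le_trans (lerD hx hy)); rewrite -mulrDl ler_wpM2r//.
  by rewrite le_eqVlt; apply/orP; left; apply/eqP; move: (enorm x) (enorm y) => a b; ring.
- rewrite -addrA -[leRHS]addrA [leRHS]addrCA lerD2l lerD//.
    apply: (le_trans (ler_wpM2l c10 imle)).
    have tri : enorm (x - y) <= enorm (v - w) + enorm (v' - w').
      have -> : x - y = (v - w) - (v' - w') by apply: vec_ext; rewrite /x /y /=; ring.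
      exact: enormB.
    have sq := distance_product nxy nvw (enorm_ge0 (v' - w')) tri.
    have -> : c1 * (k1 * (1 + Cr) * A) = 16 * pi * (1 + Cr) ^+ 2 * k1 * A *
        (enorm (x - y) * (enorm (v - w) + enorm (x - y))).
      by rewrite /c1; move: (enorm (x - y)) (enorm (v - w)) (A) => a b c; ring.
    have k0 : 0 <= 16 * pi * (1 + Cr) ^+ 2 * k1 * A.
      exact: (mulr_ge0 (mulr_ge0 (mulr_ge0 (mulr_ge0 (ler0n R 16) (pi_ge0 R)) (sqr_ge0 _)) k10) (ltW A0)).
    apply: (le_trans (ler_wpM2l k0 sq)); rewrite le_eqVlt; apply/orP; left; apply/eqP.
    by move: (enorm (v - w)) (enorm (v' - w')) (A) => a b c; ring.
  rewrite /c2 /tail_rate -/x -/y le_eqVlt; apply/orP; left; apply/eqP.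
  by move: (enorm x) (enorm y) (N `^ _) => a b c; ring.
Qed.

End generator_bounds.

(** * Approximate Kantorovich duality *)

Section measurability.
Context {R : realType}.
Local Notation V := (vec R).
Local Notation R' := (measurableTypeR R).

Lemma measurable_c1 : measurable_fun (setT : set V) (fun x => x.1.1 : R').
Proof. exact: measurableT_comp measurable_fst measurable_fst. Qed.

Lemma measurable_c2 : measurable_fun (setT : set V) (fun x => x.1.2 : R').
Proof. exact: measurableT_comp measurable_snd measurable_fst. Qed.

Lemma measurable_c3 : measurable_fun (setT : set V) (fun x => x.2 : R').
Proof. exact: measurable_snd. Qed.

Lemma measurable_vec d (T : measurableType d) (f : T -> V) :
  measurable_fun setT (fun x => (f x).1.1 : R') -> measurable_fun setT (fun x => (f x).1.2 : R') ->
  measurable_fun setT (fun x => (f x).2 : R') -> measurable_fun setT f.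
Proof.
move=> h1 h2 h3; have -> : f = (fun x => ((f x).1.1, (f x).1.2, (f x).2)).
  by apply/funext => x; apply: vec_ext.
by apply: measurable_fun_pair => //; apply: measurable_fun_pair.
Qed.

Section vector_valued.
Context d (T : measurableType d).
Local Notation D := (setT : set T).
Implicit Types f g : T -> V.

Lemma measurable_vcoord f : measurable_fun D f ->
  [/\ measurable_fun D (fun x => (f x).1.1 : R'), measurable_fun D (fun x => (f x).1.2 : R') &
      measurable_fun D (fun x => (f x).2 : R')].
Proof.
move=> mf; split.
- exact: measurableT_comp measurable_c1 mf.
- exact: measurableT_comp measurable_c2 mf.
- exact: measurableT_comp measurable_c3 mf.
Qed.

Lemma measurable_vecD f g : measurable_fun D f -> measurable_fun D g ->
  measurable_fun D (fun x => f x + g x).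
Proof.
move=> /measurable_vcoord[f1 f2 f3] /measurable_vcoord[g1 g2 g3].
by apply: measurable_vec; apply: measurable_funD.
Qed.

Lemma measurable_vecZ (k : T -> R') f : measurable_fun D k -> measurable_fun D f ->
  measurable_fun D (fun x => (k x : R) *: f x).
Proof.
move=> mk /measurable_vcoord[f1 f2 f3].
by apply: measurable_vec; apply: measurable_funM.
Qed.

Lemma measurable_vecB f g : measurable_fun D f -> measurable_fun D g ->
  measurable_fun D (fun x => f x - g x).
Proof.
move=> /measurable_vcoord[f1 f2 f3] /measurable_vcoord[g1 g2 g3].
by apply: measurable_vec; apply: measurable_funB.
Qed.

Lemma measurable_dotv f g : measurable_fun D f -> measurable_fun D g ->
  measurable_fun D (fun x => dotv (f x) (g x) : R').
Proof.
move=> /measurable_vcoord[f1 f2 f3] /measurable_vcoord[g1 g2 g3].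
by apply: measurable_funD; [apply: measurable_funD|]; apply: measurable_funM.
Qed.

Lemma measurable_enorm f : measurable_fun D f -> measurable_fun D (fun x => enorm (f x) : R').
Proof.
move=> mf; apply: (@measurableT_comp _ _ _ _ _ _ (@Num.sqrt R : R' -> R')).
  by apply: continuous_measurable_fun; exact: sqrt_continuous.
exact: measurable_dotv.
Qed.

Lemma measurable_clampv M f : measurable_fun D f -> measurable_fun D (fun x => clampv M (f x)).
Proof.
move=> /measurable_vcoord[f1 f2 f3].
have mc (h : T -> R') : measurable_fun D h -> measurable_fun D (fun x => clamp M (h x) : R').
  by move=> mh; apply: measurable_maxr => //; apply: measurable_minr.
by apply: measurable_vec; apply: mc.
Qed.

Lemma measurable_tcost M f g : measurable_fun D f -> measurable_fun D g ->
  measurable_fun D (fun x => tcost M (f x) (g x) : R').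
Proof.
move=> mf mg; apply: measurable_funX; apply: measurable_enorm; apply: measurable_vecB;
  exact: measurable_clampv.
Qed.

End vector_valued.

Let rnd (n : nat) (t : R) : R := (Num.floor (t * n.+1%:R))%:~R / n.+1%:R.

Let rnd_dist n t : `|t - rnd n t| <= n.+1%:R^-1.
Proof.
have n0 : 0 < n.+1%:R :> R by rewrite ltr0n.
have h1 := floor_le (t * n.+1%:R : R). have h2 := floorD1_gt (t * n.+1%:R : R).
rewrite intrD mulr1z in h2.
have -> : t - rnd n t = (t * n.+1%:R - (Num.floor (t * n.+1%:R))%:~R) / n.+1%:R.
  by rewrite /rnd mulrBl mulfK// gt_eqF.
rewrite normrM ger0_norm ?subr_ge0// ger0_norm ?invr_ge0 ?(ltW n0)//.
rewrite ler_piMl ?invr_ge0 ?(ltW n0)//; by rewrite lerBlDr addrC ltW.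
Qed.

Let rnd_measurable n : measurable_fun setT (rnd n : R' -> R').
Proof.
apply: nondecreasing_measurable => // s t st; rewrite /rnd ler_pM2r ?invr_gt0 ?ltr0n//.
by rewrite ler_int le_floor// ler_pM2r ?ltr0n.
Qed.

(** Composing f with the rounding of coordinates to the grid of mesh 1 / (n + 1) gives a function of
    a countable index, hence a measurable one. By the Lipschitz bound these functions converge to f
    at rate 3 * K / (n + 1). *)
Lemma lipv_measurable K (f : V -> R) : lipv K f -> measurable_fun (setT : set V) (f : V -> R').
Proof.
move=> fK; have K0 := lipv_ge0 fK.
pose r n (x : V) : V := (rnd n x.1.1, rnd n x.1.2, rnd n x.2).
have mr n : measurable_fun setT (r n).
  apply: measurable_vec => /=.
  - exact: measurableT_comp (rnd_measurable n) measurable_c1.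
  - exact: measurableT_comp (rnd_measurable n) measurable_c2.
  - exact: measurableT_comp (rnd_measurable n) measurable_c3.
have mfr n : measurable_fun (setT : set V) (fun x => f (r n x) : R').
  move=> _ Y mY; rewrite setTI.
  pose q (z : int * int * int) : V := (z.1.1%:~R / n.+1%:R, z.1.2%:~R / n.+1%:R, z.2%:~R / n.+1%:R).
  have -> : (fun x => f (r n x)) @^-1` Y =
      \bigcup_(z : int * int * int) (if `[< Y (f (q z)) >] then r n @^-1` [set q z] else set0).
    apply/seteqP; split => x /=.
      move=> Yx; pose fl t := Num.floor (t * n.+1%:R : R).
      exists (fl x.1.1, fl x.1.2, fl x.2) => //.
      by have -> : `[< Y (f (q (fl x.1.1, fl x.1.2, fl x.2))) >] by apply/asboolP.
    by move=> [z _]; case: asboolP => //= Yz ->.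
  apply: countable_bigcupT_measurable; first exact: countableP.
  move=> z; case: asboolP => // _.
  rewrite -[X in measurable X]setTI; apply: mr => //.
  have -> : [set q z] = ([set (q z).1.1] `*` [set (q z).1.2]) `*` [set (q z).2].
    apply/seteqP; split => [x ->//|[[x1 x2] x3] /= [[-> ->] ->]//].
  by apply: measurableX => //; apply: measurableX.
apply: (measurable_fun_cvg mfr) => x _.
apply/cvgrPdist_le => e e0.
have Ke : 0 < K + 1 by rewrite ltr_wpDl.
near=> n.
apply: (le_trans (fK _ _)).
have h : enorm (x - r n x) <= 3 * n.+1%:R^-1.
  apply: (le_trans (enorm_le_sum _)) => /=.
  have := rnd_dist n x.1.1; have := rnd_dist n x.1.2; have := rnd_dist n x.2.
  by move: (n.+1%:R^-1) => u; move: (rnd n _) (rnd n _) (rnd n _) => *; lra.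
apply: (@le_trans _ _ ((K + 1) * (3 * n.+1%:R^-1))).
  by rewrite ler_pM ?enorm_ge0 ?lerDl.
rewrite mulrA ler_pdivrMr ?ltr0n// -ler_pdivrMl// [e^-1 * _]mulrC.
have : (Num.truncn ((K + 1) * 3 / e) <= n)%N by near: n; exact: nbhs_infty_ge.
move=> hn; apply/ltW; apply: (lt_le_trans (truncnS_gt _)).
by rewrite ler_nat ltnS.
Unshelve. all: by end_near.
Qed.

End measurability.

Section probability_tools.
Context d (T : measurableType d) (R : realType).

Lemma bounded_integrable (P : probability T R) (f : T -> R) (B : R) :
  measurable_fun setT f -> (forall x, `|f x| <= B) -> P.-integrable setT (EFin \o f).
Proof.
move=> mf fB; apply: measurable_bounded_integrable => //.
  by rewrite (le_lt_trans (probability_le1 P _)) ?ltry.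
exists B; split; first by rewrite num_real.
by move=> M BM x _ /=; rewrite (le_trans (fB x))// ltW.
Qed.

Lemma prob_Rint_cst (P : probability T R) (c : R) : \int[P]_x c = c.
Proof.
rewrite Rintegral_cst// [X in _ * X](_ : _ = 1) ?mulr1//.
exact: (congr1 fine (probability_setT P)).
Qed.

Lemma prob_integral_cst (P : probability T R) (c : \bar R) : (\int[P]_x c = c)%E.
Proof.
by rewrite integral_cst// [X in (_ * X)%E](_ : _ = 1%E) ?mule1//; exact: (probability_setT P).
Qed.

(** P0 is the default value of [mnormalize], never reached when the mass is 1. *)
Lemma mass1_probability (m : {measure set T -> \bar R}) (P0 : probability T R) : m setT = 1%E ->
  exists P : probability T R, forall A, P A = m A.
Proof.
move=> m1; exists (mnormalize m P0) => A.
by rewrite /= /mnormalize m1 /= orbF ifF ?onee_neq0 ?invr1 ?mule1//; exact/negbTE/onee_neq0.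
Qed.

Lemma ge0_Rintegral_EFin (mu : {measure set T -> \bar R}) (f : T -> R) :
  mu.-integrable setT (EFin \o f) -> (\int[mu]_x f x)%:E = (\int[mu]_x (f x)%:E)%E.
Proof. by move=> iF; rewrite /Rintegral fineK//; exact: integrable_fin_num. Qed.

End probability_tools.

Section finite_duality_ge0.
Context {R : realType} {I J : finType}.
Variables (a : I -> R) (b : J -> R) (c : I -> J -> R) (e : R).
Hypotheses (e0 : 0 < e) (a0 : forall i, 0 <= a i) (b0 : forall j, 0 <= b j)
  (c0 : forall i j, 0 <= c i j) (a1 : \sum_i a i = 1) (b1 : \sum_j b j = 1).

(** Positivity of the weights gave the coercivity of the finite problem, so the problem is solved on
    the indices of positive weight. The potentials are extended by 0, which is why the constraint is
    asserted only there. *)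
Lemma finite_duality_ge0 : exists (u : I -> R) (v : J -> R) (p : I -> J -> R),
  [/\ forall i j, 0 <= p i j, forall i, \sum_j p i j = a i, forall j, \sum_i p i j = b j,
      forall i j, 0 < a i -> 0 < b j -> u i + v j <= c i j &
      \sum_i \sum_j c i j * p i j <= \sum_i u i * a i + \sum_j v j * b j + e].
Proof.
pose SI := {i : I | 0 < a i}; pose SJ := {j : J | 0 < b j}.
have nz (K : finType) (F : K -> R) (w : K -> R) : (forall k, 0 <= w k) -> (forall k, w k = 0 -> F k = 0) ->
    \sum_k F k = \sum_(k : {k : K | 0 < w k}) F (val k).
  move=> w0 Fw; transitivity (\sum_(k in [pred k | 0 < w k]) F k).
    rewrite [RHS]big_mkcond; apply: eq_bigr => k _; case: ifPn => //.
    by rewrite inE -leNgt => wk; apply: Fw; apply/eqP; rewrite eq_le wk w0.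
  exact: big_sub.
have a1' : \sum_(i : SI) a (val i) = 1 by rewrite -nz.
have b1' : \sum_(j : SJ) b (val j) = 1 by rewrite -nz.
have [u [v [p [p0 pa pb uv pc]]]] := @finite_duality R SI SJ (fun i => a (val i)) (fun j => b (val j))
  (fun i j => c (val i) (val j)) e e0 (fun i => valP i) (fun j => valP j) (fun i j => c0 _ _) a1' b1'.
pose eu i := if insub i is Some k then u k else 0.
pose ev j := if insub j is Some k then v k else 0.
pose ep i j := if insub i is Some k then (if insub j is Some l then p k l else 0) else 0.
have ins (K : finType) (w : K -> R) k : w k = 0 -> insub k = None :> option {k : K | 0 < w k}.
  by move=> wk; rewrite insubF// wk ltxx.
have epl i j : a i = 0 -> ep i j = 0 by move=> h; rewrite /ep (ins _ _ _ h).
have epr i j : b j = 0 -> ep i j = 0 by move=> h; rewrite /ep (ins _ _ _ h); case: insub.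
have epE (k : SI) (l : SJ) : ep (val k) (val l) = p k l by rewrite /ep !valK.
exists eu, ev, ep; split.
- by move=> i j; rewrite /ep; case: insub => // k; case: insub.
- move=> i; have [ai|ai] := eqVneq (a i) 0.
    by rewrite ai big1// => j _; exact: epl.
  have ip : 0 < a i by rewrite lt_def ai a0.
  rewrite (nz _ _ b)//; last by move=> j; exact: epr.
  by rewrite -(pa (exist _ i ip)); apply: eq_bigr => l _; rewrite -epE.
- move=> j; have [bj|bj] := eqVneq (b j) 0.
    by rewrite bj big1// => i _; exact: epr.
  have jp : 0 < b j by rewrite lt_def bj b0.
  rewrite (nz _ _ a)//; last by move=> i; exact: epl.
  by rewrite -(pb (exist _ j jp)); apply: eq_bigr => l _; rewrite -epE.
- move=> i j ai bj; have := uv (exist _ i ai) (exist _ j bj) => /=.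
  by rewrite /eu /ev (insubT (fun i => 0 < a i) ai) (insubT (fun j => 0 < b j) bj).
- rewrite (nz _ _ a)//; last by move=> i ai; rewrite big1// => j _; rewrite epl ?mulr0.
  rewrite (nz _ (fun i => eu i * a i) a)//; last by move=> i ->; rewrite mulr0.
  rewrite (nz _ (fun j => ev j * b j) b)//; last by move=> j ->; rewrite mulr0.
  have -> : \sum_(k : SI) eu (val k) * a (val k) = \sum_(k : SI) u k * a (val k).
    by apply: eq_bigr => k _; rewrite /eu valK.
  have -> : \sum_(k : SJ) ev (val k) * b (val k) = \sum_(k : SJ) v k * b (val k).
    by apply: eq_bigr => k _; rewrite /ev valK.
  apply: le_trans pc; rewrite le_eqVlt; apply/orP; left; apply/eqP; apply: eq_bigr => k _.
  rewrite (nz _ _ b)//; last by move=> j bj; rewrite epr ?mulr0.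
  by apply: eq_bigr => l _; rewrite epE.
Qed.

End finite_duality_ge0.

Section finite_valued.
Context d (T : measurableType d) (R : realType) (K : finType) (idx : T -> K).
Hypothesis midx : forall k, measurable (idx @^-1` [set k]).
Local Notation R' := (measurableTypeR R).

Let sumE (F : K -> R) x : F (idx x) = \sum_k F k * \1_(idx @^-1` [set k]) x.
Proof.
rewrite (bigD1 (idx x))//= indicE mem_set//= mulr1 big1 ?addr0// => k /eqP kx.
by rewrite indicE memNset ?mulr0//= => h; apply: kx.
Qed.

Lemma measurable_finite_valued (F : K -> R) : measurable_fun setT (fun x => F (idx x) : R').
Proof.
rewrite (_ : (fun x => _) = (fun x => \sum_k F k * \1_(idx @^-1` [set k]) x)); last first.
  by apply/funext => x; exact: sumE.
apply: measurable_sum => k; apply: measurable_funM => //.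
Qed.

Lemma ge0_integral_finite_valued (mu : {measure set T -> \bar R}) (F : K -> R) A : measurable A ->
  (forall k, 0 <= F k) ->
  (\int[mu]_(x in A) (F (idx x))%:E = \sum_k (F k)%:E * mu (A `&` idx @^-1` [set k]))%E.
Proof.
move=> mA F0.
under eq_integral do rewrite sumE -sumEFin.
rewrite ge0_integral_sum//; first last.
- by move=> k x _; rewrite lee_fin mulr_ge0.
- move=> k; apply/measurable_EFinP; apply: measurable_funTS; exact: measurable_funM.
apply: eq_bigr => k _; rewrite (@integralZl_indic _ _ _ mu A mA (fun=> idx @^-1` [set k]))//.
  by rewrite integral_indic// setIC.
by move=> Fk; have := F0 k; rewrite leNgt Fk.
Qed.

Lemma sum_cells (mu : {measure set T -> \bar R}) A : measurable A ->
  (\sum_k mu (A `&` idx @^-1` [set k]) = mu A)%E.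
Proof.
move=> mA; have := ge0_integral_finite_valued mu mA (F := fun=> 1) (fun=> ler01).
rewrite integral_cst// mul1e => ->; apply: eq_bigr => k _; by rewrite mul1e.
Qed.

Lemma Rintegral_finite_valued (P : probability T R) (F : K -> R) :
  \int[P]_x F (idx x) = \sum_k F k * fine (P (idx @^-1` [set k])).
Proof.
rewrite /Rintegral; under eq_integral do rewrite sumE -sumEFin.
have m1 k : measurable_fun setT (\1_(idx @^-1` [set k]) : T -> R) by exact: measurable_indic.
have iF k : P.-integrable setT (fun x => (F k * \1_(idx @^-1` [set k]) x)%:E).
  apply: (@bounded_integrable _ _ _ P _ `|F k|) => [|x].
    by apply: measurable_funM.
  by rewrite normrM ler_piMr//= indicE; case: (_ \in _); rewrite ?normr1 ?normr0.
rewrite integral_sum// -sum_fine/=; last by move=> k _; exact: integrable_fin_num.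
apply: eq_bigr => k _; under eq_integral do rewrite EFinM.
rewrite integralZl//; last first.
  apply: (@bounded_integrable _ _ _ P _ 1) => // x.
  by rewrite indicE; case: (_ \in _); rewrite ?normr1 ?normr0.
rewrite integral_indic// setIT fineM//; exact: fin_num_measure.
Qed.

End finite_valued.

Section inf_lemmas.
Context {R : realType} {T : Type}.

Lemma inf_dist (A : set T) (F G : T -> R) (D : R) : A !=set0 ->
  (forall t, A t -> `|F t - G t| <= D) -> has_lbound (F @` A) ->
  `|inf (F @` A) - inf (G @` A)| <= D.
Proof.
move=> [t0 At0] FG [m lF].
have lG : has_lbound (G @` A).
  exists (m - D) => _ [t At <-]; have := lF _ (ex_intro2 _ _ t At erefl).
  by have := FG t At; rewrite ler_norml => /andP[h1 h2]; move: (F t) (G t) h1 h2 => a b; lra.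
have aux (H1 H2 : T -> R) : (forall t, A t -> `|H1 t - H2 t| <= D) -> has_lbound (H1 @` A) ->
    inf (H1 @` A) - D <= inf (H2 @` A).
  move=> H12 l1; apply: lb_le_inf; first by exists (H2 t0), t0.
  move=> _ [t At <-]; have := ge_inf l1 (ex_intro2 _ _ t At erefl).
  have := H12 t At; rewrite ler_norml => /andP[h1 h2].
  by move: (inf _) (H1 t) (H2 t) h1 h2 => i a b; lra.
have h1 := aux F G FG (ex_intro _ m lF).
have h2 : inf (G @` A) - D <= inf (F @` A) by apply: aux => // t At; rewrite distrC; exact: FG.
by rewrite ler_norml; move: (inf _) (inf _) h1 h2 => i j; lra.
Qed.

End inf_lemmas.

(** * Discretization of the truncated cost *)

Section cells.
Context {R : realType}.
Local Notation V := (vec R).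
Local Notation R' := (measurableTypeR R).

Let clamp_ge (M t : R) : - M <= clamp M t.
Proof. by rewrite /clamp le_max lexx. Qed.

Let clamp_le (M t : R) : 0 <= M -> clamp M t <= M.
Proof. by move=> M0; rewrite /clamp ge_max ge_min lexx andbT ge0_cp. Qed.

Let clamp_mono (M : R) : {homo clamp M : s t / s <= t}.
Proof.
move=> s t st; rewrite /clamp ge_max le_max lexx/= le_max; apply/orP; right.
by rewrite le_min !ge_min lexx st orbT.
Qed.

(** Only the clamped value is discretized, by the integer part of (clamp M t + M) / eta; the cells
    cover the whole line and the unbounded ones cause no error. *)
Lemma clamp_cells (M eta : R) : 0 < M -> 0 < eta -> exists (n : nat) (idx : R -> 'I_n.+1),
  (forall k, measurable (idx @^-1` [set k] : set R')) /\
  forall s t, idx s = idx t -> `|clamp M s - clamp M t| <= eta.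
Proof.
move=> M0 e0; pose h t := (clamp M t + M) / eta.
have h0 t : 0 <= h t by rewrite divr_ge0 ?(ltW e0)// -lerBlDr sub0r clamp_ge.
pose n := Num.truncn (2 * M / eta).
have hn t : (Num.truncn (h t) <= n)%N.
  apply: le_truncn; rewrite ler_pM2r ?invr_gt0//.
  by have := clamp_le t (ltW M0); move: (clamp M t) => a; lra.
exists n, (fun t => inord (Num.truncn (h t))); split.
  move=> k; have mh : measurable_fun setT (fun t : R' => (Num.truncn (h t))%:R : R').
    apply: nondecreasing_measurable => // s t st; rewrite ler_nat; apply: le_truncn.
    by rewrite ler_pM2r ?invr_gt0// lerD2r clamp_mono.
  rewrite (_ : _ @^-1` _ = (fun t : R' => (Num.truncn (h t))%:R : R') @^-1` [set (k : nat)%:R]).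
    by rewrite -[X in measurable X]setTI; apply: mh.
  apply/seteqP; split => t /=; first by move=> <-; rewrite inordK// ltnS.
  by move=> /(congr1 Num.truncn); rewrite !natrK => ->; rewrite inord_val.
move=> s t /(congr1 val) /=; rewrite !inordK ?ltnS// => hst.
have := truncn_le (h s); have := truncn_le (h t); rewrite !h0 => le1 le2.
have := truncnS_gt (h s); have := truncnS_gt (h t); rewrite hst -natr1 => lt1 lt2.
have hd : `|h s - h t| <= 1.
  rewrite ler_norml; move: le1 le2 lt1 lt2; rewrite hst.
  by move: (h s) (h t) (Num.truncn _)%:R => a b c; lra.
have -> : clamp M s - clamp M t = (h s - h t) * eta.
  by rewrite /h; field; rewrite gt_eqF.
by rewrite normrM (gtr0_norm e0) ler_piMl ?(ltW e0).
Qed.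

Lemma clampv_cells (M eta : R) : 0 < M -> 0 < eta -> exists (K : finType) (idx : V -> K),
  (forall k, measurable (idx @^-1` [set k])) /\
  forall x y, idx x = idx y -> enorm (clampv M x - clampv M y) <= eta.
Proof.
move=> M0 e0; have e30 : 0 < eta / 3 by rewrite divr_gt0.
have [n [i [mi ci]]] := clamp_cells M0 e30.
exists ('I_n.+1 * 'I_n.+1 * 'I_n.+1)%type, (fun x => (i x.1.1, i x.1.2, i x.2)); split.
  move=> [[k1 k2] k3].
  rewrite (_ : _ @^-1` _ = ((i @^-1` [set k1]) `*` (i @^-1` [set k2])) `*` (i @^-1` [set k3])).
    by apply: measurableX => //; apply: measurableX.
  by apply/seteqP; split => x /=; [move=> [-> -> ->]|move=> [[-> ->] ->]].
move=> x y [h1 h2 h3]; apply: (le_trans (enorm_le_sum _)) => /=.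
have := ci _ _ h1; have := ci _ _ h2; have := ci _ _ h3.
move: (`|_|) (`|_|) (`|_|) => a b c; lra.
Qed.

Lemma clampvK (M : R) (x : V) : 0 <= M -> clampv M (clampv M x) = clampv M x.
Proof.
move=> M0; have aux t : clamp M (clamp M t) = clamp M t.
  by apply: clamp_id; rewrite ler_norml clamp_ge clamp_le.
by rewrite /clampv/= !aux.
Qed.

Lemma tcost_dist (M : R) (x x' y : V) : 0 <= M ->
  `|tcost M x y - tcost M x' y| <= 12 * M * enorm (clampv M x - clampv M x').
Proof.
move=> M0; have tc z : tcost M z y = tcost M (clampv M z) y by rewrite /tcost clampvK.
by rewrite (tc x) (tc x'); exact: tcost_lip.
Qed.

End cells.

Section duality.
Context {R : realType}.
Local Notation V := (vec R).
Local Notation R' := (measurableTypeR R).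
Variables (M : R) (f g : probability V R) (e : R).
Hypotheses (M0 : 0 < M) (e0 : 0 < e).

(* A coupling that is piecewise proportional to the product measure. *)
Lemma cell_coupling (K : finType) (idx : V -> K) (p : K -> K -> R) :
  (forall k, measurable (idx @^-1` [set k])) ->
  (forall k l, 0 <= p k l) ->
  (forall k, \sum_l p k l = fine (f (idx @^-1` [set k]))) ->
  (forall l, \sum_k p k l = fine (g (idx @^-1` [set l]))) ->
  exists P, coupling f g P /\
    forall k l, P ((idx @^-1` [set k]) `*` (idx @^-1` [set l])) = (p k l)%:E.
Proof.
move=> mi p0 pf pg.
pose a k := fine (f (idx @^-1` [set k])); pose b k := fine (g (idx @^-1` [set k])).
have aE k : f (idx @^-1` [set k]) = (a k)%:E by rewrite fineK// fin_num_measure.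
have bE k : g (idx @^-1` [set k]) = (b k)%:E by rewrite fineK// fin_num_measure.
pose idx2 (z : V * V) := (idx z.1, idx z.2).
have c2 kl : idx2 @^-1` [set kl] = (idx @^-1` [set kl.1]) `*` (idx @^-1` [set kl.2]).
  by apply/seteqP; split => z /=; [move=> <-|case: kl => k l [/= <- <-]].
have mi2 kl : measurable (idx2 @^-1` [set kl]) by rewrite c2; apply: measurableX.
(* The density with respect to the product measure. On a cell of mass zero the quotient is 0 by
   convention, the right value since p vanishes there as well. *)
pose Q (kl : K * K) := p kl.1 kl.2 / (a kl.1 * b kl.2).
have a0 k : 0 <= a k by exact: fine_ge0.
have b0 k : 0 <= b k by exact: fine_ge0.
have Q0 kl : 0 <= Q kl by rewrite divr_ge0// mulr_ge0.
have mQ : measurable_fun setT (fun z => (Q (idx2 z))%:E).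
  by apply/measurable_EFinP; exact: measurable_finite_valued.
have EQ0 z : (0%R <= (Q (idx2 z))%:E)%E by rewrite lee_fin.
pose m := mdensity (f \x g)%E mQ EQ0.
have pa k l : a k = 0 -> p k l = 0.
  move=> ak; apply/eqP; rewrite eq_le p0 andbT.
  rewrite -ak -[leRHS]pf (bigD1 l)//= lerDl; exact: sumr_ge0.
have pb k l : b l = 0 -> p k l = 0.
  move=> bl; apply/eqP; rewrite eq_le p0 andbT.
  rewrite -bl -[leRHS]pg (bigD1 k)//= lerDl; exact: sumr_ge0.
have QE k l : p k l = Q (k, l) * a k * b l.
  rewrite /Q/=; have [ak|ak] := eqVneq (a k) 0; first by rewrite ak !mulr0 mul0r pa.
  have [bl|bl] := eqVneq (b l) 0; first by rewrite bl mulr0 pb.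
  by field; rewrite ak bl.
have mrect A B : measurable A -> measurable B -> m (A `*` B) =
    (\sum_k \sum_l (Q (k, l))%:E * (f (A `&` idx @^-1` [set k]) * g (B `&` idx @^-1` [set l])))%E.
  move=> mA mB; rewrite /m /mdensity/= ge0_integral_finite_valued//; last exact: measurableX.
  rewrite [RHS]pair_big; apply: eq_bigr => -[k l] _ /=; congr (_ * _)%E.
  rewrite c2/= -setXI product_measure1E//; exact: measurableI.
have fin_nm (h : probability V R) A : measurable A -> h A = (fine (h A))%:E.
  by move=> mA; rewrite fineK// fin_num_measure.
have cvx (h : probability V R) A k : measurable A -> (h (A `&` idx @^-1` [set k]) <= h (idx @^-1` [set k]))%E.
  by move=> mA; apply: le_measure; rewrite ?inE//; apply: measurableI.
have m1 A : measurable A -> m (A `*` setT) = f A.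
  move=> mA; rewrite mrect// -(sum_cells mi f mA); apply: eq_bigr => k _.
  have mAk : measurable (A `&` idx @^-1` [set k]) by apply: measurableI.
  have [s sE] : exists s : R, f (A `&` idx @^-1` [set k]) = s%:E.
    by eexists; exact: fin_nm.
  transitivity (s%:E); last exact: esym.
  transitivity (\sum_l (Q (k, l) * (s * b l))%:E)%E.
    by apply: eq_bigr => l _; rewrite !EFinM setTI; congr (_ * (_ * _))%E; [exact: sE|exact: bE].
  rewrite sumEFin; congr (_%:E); have [ak|ak] := eqVneq (a k) 0.
    have -> : s = 0.
      have := cvx f A k mA; rewrite aE ak => h; apply/eqP; rewrite eq_le -!lee_fin -sE.
      by rewrite h measure_ge0.
    by rewrite big1// => l _; rewrite mul0r mulr0.
  apply: (mulIf ak); rewrite mulr_suml {2}/a -pf mulr_sumr; apply: eq_bigr => l _.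
  by rewrite QE; ring.
have m2 A : measurable A -> m (setT `*` A) = g A.
  move=> mA; rewrite mrect// -(sum_cells mi g mA) exchange_big/=; apply: eq_bigr => k _.
  have mAk : measurable (A `&` idx @^-1` [set k]) by apply: measurableI.
  have [s sE] : exists s : R, g (A `&` idx @^-1` [set k]) = s%:E.
    by eexists; exact: fin_nm.
  transitivity (s%:E); last exact: esym.
  transitivity (\sum_l (Q (l, k) * (a l * s))%:E)%E.
    by apply: eq_bigr => l _; rewrite !EFinM setTI; congr (_ * (_ * _))%E; [exact: aE|exact: sE].
  rewrite sumEFin; congr (_%:E); have [bk|bk] := eqVneq (b k) 0.
    have -> : s = 0.
      have := cvx g A k mA; rewrite bE bk => h; apply/eqP; rewrite eq_le -!lee_fin -sE.
      by rewrite h measure_ge0.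
    by rewrite big1// => l _; rewrite !mulr0.
  apply: (mulIf bk); rewrite mulr_suml {2}/b -pg mulr_sumr; apply: eq_bigr => l _.
  by rewrite QE; ring.
have mT : m setT = 1%E by rewrite -setXTT; exact: etrans (m1 _ measurableT) (probability_setT f).
have [P PE] := mass1_probability (f \x g)%E mT.
exists P; split; first by move=> A mA; split; [exact: etrans (PE _) (m1 _ mA)|exact: etrans (PE _) (m2 _ mA)].
move=> k l; rewrite (etrans (PE _) (mrect _ _ (mi k) (mi l))).
have dj (i j : K) : i != j -> (idx @^-1` [set j]) `&` (idx @^-1` [set i]) = set0.
  by move=> /eqP ij; rewrite -subset0 => x /= [-> ji]; apply: ij.
rewrite (bigD1 k)//= [X in (_ + X)%E]big1 ?adde0; last first.
  by move=> i ik; rewrite big1// => j _; rewrite dj// measure0 mul0e mule0.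
rewrite (bigD1 l)//= [X in (_ + X)%E]big1 ?adde0; last first.
  by move=> j jl; rewrite (dj j l)// measure0 !mule0.
by rewrite !setIid aE bE -!EFinM QE mulrA.
Qed.

(** The finite problem lives on representatives of small cells, and its potentials satisfy the
    constraint only at those of positive mass. They are replaced by cost transforms: phi is the
    transform of v over these cells, psi the transform of phi. The constraint then holds everywhere,
    both functions inherit the oscillation and Lipschitz bounds of [tcost], and on charged cells
    they lose at most dl compared with u and v. *)
Lemma approx_duality : exists (P : probability (V * V)%type R) (phi psi : V -> R),
  [/\ coupling f g P, lipv (12 * M) phi /\ lipv (12 * M) psi,
      exists B, forall x, `|phi x| <= B /\ `|psi x| <= B,
      forall x y, phi x + psi y <= tcost M x y &
      \int[P]_z tcost M z.1 z.2 <= \int[f]_x phi x + \int[g]_x psi x + e].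
Proof.
(* The budget of e = 8 * dl: 4 * dl for the finite problem, 2 * dl for replacing points by
   representatives in the cost, and dl for each potential. *)
have dl0 : 0 < e / 8 by rewrite divr_gt0.
set dl := e / 8 in dl0; have eta0 : 0 < dl / (12 * M) by rewrite divr_gt0// mulr_gt0.
have [K [idx [mi ci]]] := clampv_cells M0 eta0.
have ci' x x' y : idx x = idx x' -> `|tcost M x y - tcost M x' y| <= dl.
  move=> xx'; apply: (le_trans (tcost_dist _ _ _ (ltW M0))).
  by rewrite mulrC -ler_pdivlMr ?mulr_gt0//; exact: ci.
pose rho k := xget (0 : V) (idx @^-1` [set k]).
have rhoE x : idx (rho (idx x)) = idx x.
  by rewrite /rho; have := @xgetPex _ (0 : V) (idx @^-1` [set idx x]) => /(_ (ex_intro _ x erefl)).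
pose a k := fine (f (idx @^-1` [set k])); pose b k := fine (g (idx @^-1` [set k])).
have sum1 (h : probability V R) : \sum_k fine (h (idx @^-1` [set k])) = 1.
  have := Rintegral_finite_valued mi h (fun=> 1); rewrite prob_Rint_cst => ->.
  by apply: eq_bigr => k _; rewrite mul1r.
have c0 k l : 0 <= tcost M (rho k) (rho l) by exact: tcost_ge0.
have e20 : 0 < e / 2 by rewrite divr_gt0.
have [u [v [p [p0 pf pg uv pc]]]] := finite_duality_ge0 e20 (fun k => fine_ge0 (measure_ge0 f (idx @^-1` [set k])))
  (fun k => fine_ge0 (measure_ge0 g (idx @^-1` [set k]))) c0 (sum1 f) (sum1 g).
have [P [cP Pkl]] := cell_coupling mi p0 pf pg.
have [l0 bl0] : exists l, 0 < b l.
  apply: contrapT => H; have := sum1 g; rewrite big1 => [/eqP|k _]; first by rewrite eq_sym oner_eq0.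
  apply/eqP; rewrite eq_le fine_ge0 ?andbT//; rewrite leNgt; apply/negP => bk; apply: H; by exists k.
(* The infimum runs over the charged cells only, since the values of v elsewhere are arbitrary. *)
pose L := [set l | 0 < b l].
have L0 : L !=set0 by exists l0.
pose F x l := tcost M x (rho l) - v l.
pose phi x := inf (F x @` L).
have lF x : has_lbound (F x @` L).
  exists (- \sum_l `|v l|) => _ [l _ <-]; rewrite /F lerNl opprB.
  apply: (@le_trans _ _ (v l)); first by rewrite gerBl tcost_ge0.
  rewrite (bigD1 l)//= (le_trans (ler_norm (v l)))// lerDl; exact: sumr_ge0.
have dphi x x' D : (forall y, `|tcost M x y - tcost M x' y| <= D) -> `|phi x - phi x'| <= D.
  move=> xD; apply: inf_dist => // l _; rewrite /F (_ : _ - _ = tcost M x (rho l) - tcost M x' (rho l)); [exact: xD|by ring].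
pose B := `|phi 0| + 36 * M ^+ 2.
have Ble (h : V -> R) : (forall x x' D, (forall y, `|tcost M x y - tcost M x' y| <= D) -> `|h x - h x'| <= D) ->
    forall x, `|h x| <= `|h 0| + 36 * M ^+ 2.
  move=> dh x; have -> : h x = h 0 + (h x - h 0) by rewrite addrC subrK.
  rewrite (le_trans (ler_normD _ _))// lerD2l.
  apply: dh => y; rewrite ler_norml.
  have := tcost_bound x y (ltW M0); have := tcost_bound 0 y (ltW M0).
  have := tcost_ge0 M x y; have := tcost_ge0 M 0 y.
  by move: (tcost _ _ _) (tcost _ _ _) (36 * _) => i j k; lra.
have Bphi := Ble _ dphi.
pose G y x := tcost M x y - phi x.
pose psi y := inf (range (G y)).
have lG y : has_lbound (range (G y)).
  exists (- B) => _ [x _ <-]; rewrite /G; have := Bphi x; rewrite ler_norml => /andP[_ h].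
  by have := tcost_ge0 M x y; move: h; rewrite -/B; move: B (phi x) (tcost _ _ _) => i j k; lra.
have dpsi x x' D : (forall y, `|tcost M x y - tcost M x' y| <= D) -> `|psi x - psi x'| <= D.
  move=> xD; apply: inf_dist => //; first by exists 0.
  move=> t _; rewrite /G (_ : _ - _ = tcost M x t - tcost M x' t); first exact: xD.
  by rewrite (tcostC M t) (tcostC M t); ring.
have Bpsi := Ble _ dpsi.
have Lip h : (forall x x' D, (forall y, `|tcost M x y - tcost M x' y| <= D) -> `|h x - h x'| <= D) ->
    lipv (12 * M) h.
  by move=> dh x x'; apply: dh => y; apply: tcost_lip; exact: ltW.
have uphi x : 0 < a (idx x) -> u (idx x) - dl <= phi x.
  move=> ax; apply: lb_le_inf; first by case: L0 => l Ll; exists (F x l), l.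
  move=> _ [l Ll <-]; have := uv _ _ ax Ll; rewrite /F.
  have := ci' x (rho (idx x)) (rho l) (esym (rhoE x)); rewrite ler_norml => /andP[+ _].
  by move: (tcost _ _ _) (tcost _ _ _) (u _) (v _) => i j s t; lra.
have vpsi y : 0 < b (idx y) -> v (idx y) - dl <= psi y.
  move=> yb; apply: lb_le_inf; first by exists (G y 0), 0.
  move=> _ [x _ <-]; have := ge_inf (lF x) (ex_intro2 _ _ _ (yb : L (idx y)) erefl).
  rewrite -/(phi x) /G /F.
  have := ci' y (rho (idx y)) x (esym (rhoE y)); rewrite ler_norml (tcostC M y) (tcostC M (rho _)) => /andP[+ _].
  by move: (tcost _ _ _) (tcost _ _ _) (phi _) (v _) => i j s t; lra.
have lowint (h : probability V R) (w : K -> R) (F0 : V -> R) B0 :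
    measurable_fun setT (F0 : V -> R') -> (forall x, `|F0 x| <= B0) ->
    (forall x, 0 < fine (h (idx @^-1` [set idx x])) -> w (idx x) - dl <= F0 x) ->
    \sum_k w k * fine (h (idx @^-1` [set k])) - dl <= \int[h]_x F0 x.
  (* On null cells nothing relates F0 to w; the lower bound - B0 is used there and contributes
     nothing to the integral. *)
  move=> mF0 BF0 wF0; pose w' k := if 0 < fine (h (idx @^-1` [set k])) then w k - dl else - B0.
  have -> : \sum_k w k * fine (h (idx @^-1` [set k])) - dl = \sum_k w' k * fine (h (idx @^-1` [set k])).
    have -> : dl = \sum_k dl * fine (h (idx @^-1` [set k])) by rewrite -mulr_sumr sum1 mulr1.
    rewrite -sumrB; apply: eq_bigr => k _; rewrite /w' -mulrBl; case: ltP => // hk.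
    have -> : fine (h (idx @^-1` [set k])) = 0 by apply/eqP; rewrite eq_le hk fine_ge0.
    by rewrite !mulr0.
  rewrite -Rintegral_finite_valued//; apply: le_Rintegral => //.
  - apply: (@bounded_integrable _ _ _ h _ (\sum_k `|w' k|)) => [|x].
      exact: measurable_finite_valued.
    by rewrite (bigD1 (idx x))//= lerDl; exact: sumr_ge0.
  - exact: bounded_integrable BF0.
  - move=> x _; rewrite /w'; case: ltP => hx; first exact: wF0.
    by have := BF0 x; rewrite ler_norml => /andP[].
have mphi : measurable_fun setT (phi : V -> R') := lipv_measurable (Lip _ dphi).
have mpsi : measurable_fun setT (psi : V -> R') := lipv_measurable (Lip _ dpsi).
have hf := lowint f u phi _ mphi Bphi uphi.
have hg := lowint g v psi _ mpsi Bpsi vpsi.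
exists P, phi, psi; split => //.
- by split; exact: Lip.
- exists (Num.max (`|phi 0| + 36 * M ^+ 2) (`|psi 0| + 36 * M ^+ 2)) => x.
  by rewrite !le_max Bphi Bpsi orbT.
- move=> x y; rewrite addrC -lerBrDr; apply: ge_inf => //; by exists x.
pose idx2 (z : V * V) := (idx z.1, idx z.2).
have c2 kl : idx2 @^-1` [set kl] = (idx @^-1` [set kl.1]) `*` (idx @^-1` [set kl.2]).
  by apply/seteqP; split => z /=; [move=> <-|case: kl => k l [/= <- <-]].
have mi2 kl : measurable (idx2 @^-1` [set kl]) by rewrite c2; apply: measurableX.
pose c2E (kl : K * K) := tcost M (rho kl.1) (rho kl.2) + 2 * dl.
have hP : \int[P]_z tcost M z.1 z.2 <= \int[P]_z c2E (idx2 z).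
  apply: le_Rintegral => //.
  - apply: (@bounded_integrable _ _ _ P _ (36 * M ^+ 2)) => [|z].
      by apply: measurable_tcost; [exact: measurable_fst|exact: measurable_snd].
    by rewrite ger0_norm ?tcost_ge0// tcost_bound// ltW.
  - apply: (@bounded_integrable _ _ _ P _ (36 * M ^+ 2 + 2 * dl)) => [|z].
      exact: measurable_finite_valued.
    have d0 : 0 <= 2 * dl by rewrite mulr_ge0 ?(ltW dl0).
    by rewrite ger0_norm ?addr_ge0 ?tcost_ge0// lerD2r tcost_bound// ltW.
  - move=> [x y] _; rewrite /c2E/=.
    have := ci' x (rho (idx x)) y (esym (rhoE x)).
    have := ci' y (rho (idx y)) (rho (idx x)) (esym (rhoE y)).
    rewrite !ler_norml (tcostC M y) (tcostC M (rho (idx y))) => /andP[_ h1] /andP[_ h2].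
    by move: (tcost _ _ _) (tcost _ _ _) (tcost _ _ _) h1 h2 => i j k; lra.
rewrite Rintegral_finite_valued// in hP.
have sE : \sum_kl c2E kl * fine (P (idx2 @^-1` [set kl])) =
    \sum_k \sum_l tcost M (rho k) (rho l) * p k l + 2 * dl.
  have -> : 2 * dl = \sum_k \sum_l 2 * dl * p k l.
    rewrite -[LHS]mulr1 -(sum1 f) mulr_sumr; apply: eq_bigr => k _; by rewrite -pf mulr_sumr.
  rewrite -big_split/=.
  under [RHS]eq_bigr do rewrite -big_split/=.
  rewrite [RHS]pair_big/=; apply: eq_bigr => -[k l] _; by rewrite c2/= Pkl/= -mulrDl.
rewrite sE in hP; move: hP pc hf hg.
have -> : e = 8 * dl by rewrite /dl; field.
by move: (\int[P]_z _) (\sum_k (\sum_l _)) (\sum_k u k * _) (\sum_k v k * _) (\int[f]_x _) (\int[g]_x _) => *; lra.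
Qed.

End duality.

(** * Singular potentials of L^p densities *)

Section Lp_density.
Context {R : realType}.
Local Notation V := (vec R).
Local Notation R' := (measurableTypeR R).
Variables (gamma p : R).
Hypotheses (hgamma : -1 < gamma < 0) (hp : 3 / (3 + gamma) < p).

(** The exponent with which an L^p density charges small balls: 3 divided by the exponent conjugate
    to p. The condition p > 3 / (3 + gamma) is exactly gamma + th > 0. *)
Let th := 3 * (1 - p^-1).

Let p1 : 1 < p.
Proof.
apply: le_lt_trans hp; move: hgamma => /andP[h1 h2].
by rewrite ler_pdivlMr; lra.
Qed.

Let p_gt0 : 0 < p.
Proof. exact: lt_trans p1. Qed.

Let th_gt : 0 < gamma + th.
Proof.
have g3 : 0 < 3 + gamma by move: hgamma => /andP[h1 h2]; lra.
have : 3 < p * (3 + gamma) by rewrite -ltr_pdivrMr.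
move=> h; have -> : gamma + th = (p * (3 + gamma) - 3) / p.
  by rewrite /th; field; rewrite gt_eqF.
by rewrite divr_gt0// subr_gt0.
Qed.

Lemma powR_expn (a s : R) n : 0 <= a -> (a ^+ n) `^ s = (a `^ s) ^+ n.
Proof.
move=> a0; rewrite -(powR_mulrn n a0) -(powR_mulrn n (powR_ge0 a s)).
by rewrite powRAC.
Qed.

Lemma powR_anti (a b s : R) : s <= 0 -> 0 < a -> a <= b -> b `^ s <= a `^ s.
Proof.
move=> s0 a0 ab; have b0 := lt_le_trans a0 ab.
have [r sE] : exists r, s = - r by exists (- s); rewrite opprK.
rewrite sE in s0 *; rewrite !powRN lef_pV2 ?posrE ?powR_gt0//.
have r0 : 0 <= r by rewrite -oppr_le0.
by apply: (@ge0_ler_powR _ r r0 a b _ _ ab); rewrite nnegrE ltW.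
Qed.

(** Hoelder's inequality against the indicator of the cube of side 2 * r containing the ball, whose
    volume is a product of lengths. The infimum in [Lp_norm] is handled by arguing with an arbitrary
    density. *)
Lemma density_ball_le (f : probability V R) (v : V) (r : R) : 0 < r ->
  (f [set w | (enorm (v - w) <= r)%R] <= Lp_norm p f * ((2 * r) `^ th)%:E)%E.
Proof.
move=> r0; set B := [set w | _].
have mB : measurable B.
  rewrite (_ : B = (fun w => enorm (v - w) : R') @^-1` [set x | x <= r]); last by [].
  rewrite -[X in measurable X]setTI; apply: measurable_enorm => //.
    by apply: measurable_vecB.
  by rewrite -set_itvNyc.
have c0 : 0 < (2 * r) `^ th by rewrite powR_gt0// mulr_gt0.
rewrite -lee_pdivrMr//; apply: le_ereal_inf_tmp => _ [h [mh h0 hE] <-].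
rewrite lee_pdivrMr//.
pose Q : set V := ([set` `[v.1.1 - r, v.1.1 + r]] `*` [set` `[v.1.2 - r, v.1.2 + r]]) `*` [set` `[v.2 - r, v.2 + r]].
have mI (a b : R) : measurable ([set` `[a, b]] : set R') by exact: measurable_itv.
have mQ : measurable Q by apply: measurableX => //; exact: measurableX.
have lI (a : R) : @lebesgue_measure R ([set` `[a - r, a + r]] : set R') = (2 * r)%:E.
  rewrite lebesgue_measure_itv/= lte_fin ifT; last by lra.
  by rewrite -EFinB; congr (_%:E); ring.
have lQ : leb3 R Q = ((2 * r) ^+ 3)%:E.
  have mI2 : measurable ([set` `[v.1.1 - r, v.1.1 + r]] `*` [set` `[v.1.2 - r, v.1.2 + r]] : set (R' * R')).
    exact: measurableX.
  have e1 := @product_measure1E _ _ _ _ R (@lebesgue_measure R \x @lebesgue_measure R)%E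
    (@lebesgue_measure R) _ _ mI2 (mI (v.2 - r) (v.2 + r)).
  have e2 := @product_measure1E _ _ _ _ R (@lebesgue_measure R)
    (@lebesgue_measure R) _ _ (mI (v.1.1 - r) (v.1.1 + r)) (mI (v.1.2 - r) (v.1.2 + r)).
  apply: (etrans e1); apply: (etrans (congr2 mule (etrans e2 (congr2 mule (lI _) (lI _))) (lI _))).
  rewrite -!EFinM.
  by congr (_%:E); ring.
have BQ : B `<=` Q.
  move=> w /= wr; have [h1 h2 h3] := norm_coord (v - w).
  have aux (a b : R) : `|a - b| <= r -> a - r <= b <= a + r.
    by rewrite ler_norml => /andP[]; lra.
  by split; first split; rewrite /= in_itv/=; apply: aux;
    [apply: le_trans h1 wr|apply: le_trans h2 wr|apply: le_trans h3 wr].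
apply: (@le_trans _ _ (f Q)); first by apply: le_measure; rewrite ?inE.
rewrite hE//.
have q0 : 0 < (1 - p^-1)^-1 by rewrite invr_gt0 subr_gt0 invf_lt1.
have mind : measurable_fun setT (\1_Q : V -> R) by exact: measurable_indic.
have pq : p^-1 + (1 - p^-1)^-1^-1 = 1 by rewrite invrK addrC subrK.
have H := hoelder (leb3 R) mh mind p_gt0 q0 pq.
rewrite Lnorm1 in H.
have -> : (\int[leb3 R]_(w in Q) (h w)%:E = \int[leb3 R]_w `|(EFin \o (h \* \1_Q)%R) w|)%E.
  rewrite integral_mkcond; apply: eq_integral => w _.
  rewrite patchE/= indicE; case: (w \in Q); rewrite ?mulr1 ?mulr0 ?normr0//.
  by rewrite ger0_norm.
apply: (le_trans H); apply: lee_pmul => //; rewrite ?Lnorm_ge0//.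
rewrite unlock.
have -> : (\int[leb3 R]_w `|(EFin \o \1_Q) w| `^ (1 - p^-1)^-1 = leb3 R Q)%E.
  rewrite -[in RHS](setIT Q) -integral_indic//; apply: eq_integral => w _ /=.
  rewrite indicE; case: (w \in Q); rewrite ?normr1 ?normr0 ?powR1 ?powR0//.
  by rewrite gt_eqF.
rewrite lQ invrK poweR_EFin lee_fin.
by rewrite -powR_mulrn ?mulr_ge0 ?(ltW r0)// -powRrM.
Qed.

(** Balls shrinking to v have vanishing mass. This discards the pairs with v = v', where the
    collisions cannot be matched. *)
Lemma density_no_atom (f : probability V R) (v : V) : (Lp_norm p f < +oo)%E -> f [set v] = 0%E.
Proof.
move=> fp; have N0 : (0 <= Lp_norm p f)%E.
  by apply: le_ereal_inf_tmp => _ [h _ <-]; exact: Lnorm_ge0.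
have [N NE] : exists N : R, Lp_norm p f = N%:E.
  by exists (fine (Lp_norm p f)); rewrite fineK// ge0_fin_numE.
have {}N0 : 0 <= N by rewrite -lee_fin -NE.
have th0 : 0 < th by move: hgamma => /andP[h1 h2]; move: th_gt; lra.
apply/eqP; rewrite eq_le measure_ge0 andbT.
apply/lee_addgt0Pr => e e0; rewrite add0e.
(* Chosen so that (2 * r)^th = e / (N + 1). *)
pose r := 2^-1 * ((e / (N + 1)) `^ th^-1).
have N10 : 0 < N + 1 by rewrite ltr_wpDl.
have r0 : 0 < r by rewrite mulr_gt0// powR_gt0// divr_gt0.
have ms : measurable [set v].
  have -> : [set v] = ([set v.1.1] `*` [set v.1.2]) `*` [set v.2].
    by case: v => [[a b] c]; apply/seteqP; split => [x ->//|[[x1 x2] x3] /= [[-> ->] ->]//].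
  by apply: measurableX => //; apply: measurableX.
have mB : measurable [set w | enorm (v - w) <= r].
  rewrite (_ : [set _ | _] = (fun w => enorm (v - w) : R') @^-1` [set x | x <= r]); last by [].
  rewrite -[X in measurable X]setTI; apply: measurable_enorm => //.
    by apply: measurable_vecB.
  by rewrite -set_itvNyc.
apply: (@le_trans _ _ (f [set w | (enorm (v - w) <= r)%R])).
  apply: le_measure; rewrite ?inE// => _ /= ->.
  by rewrite subrr enorm0 (ltW r0).
apply: (le_trans (density_ball_le f v r0)).
rewrite NE -EFinM lee_fin /r mulrA mulfV// mul1r -powRrM mulVf ?gt_eqF// powRr1 ?divr_ge0 ?(ltW e0) ?(ltW N10)//.
by rewrite mulrCA ler_piMr ?(ltW e0)// ler_pdivrMr// mul1r lerDl.
Qed.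

(** The kernel is at most 1 at distance at least 1. Closer than that it is dominated by the sum of c
    n over the dyadic balls containing w, c n being its value at radius 2^(-n-1). By
    [density_ball_le] the n-th term integrates to at most A * q^n times the norm, with q =
    2^(-(gamma + th)) < 1. The constant depends on gamma and p only. *)
Lemma density_kernel_bound : exists C : R, 0 < C /\ forall (f : probability V R) (v : V),
  (\int[f]_w (enorm (v - w) `^ gamma)%:E <= C%:E * (1 + Lp_norm p f))%E.
Proof.
have [g1 g0] := andP hgamma.
pose c (n : nat) : R := (2^-1 ^+ n.+1) `^ gamma.
have c0 n : 0 <= c n by exact: powR_ge0.
pose q : R := 2^-1 `^ (gamma + th).
have h2 : 0 < (2^-1 : R) by rewrite invr_gt0.
have q1 : q < 1.
  rewrite /q [ltRHS](_ : _ = 1 `^ (gamma + th)); last by rewrite powR1.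
  apply: (@gt0_ltr_powR _ _ th_gt 2^-1 1); rewrite ?nnegrE ?invr_ge0 ?ler0n//.
  by rewrite invf_lt1 ?ltr1n.
have q0 : 0 <= q by exact: powR_ge0.
pose A : R := 2^-1 `^ gamma * 2 `^ th.
have A0 : 0 <= A by rewrite mulr_ge0 ?powR_ge0.
exists (1 + A / (1 - q)); split.
  by rewrite ltr_pwDl// divr_ge0// subr_ge0 ltW.
move=> f v.
have N0 : (0 <= Lp_norm p f)%E.
  by apply: le_ereal_inf_tmp => _ [h _ <-]; exact: Lnorm_ge0.
pose B n : set V := [set w | enorm (v - w) <= 2^-1 ^+ n].
have mB n : measurable (B n).
  rewrite (_ : B n = (fun w => enorm (v - w) : R') @^-1` [set x | x <= 2^-1 ^+ n]); last by [].
  rewrite -[X in measurable X]setTI; apply: measurable_enorm => //.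
    by apply: measurable_vecB.
  by rewrite -set_itvNyc.
have ptw w : ((enorm (v - w) `^ gamma)%:E <= 1 + \sum_(n <oo) (c n * \1_(B n) w)%:E)%E.
  have s0 : (0 <= \sum_(n <oo) (c n * \1_(B n) w)%:E)%E.
    by apply: nneseries_ge0 => n _ _; rewrite lee_fin mulr_ge0.
  have [e1|e1] := leP 1 (enorm (v - w)).
    apply: (@le_trans _ _ 1%E); last by rewrite leeDl.
    rewrite lee_fin [leRHS](_ : _ = 1 `^ gamma); last by rewrite powR1.
    by apply: powR_anti => //; exact: ltW.
  have [e00|e00] := eqVneq (enorm (v - w)) 0.
    by rewrite e00 powR0 ?lt_eqF// adde_ge0.
  have e_gt0 : 0 < enorm (v - w) by rewrite lt_def e00 enorm_ge0.
  have ex : exists n, 2^-1 ^+ n.+1 < enorm (v - w).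
    have /cvgrPdist_lt /(_ _ e_gt0) [n _ Hn] : (2^-1 ^+ n : R) @[n --> \oo] --> 0.
      by apply: cvg_expr; rewrite ger0_norm ?invr_ge0 ?ler0n// invf_lt1 ?ltr1n.
    exists n; have := Hn n.+1 (leqnSn n).
    by rewrite /= sub0r normrN ger0_norm// exprn_ge0// ltW.
  case: (ex_minnP ex) => n hn nmin.
  have wB : B n w.
    rewrite /B/=; case: n hn nmin => [_ _|n _ nmin]; first by rewrite expr0 ltW.
    rewrite leNgt; apply/negP => h; by have := nmin _ h; rewrite ltnn.
  apply: (@le_trans _ _ (c n)%:E).
    by rewrite lee_fin; apply: powR_anti; rewrite ?exprn_gt0// ltW.
  apply: (@le_trans _ _ (\sum_(n <oo) (c n * \1_(B n) w)%:E)%E); last by rewrite leeDr.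
  apply: (@le_trans _ _ (\sum_(0 <= k < n.+1) (c k * \1_(B k) w)%:E)%E).
    rewrite big_nat_recr//= indicE mem_set// mulr1 leeDr//.
    by apply: sume_ge0 => k _; rewrite lee_fin mulr_ge0.
  by apply: nneseries_lim_ge => k _ _; rewrite lee_fin mulr_ge0.
have mi n : measurable_fun setT (fun w => (c n * \1_(B n) w)%:E).
  apply/measurable_EFinP; apply: measurable_funM => //.
have ms : measurable_fun setT (fun w => \sum_(n <oo) (c n * \1_(B n) w)%:E)%E.
  by apply: ge0_emeasurable_sum => // n w _ _; rewrite lee_fin mulr_ge0.
have s0 w : (0 <= \sum_(n <oo) (c n * \1_(B n) w)%:E)%E.
  by apply: nneseries_ge0 => n _ _; rewrite lee_fin mulr_ge0.
apply: (@le_trans _ _ (\int[f]_w (1 + \sum_(n <oo) (c n * \1_(B n) w)%:E))%E).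
  apply: ge0_le_integral => //.
  - by move=> w _; rewrite lee_fin powR_ge0.
  - apply/measurable_EFinP; apply: (@measurableT_comp _ _ _ _ _ _ (fun x : R' => (x : R) `^ gamma : R')).
      exact: measurable_powR.
    apply: measurable_enorm => //; exact: measurable_vecB.
  - exact: emeasurable_funD.
rewrite ge0_integralD// prob_integral_cst.
rewrite integral_nneseries//; last by move=> n w _; rewrite lee_fin mulr_ge0.
have iE n : (\int[f]_w (c n * \1_(B n) w)%:E = (c n)%:E * f (B n))%E.
  rewrite (@integralZl_indic _ _ _ f setT measurableT (fun=> B n))//.
    by rewrite integral_indic// setIT.
  by move=> cn; have := c0 n; rewrite leNgt cn.
under eq_eseriesr do rewrite iE.
have [->|] := eqVneq (Lp_norm p f) +oo%E.
  by rewrite addey// gt0_muley ?leey// lte_fin ltr_pwDl// divr_ge0// subr_ge0 ltW.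
rewrite -ltey => fp.
have [N NE] : exists N : R, Lp_norm p f = N%:E.
  by exists (fine (Lp_norm p f)); rewrite fineK// ge0_fin_numE.
have {}N0 : 0 <= N by rewrite -lee_fin -NE.
have tE n : ((c n)%:E * f (B n) <= (N * (A * q ^+ n))%:E)%E.
  have r0 : 0 < 2^-1 ^+ n :> R by rewrite exprn_gt0.
  apply: (@le_trans _ _ ((c n)%:E * (Lp_norm p f * ((2 * 2^-1 ^+ n) `^ th)%:E))%E).
    by apply: lee_wpmul2l; [rewrite lee_fin|exact: density_ball_le].
  rewrite NE -!EFinM lee_fin le_eqVlt; apply/orP; left; apply/eqP.
  rewrite /c /A /q powRM ?(ltW r0)// !powR_expn ?(ltW h2)// exprS powRD; last by rewrite gt_eqF// implybT.
  by rewrite exprMn; ring.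
have -> : (1 + A / (1 - q))%:E = (1 + (A / (1 - q))%:E)%E by [].
apply: (@le_trans _ _ (1 + (N * (A / (1 - q)))%:E)%E).
  rewrite leeD2l//; apply: lime_le.
    by apply: is_cvg_nneseries => n _ _; rewrite mule_ge0 ?lee_fin.
  near=> n; apply: (@le_trans _ _ (\sum_(0 <= k < n) (N * (A * q ^+ k))%:E)%E).
    by apply: lee_sum => k _; exact: tE.
  rewrite sumEFin lee_fin -mulr_sumr ler_wpM2l// -mulr_sumr ler_wpM2l//.
  rewrite -[leRHS]mul1r ler_pdivlMr ?subr_gt0//.
  have := subrX1 q n; rewrite big_mkord => h.
  have : 0 <= q ^+ n by exact: exprn_ge0.
  by move: h; move: (q ^+ n) (\sum_(i < n) _) => a b k1 k2; nra.
rewrite NE -!EFinD -EFinM lee_fin.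
have : 0 <= A / (1 - q) by rewrite divr_ge0// subr_ge0 ltW.
by move: (A / _) => u u0; nra.
Unshelve. all: by end_near.
Qed.
End Lp_density.

(** * Measurability of the collision term *)

Section parametric_measurability.
Context d d' (X : measurableType d) (Y : measurableType d') (R : realType).
Local Notation R' := (measurableTypeR R).

Let signed_measurable (J : (X * Y -> \bar R) -> X -> \bar R) (F : X * Y -> R) :
  (forall H, measurable_fun setT H -> (forall z, 0 <= H z)%E -> measurable_fun setT (J H)) ->
  measurable_fun setT (F : _ -> R') ->
  measurable_fun setT (fun x => fine (J (EFin \o F)^\+%E x - J (EFin \o F)^\-%E x)%E : R').
Proof.
move=> mJ /measurable_EFinP mF.
apply: (measurableT_comp (fine_measurable measurableT)).
apply: emeasurable_funB; apply: mJ => //.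
- exact: measurable_funepos.
- exact: measurable_funeneg.
Qed.

Lemma measurable_Rintegral_param (m : {sigma_finite_measure set Y -> \bar R}) (D : set Y)
  (F : X * Y -> R) : measurable D -> measurable_fun setT (F : _ -> R') ->
  measurable_fun setT (fun x => \int[m]_(y in D) F (x, y) : R').
Proof.
move=> mD mF; pose F' z := F z * \1_D z.2.
have mF' : measurable_fun setT (F' : _ -> R').
  apply: measurable_funM => //; apply: measurableT_comp measurable_snd; exact: measurable_indic.
have := @signed_measurable (fun H x => \int[m]_y H (x, y))%E F' _ mF'.
rewrite (_ : (fun x => fine _) = (fun x => \int[m]_(y in D) F (x, y))).
  by apply => H mH H0; exact: (measurable_fun_fubini_tonelli_F H).
apply/funext => x; rewrite /Rintegral [in RHS]integral_mkcond [in RHS]integralE.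
by congr (fine (_ - _)%E); apply: eq_integral => y _; rewrite ?funeposE ?funenegE patchE /F'/= indicE;
  case: (y \in D); rewrite ?mulr1 ?mulr0.
Qed.

Section probability_family.
Variables (f : X -> probability Y R).

(** A copy of the family that carries the proof of its measurability, so that a kernel structure can
    be attached to it. *)
Definition probability_family (mf : forall A : set Y, measurable A -> measurable_fun setT (fun x => f x A)) :
  X -> {measure set Y -> \bar R} := fun x => f x.

Hypothesis mf : forall A : set Y, measurable A -> measurable_fun setT (fun x => f x A).

Let mk U : measurable U -> measurable_fun setT ((probability_family mf) ^~ U).
Proof. exact: mf. Qed.

HB.instance Definition _ := isKernel.Build _ _ X Y R (probability_family mf) mk.

Let pk x : probability_family mf x setT = 1%E.
Proof. exact: (probability_setT (f x)). Qed.

HB.instance Definition _ := Kernel_isProbability.Build _ _ X Y R (probability_family mf) pk.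

Lemma measurable_integral_family (F : X * Y -> \bar R) : measurable_fun setT F ->
  (forall z, 0 <= F z)%E -> measurable_fun setT (fun x => \int[f x]_y F (x, y))%E.
Proof.
move=> mF F0; exact: (measurable_fun_integral_finite_kernel F (probability_family mf) F0 mF).
Qed.

Lemma measurable_Rintegral_family (F : X * Y -> R) : measurable_fun setT (F : _ -> R') ->
  measurable_fun setT (fun x => \int[f x]_y F (x, y) : R').
Proof.
move=> mF.
have := @signed_measurable (fun H x => \int[f x]_y H (x, y))%E F _ mF.
rewrite (_ : (fun x => fine _) = (fun x => \int[f x]_y F (x, y))).
  by apply => H mH H0; exact: measurable_integral_family.
apply/funext => x; rewrite /Rintegral [in RHS]integralE.
by congr (fine (_ - _)%E); apply: eq_integral => y _; rewrite ?funeposE ?funenegE.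
Qed.

End probability_family.
End parametric_measurability.

Section collision_measurability.
Context {R : realType}.
Local Notation V := (vec R).
Local Notation R' := (measurableTypeR R).
Variables (gamma nu : R) (beta : R -> R) (I : V -> V).
Hypotheses (mb : measurable_fun `]0, pi] (beta : R' -> R')) (hI : orthogonal_selection I).

Lemma measurable_Gamma_vec : measurable_fun setT (fun z : V * R' => Gamma_vec I z.1 z.2).
Proof.
pose I0 (x : V) : V := if x == 0 then 0 else I x.
have ms : measurable [set x : V | x != 0].
  rewrite (_ : [set _ | _] = ~` ([set 0 : R'] `*` [set 0 : R'] `*` [set 0 : R'])).
    by apply: measurableC; apply: measurableX => //; apply: measurableX.
  apply/seteqP; split => x /=; first by move=> /eqP x0 [[h1 h2] h3]; apply: x0; apply: vec_ext.
  by move=> h; apply/eqP => x0; apply: h; rewrite x0.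
have mI0 : measurable_fun setT I0.
  rewrite (_ : I0 = fun x => if x != 0 then I x else 0); last first.
    by apply/funext => x; rewrite /I0; case: eqP.
  apply: measurable_fun_if => //.
  - apply: (measurable_fun_bool true); rewrite setTI.
    by rewrite (_ : _ @^-1` _ = [set x : V | x != 0]).
  - rewrite setTI (_ : _ @^-1` _ = [set x : V | x != 0])//; exact: hI.1.
have GE z : Gamma_vec I z.1 z.2 = cos z.2 *: I0 z.1 + sin z.2 *: crossv ((enorm z.1)^-1 *: z.1) (I0 z.1).
  rewrite /Gamma_vec /I0 /J_vec; case: eqP => // z0.
  have -> : crossv ((enorm z.1)^-1 *: z.1) 0 = 0 :> V.
    by rewrite /crossv/= !mulr0 subrr.
  by rewrite !scaler0 addr0.
rewrite (_ : (fun z => _) = (fun z : V * R' => cos z.2 *: I0 z.1 + sin z.2 *: crossv ((enorm z.1)^-1 *: z.1) (I0 z.1))); last first.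
  by apply/funext => z; exact: GE.
have mt (t : R -> R) : continuous t -> measurable_fun setT (fun z : V * R' => t z.2 : R').
  move=> ct; apply: (@measurableT_comp _ _ _ _ _ _ (t : R' -> R')) measurable_snd.
  exact: continuous_measurable_fun.
have mI1 : measurable_fun setT (fun z : V * R' => I0 z.1) by exact: measurableT_comp mI0 measurable_fst.
have mn : measurable_fun setT (fun z : V * R' => (enorm z.1)^-1 : R').
  rewrite (_ : (fun _ => _) = (fun z : V * R' => enorm z.1 `^ (-1))); last first.
    by apply/funext => z; rewrite powR_inv1 ?enorm_ge0.
  apply: (@measurableT_comp _ _ _ _ _ _ (fun x : R' => (x : R) `^ (-1) : R')).
    exact: measurable_powR.
  exact: (measurable_enorm measurable_fst).
have mx : measurable_fun setT (fun z : V * R' => (enorm z.1)^-1 *: z.1 : V).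
  by apply: measurable_vecZ => //; exact: measurable_fst.
apply: measurable_vecD; apply: measurable_vecZ => //.
- by apply: mt; exact: continuous_cos.
- by apply: mt; exact: continuous_sin.
have [a1 a2 a3] := measurable_vcoord mx; have [b1 b2 b3] := measurable_vcoord mI1.
by apply: measurable_vec; apply: measurable_funB; apply: measurable_funM.
Qed.

Lemma measurable_collision_op K (f : V -> R) : lipv K f ->
  measurable_fun setT (fun z : V * V => collision_op gamma beta I f z.1 z.2 : R').
Proof.
move=> fK.
have mf := lipv_measurable fK.
have mvw : measurable_fun setT (fun z : V * V => z.1 - z.2).
  by apply: measurable_vecB; [exact: measurable_fst|exact: measurable_snd].
apply: measurable_funM.
  apply: (@measurableT_comp _ _ _ _ _ _ (fun x : R' => (x : R) `^ gamma : R')).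
    exact: measurable_powR.
  exact: (measurable_enorm mvw).
have mD : measurable ([set` `]0, pi / 2]] : set R') by exact: measurable_itv.
pose b0 (t : R) := if t \in `]0, pi / 2] then beta t else 0.
have mb0 : measurable_fun setT (b0 : R' -> R').
  have -> : b0 = patch (fun=> 0) [set` `]0, pi / 2]] beta.
    by apply/funext => t; rewrite patchE /b0 mem_setE.
  apply/(measurable_restrictT _ mD); apply: measurable_funS mb => //.
  move=> t /=; rewrite !in_itv/= => /andP[-> h]/=; apply: (le_trans h).
  by rewrite ler_pdivrMr// ler_peMr ?pi_ge0// ler1n.
have mdev : measurable_fun setT (fun z : (V * V * R') * R' =>
    f (z.1.1.1 + deviation I z.1.1.1 z.1.1.2 z.1.2 z.2) - f z.1.1.1 : R').
  have q1 : measurable_fun setT (fun z : V * V * R' * R' => z.1) by exact: measurable_fst.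
  have q11 : measurable_fun setT (fun z : V * V * R' * R' => z.1.1) by exact: measurableT_comp measurable_fst q1.
  have q12 : measurable_fun setT (fun z : V * V * R' * R' => z.1.2) by exact: measurableT_comp measurable_snd q1.
  have m1 : measurable_fun setT (fun z : V * V * R' * R' => z.1.1.1) by exact: measurableT_comp measurable_fst q11.
  have m2 : measurable_fun setT (fun z : V * V * R' * R' => z.1.1.1 - z.1.1.2) by exact: measurableT_comp mvw q11.
  have mth (t : R -> R) : continuous t -> measurable_fun setT (fun z : V * V * R' * R' => t z.1.2 : R').
    move=> ct; apply: (@measurableT_comp _ _ _ _ _ _ (t : R' -> R')) q12.
    exact: continuous_measurable_fun.
  apply: measurable_funB; last exact: (measurableT_comp mf m1).
  apply: (measurableT_comp mf); apply: measurable_vecD => //; apply: measurable_vecD; apply: measurable_vecZ => //.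
  - apply: measurable_funN; apply: measurable_funM => //; apply: measurable_funB => //.
    by apply: mth; exact: continuous_cos.
  - by apply: measurable_funM => //; apply: mth; exact: continuous_sin.
  - have mp : measurable_fun setT (fun z : V * V * R' * R' => (z.1.1.1 - z.1.1.2, z.2)).
      by apply: measurable_fun_pair => //; exact: measurable_snd.
    exact: (measurableT_comp measurable_Gamma_vec mp).
have mphi := measurable_Rintegral_param (@lebesgue_measure R) (measurable_itv `[0, 2 * pi]) mdev.
have mth : measurable_fun setT (fun z : (V * V) * R' => b0 z.2 *
   \int[lebesgue_measure]_(phi in `[0, 2 * pi]) (f (z.1.1 + deviation I z.1.1 z.1.2 z.2 phi) - f z.1.1) : R').
  apply: measurable_funM; first exact: (measurableT_comp mb0 measurable_snd).
  exact: mphi.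
have := measurable_Rintegral_param (@lebesgue_measure R) mD mth.
congr (measurable_fun _ _); apply/funext => z /=; apply: eq_Rintegral => t.
by rewrite inE/= => tD; rewrite /b0 tD.
Qed.

End collision_measurability.

(** The majorant may take the value +oo, which later allows a pointwise estimate to be void on a
    null set. *)
Lemma Rintegral_le_integral d (T : measurableType d) (R : realType) (mu : {measure set T -> \bar R})
  (F : T -> R) (G : T -> \bar R) : mu.-integrable setT (EFin \o F) -> measurable_fun setT G ->
  (forall x, 0 <= G x)%E -> (forall x, (F x)%:E <= G x)%E -> ((\int[mu]_x F x)%:E <= \int[mu]_x G x)%E.
Proof.
move=> iF mG G0 FG; rewrite ge0_Rintegral_EFin// integralE.
apply: (@le_trans _ _ (\int[mu]_x ((fun x => (F x)%:E)^\+ x))%E).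
  by rewrite -[leRHS]adde0 leeD2l// leeNl oppe0; apply: integral_ge0 => x _.
have mF := measurable_int _ iF.
apply: ge0_le_integral => //; first exact: measurable_funepos.
by move=> x _; rewrite funeposE ge_max FG G0.
Qed.

(** * The collision inequality under a coupling *)

Section double_integral.
Context d (T : measurableType d) (R : realType) (P : probability T R).
Local Notation R' := (measurableTypeR R).
Local Notation PP := (P \x P)%E.

Lemma integral_tensor (u w : T -> \bar R) : measurable_fun setT u -> measurable_fun setT w ->
  (forall x, 0 <= u x)%E -> (forall x, 0 <= w x)%E ->
  (\int[PP]_z (u z.1 * w z.2) = (\int[P]_x u x) * (\int[P]_x w x))%E.
Proof.
move=> mu mw u0 w0.
have muw : measurable_fun setT (fun z : T * T => u z.1 * w z.2)%E.
  apply: emeasurable_funM; first exact: (measurableT_comp mu measurable_fst).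
  exact: (measurableT_comp mw measurable_snd).
rewrite fubini_tonelli1//; last by move=> z; rewrite mule_ge0.
transitivity (\int[P]_x (u x * \int[P]_y w y))%E.
  by apply: eq_integral => x _; rewrite /fubini_F/= ge0_integralZl.
by rewrite ge0_integralZr// integral_ge0.
Qed.

(** One half of a Schur test: the kernel is integrated first in the variable that c does not see. *)
Lemma integral_kernel_le (k : T * T -> \bar R) (c : T -> \bar R) (S : \bar R) : measurable_fun setT k ->
  measurable_fun setT c -> (forall z, 0 <= k z)%E -> (forall x, 0 <= c x)%E -> (0 <= S)%E ->
  (forall x, \int[P]_y k (x, y) <= S)%E ->
  (\int[PP]_z (k z * c z.1) <= S * \int[P]_x c x)%E.
Proof.
move=> mk mc k0 c0 S0 kS.
have mkc : measurable_fun setT (fun z : T * T => k z * c z.1)%E.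
  by apply: emeasurable_funM => //; exact: (measurableT_comp mc measurable_fst).
rewrite fubini_tonelli1//; last by move=> z; rewrite mule_ge0.
have mkx x : measurable_fun setT (fun y => k (x, y)) by exact: measurableT_comp mk (pair1_measurable x).
rewrite -ge0_integralZl//; apply: ge0_le_integral => //.
- by move=> x _; apply: integral_ge0 => y _; rewrite mule_ge0.
- by apply: measurable_fun_fubini_tonelli_F => // z; rewrite mule_ge0.
- exact: emeasurable_funM.
- move=> x _; rewrite /fubini_F/=.
  by rewrite ge0_integralZr//; apply: lee_wpmul2r.
Qed.

Lemma integral_kernel_le2 (k : T * T -> \bar R) (c : T -> \bar R) (S : \bar R) : measurable_fun setT k ->
  measurable_fun setT c -> (forall z, 0 <= k z)%E -> (forall x, 0 <= c x)%E -> (0 <= S)%E ->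
  (forall y, \int[P]_x k (x, y) <= S)%E ->
  (\int[PP]_z (k z * c z.2) <= S * \int[P]_x c x)%E.
Proof.
move=> mk mc k0 c0 S0 kS.
have mkc : measurable_fun setT (fun z : T * T => k z * c z.2)%E.
  by apply: emeasurable_funM => //; exact: (measurableT_comp mc measurable_snd).
rewrite fubini_tonelli2//; last by move=> z; rewrite mule_ge0.
have mkx y : measurable_fun setT (fun x => k (x, y)) by exact: measurableT_comp mk (pair2_measurable y).
rewrite -ge0_integralZl//; apply: ge0_le_integral => //.
- by move=> x _; apply: integral_ge0 => y _; rewrite mule_ge0.
- by apply: measurable_fun_fubini_tonelli_G => // z; rewrite mule_ge0.
- exact: emeasurable_funM.
- move=> x _; rewrite /fubini_G/=.
  by rewrite ge0_integralZr//; apply: lee_wpmul2r.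
Qed.

Section bounded_by_tensor.
Variables (m : T -> R) (L : R) (X : T * T -> R).
Hypotheses (mm : measurable_fun setT (m : _ -> R')) (m0 : forall x, 0 <= m x) (L0 : 0 <= L)
  (im : (\int[P]_x (m x)%:E < +oo)%E) (mX : measurable_fun setT (X : _ -> R'))
  (XL : forall z, `|X z| <= L * (m z.1 * m z.2)).

Let fin_m : exists D, 0 <= D /\ (\int[P]_x (m x)%:E = D%:E)%E.
Proof.
have h0 : (0 <= \int[P]_x (m x)%:E)%E by apply: integral_ge0 => x _; rewrite lee_fin.
exists (fine (\int[P]_x (m x)%:E)%E); split; first exact: fine_ge0.
by rewrite fineK// ge0_fin_numE.
Qed.

(** Domination by the product of an integrable weight with itself gives integrability on the product
    space, and with it Fubini's theorem for the signed collision term. *)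
Lemma tensor_integrable : PP.-integrable setT (EFin \o X).
Proof.
have [D [D0 DE]] := fin_m.
apply/integrableP; split; first exact/measurable_EFinP.
have mmE : measurable_fun setT (fun x => (m x)%:E) by exact/measurable_EFinP.
apply: (@le_lt_trans _ _ (\int[PP]_z ((L%:E * (m z.1)%:E) * (m z.2)%:E))%E).
  apply: ge0_le_integral => //.
  - by apply: measurableT_comp => //; exact/measurable_EFinP.
  - apply: emeasurable_funM; last exact: (measurableT_comp mmE measurable_snd).
    by apply: emeasurable_funM => //; exact: (measurableT_comp mmE measurable_fst).
  - by move=> z _; rewrite /= -!EFinM lee_fin -mulrA.
have h1 : measurable_fun setT (fun x => L%:E * (m x)%:E)%E by exact: emeasurable_funM.
rewrite (@integral_tensor (fun x => L%:E * (m x)%:E)%E (fun x => (m x)%:E))//; last first.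
  by move=> x; rewrite mule_ge0 ?lee_fin.
by rewrite ge0_integralZl// ?DE -?EFinM ?ltry// => x _; rewrite lee_fin.
Qed.

Lemma tensor_slice_integrable x : P.-integrable setT (fun y => (X (x, y))%:E).
Proof.
have [D [D0 DE]] := fin_m.
have mmE : measurable_fun setT (fun x => (m x)%:E) by exact/measurable_EFinP.
have mXx : measurable_fun setT (fun y => (X (x, y))%:E).
  by apply/measurable_EFinP; exact: (measurableT_comp mX (pair1_measurable x)).
apply/integrableP; split => //.
apply: (@le_lt_trans _ _ (\int[P]_y ((L * m x)%:E * (m y)%:E))%E).
  apply: ge0_le_integral => //.
  - exact: (measurableT_comp _ mXx).
  - exact: emeasurable_funM.
  - by move=> y _; rewrite /= -!EFinM lee_fin -mulrA.
rewrite ge0_integralZl// ?DE -?EFinM ?ltry//; first by move=> y _; rewrite lee_fin.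
by rewrite lee_fin mulr_ge0.
Qed.

Lemma tensor_Fubini : \int[P]_x \int[P]_y X (x, y) = \int[PP]_z X z.
Proof.
rewrite {1 3}/Rintegral; congr fine.
rewrite -(integral12_prod_meas1 tensor_integrable); apply: eq_integral => x _.
by rewrite /fubini_F/= ge0_Rintegral_EFin//; exact: tensor_slice_integrable.
Qed.

Lemma tensor_Rintegral_le D : (\int[P]_x (m x)%:E <= D%:E)%E ->
  `|\int[P]_x \int[P]_y X (x, y)| <= L * (D * D).
Proof.
have [D1 [D10 DE]] := fin_m; rewrite DE lee_fin => D1D.
have mmE : measurable_fun setT (fun x => (m x)%:E) by exact/measurable_EFinP.
rewrite tensor_Fubini; apply: (le_trans (le_normr_Rintegral measurableT tensor_integrable)).
rewrite -lee_fin.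
have iX := integrable_norm tensor_integrable.
apply: (@le_trans _ _ (\int[PP]_z ((L%:E * (m z.1)%:E) * (m z.2)%:E))%E).
  apply: Rintegral_le_integral => //.
  - apply: emeasurable_funM; last exact: (measurableT_comp mmE measurable_snd).
    by apply: emeasurable_funM => //; exact: (measurableT_comp mmE measurable_fst).
  - by move=> z; rewrite !mule_ge0 ?lee_fin.
  - by move=> z; rewrite /= -!EFinM lee_fin -mulrA.
have h1 : measurable_fun setT (fun x => L%:E * (m x)%:E)%E by exact: emeasurable_funM.
rewrite (@integral_tensor (fun x => L%:E * (m x)%:E)%E (fun x => (m x)%:E))//; last first.
  by move=> x; rewrite mule_ge0 ?lee_fin.
rewrite ge0_integralZl//; last by move=> x _; rewrite lee_fin.
by rewrite DE -!EFinM lee_fin -mulrA ler_wpM2l// ler_pM.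
Qed.

End bounded_by_tensor.
End double_integral.

Section coupling_integrals.
Context {R : realType}.
Local Notation V := (vec R).
Variables (f g : probability V R) (P : probability (V * V)%type R).
Hypothesis cP : coupling f g P.

Let marginal (pr : V * V -> V) (h : V -> \bar R) (k : probability V R) : measurable_fun setT pr ->
  (forall A, measurable A -> P (pr @^-1` A) = k A) -> measurable_fun setT h ->
  (\int[P]_z h (pr z) = \int[k]_x h x)%E.
Proof.
move=> mpr PE mh.
have ge0 (H : V -> \bar R) : measurable_fun setT H -> (forall x, 0 <= H x)%E ->
    (\int[P]_z H (pr z) = \int[k]_x H x)%E.
  move=> mH H0.
  have := @ge0_integral_pushforward _ _ _ _ R pr mpr P setT H measurableT mH (fun x _ => H0 x).
  by rewrite preimage_setT => <-; apply: eq_measure_integral => A mA _; exact: PE.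
rewrite integralE [RHS]integralE; congr (_ - _)%E.
  rewrite -ge0//; first by apply: eq_integral => z _; rewrite !funeposE.
  exact: measurable_funepos.
rewrite -ge0//; first by apply: eq_integral => z _; rewrite !funenegE.
exact: measurable_funeneg.
Qed.

Lemma coupling_integral1 (h : V -> \bar R) : measurable_fun setT h ->
  (\int[P]_z h z.1 = \int[f]_x h x)%E.
Proof.
apply: marginal; first exact: measurable_fst.
move=> A mA; rewrite -(cP mA).1; congr (P _).
by apply/seteqP; split => z //= [].
Qed.

Lemma coupling_integral2 (h : V -> \bar R) : measurable_fun setT h ->
  (\int[P]_z h z.2 = \int[g]_x h x)%E.
Proof.
apply: marginal; first exact: measurable_snd.
move=> A mA; rewrite -(cP mA).2; congr (P _).
by apply/seteqP; split => z //= [].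
Qed.

End coupling_integrals.

Section far_field.
Context {R : realType}.
Local Notation V := (vec R).
Implicit Types (M : R) (v w : V).

(** The factor M comes from the Lipschitz constant of the potentials. If one of |v|, |w| exceeds M,
    then M, M * |v| and M * |w| are all at most the sum of the two tails, so the growth in M is
    absorbed. *)
Lemma far_field_le M v v' w w' : 1 <= M -> (M < enorm v) || (M < enorm w) ->
  M * (2 + enorm (v - v') + enorm (w - w')) <=
  4 * ((tail2 M v + tail2 M w) * (1 + enorm v' + enorm w')).
Proof.
move=> M1 far.
have M0 : 0 <= M by exact: le_trans M1.
have h1 := enormB v v'; have h2 := enormB w w'.
apply: (@le_trans _ _ (M * (2 + (enorm v + enorm v') + (enorm w + enorm w')))).
  by rewrite ler_wpM2l// lerD// lerD2l.
have ht : forall a b c d : R, 0 <= a -> 0 <= b -> 0 <= c -> 0 <= d -> M < a ->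
    M * (2 + (a + c) + (b + d)) <= 4 * ((a ^+ 2 + (if b <= M then 0 else b ^+ 2)) * (1 + c + d)).
  move=> a b c d a0 b0 c0 d0 Ma.
  pose t := a ^+ 2 + (if b <= M then 0 else b ^+ 2).
  have i1 : M <= t.
    apply: (@le_trans _ _ (a ^+ 2)); first by rewrite expr2; nra.
    by rewrite lerDl; case: ifP => // _; exact: sqr_ge0.
  have i2 : M * a <= t.
    apply: (@le_trans _ _ (a ^+ 2)); first by rewrite expr2; nra.
    by rewrite lerDl; case: ifP => // _; exact: sqr_ge0.
  have i3 : M * b <= t.
    rewrite /t; case: (leP b M) => bM; first by rewrite addr0 expr2; nra.
    by rewrite !expr2; nra.
  rewrite -/t; move: t i1 i2 i3 => t i1 i2 i3.
  have j1 : M * c <= t * c by rewrite ler_wpM2r.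
  have j2 : M * d <= t * d by rewrite ler_wpM2r.
  have t0 : 0 <= t by exact: le_trans i1.
  have := mulr_ge0 t0 c0; have := mulr_ge0 t0 d0.
  by move: j1 j2 i1 i2 i3; rewrite !mulrDr !mulrDl; move: (M * c) (M * d) (t * c) (t * d) (M * a) (M * b) => *; lra.
case/orP: far => far.
  have := ht _ _ _ _ (enorm_ge0 v) (enorm_ge0 w) (enorm_ge0 v') (enorm_ge0 w') far.
  by rewrite /tail2 [enorm v <= M]leNgt far.
have := ht _ _ _ _ (enorm_ge0 w) (enorm_ge0 v) (enorm_ge0 w') (enorm_ge0 v') far.
have tw : tail2 M w = enorm w ^+ 2 by rewrite /tail2 leNgt far.
rewrite -/(tail2 M v) tw; move: (tail2 M v) (enorm v) (enorm w) (enorm v') (enorm w') => t a b c d h.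
apply: le_trans (le_trans h _); rewrite le_eqVlt; apply/orP; left; apply/eqP; ring.
Qed.

End far_field.

Section instantaneous.
Context {R : realType} (gamma nu : R) (beta G : R -> R) (Cr Cd k1 : R) (I : vec R -> vec R).
Hypotheses (hgamma : -1 < gamma < 0) (nu01 : 0 < nu < 1) (hgn : 0 < gamma + nu)
  (mb : measurable_fun `](0 : R), pi] beta) (b_ge0 : {in `](0 : R), pi], forall t, 0 <= beta t})
  (hG : inverse_angle nu beta G Cr Cd k1) (hI : orthogonal_selection I).
Local Notation V := (vec R).
Local Notation R' := (measurableTypeR R).
Local Notation A := (collision_op gamma beta I).

(** 128 is twice the 64 of [collision_pair]. In [far_rate] below, 96 = 4 * 24: the 4 of
    [far_field_le] and 2 * 12 from the Lipschitz constant 12 * M in [collision_op_le]. *)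
Definition rate : R := 128 * pi * (1 + Cr) ^+ 2 * k1.
Definition far_rate : R := 96 * pi * k1.

Let k10 : 0 <= k1. Proof. by case: hG => -[]. Qed.
Let Cr0 : 0 <= Cr. Proof. by case: hG => -[]. Qed.
Let Cd0 : 0 <= Cd. Proof. by case: hG => -[]. Qed.

Lemma rate_ge0 : 0 <= rate.
Proof. by rewrite /rate !mulr_ge0 ?pi_ge0 ?addr_ge0. Qed.

Lemma far_rate_ge0 : 0 <= far_rate.
Proof. by rewrite /far_rate !mulr_ge0 ?pi_ge0. Qed.

Lemma tail_rate_ge0 N : 0 <= tail_rate nu Cd N.
Proof.
apply: mulr_ge0; first by rewrite !mulr_ge0 ?pi_ge0.
rewrite divr_ge0 ?powR_ge0// subr_ge0.
by move: nu01 => /andP[n0 n1]; rewrite invf_ge1// ltW.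
Qed.

Definition weight (z : V * V) : R := 1 + enorm z.1 + enorm z.2.
Definition tails M (z : V * V) : R := tail2 M z.1 + tail2 M z.2.

Lemma weight_ge1 z : 1 <= weight z.
Proof. by rewrite /weight -addrA lerDl addr_ge0 ?enorm_ge0. Qed.

Lemma weight_ge0 z : 0 <= weight z.
Proof. exact: le_trans (weight_ge1 z). Qed.

Lemma tails_ge0 M z : 0 <= tails M z.
Proof. by rewrite addr_ge0 ?tail2_ge0. Qed.

Lemma weight_prod z z' : 2 + enorm (z.1 - z'.1) + enorm (z.2 - z'.2) <= 2 * (weight z * weight z').
Proof.
have h1 := enormB z.1 z'.1; have h2 := enormB z.2 z'.2; rewrite /weight.
have := enorm_ge0 z.1; have := enorm_ge0 z'.1; have := enorm_ge0 z.2; have := enorm_ge0 z'.2.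
move: h1 h2; move: (enorm (z.1 - z'.1)) (enorm (z.2 - z'.2)) (enorm z.1) (enorm z'.1) (enorm z.2) (enorm z'.2).
move=> i j a b c d h1 h2 d0 c0 b0 a0.
have := mulr_ge0 a0 b0; have := mulr_ge0 a0 d0; have := mulr_ge0 c0 b0; have := mulr_ge0 c0 d0.
by rewrite !mulrDr !mulrDl !mul1r !mulr1; move: (a * b) (a * d) (c * b) (c * d) => *; lra.
Qed.

(** If v and w lie in the ball of radius M, [collision_pair] applies and the squared distances are
    converted by [sqr_le_tcost]. Otherwise the Lipschitz bound is absorbed by the tails. All four
    terms are nonnegative, so each case pays only its own. *)
Lemma collision_pair_le f h M N z z' : lipv (12 * M) f -> lipv (12 * M) h ->
  (forall a b, f a + h b <= tcost M a b) -> 1 <= M -> 0 < N -> z.1 != z'.1 ->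
  A f z.1 z'.1 + A h z.2 z'.2 <=
    rate * (enorm (z.1 - z'.1) `^ gamma * ((tcost M z.1 z.2 + 4 * tails M z) + (tcost M z'.1 z'.2 + 4 * tails M z')))
    + N * (2 * pi * (tcost M z.1 z.2 - f z.1 - h z.2))
    + 24 * M * tail_rate nu Cd N * (weight z * weight z')
    + far_rate * (tails M z * weight z').
Proof.
move: z z' => [v w] [v' w'] /= fK hK fh M1 N0 vv'.
have M0 : 0 <= M by exact: le_trans M1.
have i1 : 0 <= rate * (enorm (v - v') `^ gamma * ((tcost M v w + 4 * tails M (v, w)) + (tcost M v' w' + 4 * tails M (v', w')))).
  rewrite mulr_ge0 ?rate_ge0// mulr_ge0 ?powR_ge0//.
  by rewrite !addr_ge0 ?tcost_ge0// mulr_ge0 ?tails_ge0.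
have i2 : 0 <= N * (2 * pi * (tcost M v w - f v - h w)).
  rewrite mulr_ge0 ?(ltW N0)// mulr_ge0 ?mulr_ge0 ?pi_ge0//.
  by rewrite -addrA -opprD subr_ge0.
have i3 : 0 <= 24 * M * tail_rate nu Cd N * (weight (v, w) * weight (v', w')).
  apply: mulr_ge0; last by apply: mulr_ge0; exact: weight_ge0.
  by apply: mulr_ge0; [rewrite mulr_ge0|exact: tail_rate_ge0].
have i4 : 0 <= far_rate * (tails M (v, w) * weight (v', w')).
  by rewrite mulr_ge0 ?far_rate_ge0// mulr_ge0 ?tails_ge0 ?weight_ge0.
have [far|] := boolP ((M < enorm v) || (M < enorm w)).
  have h1 := collision_op_le hgamma mb b_ge0 hG hI v v' fK.
  have h2 := collision_op_le hgamma mb b_ge0 hG hI w w' hK.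
  have h3 := far_field_le v' w' M1 far.
  have h4 : A f v v' + A h w w' <= far_rate * (tails M (v, w) * weight (v', w')).
    apply: (@le_trans _ _ (24 * pi * k1 * (M * (2 + enorm (v - v') + enorm (w - w'))))).
      apply: (le_trans (lerD (ler_norm _) (ler_norm _))); apply: (le_trans (lerD h1 h2)).
      by rewrite le_eqVlt; apply/orP; left; apply/eqP; ring.
    apply: (@le_trans _ _ (24 * pi * k1 * (4 * ((tail2 M v + tail2 M w) * (1 + enorm v' + enorm w'))))).
      by apply: ler_wpM2l => //; rewrite !mulr_ge0 ?pi_ge0.
    by rewrite /far_rate /tails /weight/= le_eqVlt; apply/orP; left; apply/eqP; ring.
  by apply: (le_trans h4); rewrite lerDr addr_ge0// addr_ge0.
rewrite negb_or -!leNgt => /andP[vM wM].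
have h1 := collision_pair hgamma nu01 hgn mb b_ge0 hG hI w' fK hK fh N0 vv' vM wM.
apply: (le_trans h1).
have j1 : 64 * pi * (1 + Cr) ^+ 2 * k1 *
  (enorm (v - v') `^ gamma * (2 * (enorm (v - w) ^+ 2 + enorm (v' - w') ^+ 2))) <=
  rate * (enorm (v - v') `^ gamma * ((tcost M v w + 4 * tails M (v, w)) + (tcost M v' w' + 4 * tails M (v', w')))).
  rewrite (_ : 64 * pi * (1 + Cr) ^+ 2 * k1 * _ =
    rate * (enorm (v - v') `^ gamma * (enorm (v - w) ^+ 2 + enorm (v' - w') ^+ 2))); last by rewrite /rate; ring.
  apply: ler_wpM2l; first exact: rate_ge0.
  apply: ler_wpM2l; first exact: powR_ge0.
  by apply: lerD; exact: sqr_le_tcost.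
have j2 : 12 * M * tail_rate nu Cd N * (2 + enorm (v - v') + enorm (w - w')) <=
    24 * M * tail_rate nu Cd N * (weight (v, w) * weight (v', w')).
  rewrite (_ : 24 * M * _ * _ = 12 * M * tail_rate nu Cd N * (2 * (weight (v, w) * weight (v', w')))); last by ring.
  apply: ler_wpM2l; first by apply: mulr_ge0; [rewrite mulr_ge0|exact: tail_rate_ge0].
  exact: (weight_prod (v, w) (v', w')).
apply: (le_trans (lerD (lerD j1 (lexx _)) j2)).
by rewrite lerDl.
Qed.

Lemma collision_op_weight_le K f v w : lipv K f ->
  `|A f v w| <= 2 * pi * K * k1 * ((1 + enorm v) * (1 + enorm w)).
Proof.
move=> fK; apply: (le_trans (collision_op_le hgamma mb b_ge0 hG hI v w fK)).
apply: ler_wpM2l; first by rewrite !mulr_ge0 ?pi_ge0// (lipv_ge0 fK).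
have := enormB v w; have := mulr_ge0 (enorm_ge0 v) (enorm_ge0 w).
by move: (enorm (v - w)) (enorm v) (enorm w) => i a b h1 h2; nra.
Qed.

Lemma measurable_weight : measurable_fun setT (weight : V * V -> R').
Proof.
apply: measurable_funD; first apply: measurable_funD => //; apply: measurable_enorm.
- exact: measurable_fst.
- exact: measurable_snd.
Qed.

Lemma measurable_tail2 M : measurable_fun setT (tail2 M : V -> R').
Proof.
have me : measurable_fun setT (fun x : V => enorm x : R') by exact: measurable_enorm.
rewrite (_ : tail2 M = fun x => if enorm x <= M then 0 else enorm x ^+ 2)//.
apply: measurable_fun_ifT => //.
  apply: measurable_fun_ler => //.
exact: measurable_funX.
Qed.

Lemma measurable_tails M : measurable_fun setT (tails M : V * V -> R').
Proof.
apply: measurable_funD.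
- exact: (measurableT_comp (measurable_tail2 M) measurable_fst).
- exact: (measurableT_comp (measurable_tail2 M) measurable_snd).
Qed.

End instantaneous.

Section instantaneous_inequality.
Context {R : realType} (gamma nu : R) (beta G : R -> R) (Cr Cd k1 : R) (I : vec R -> vec R).
Hypotheses (hgamma : -1 < gamma < 0) (nu01 : 0 < nu < 1) (hgn : 0 < gamma + nu)
  (mb : measurable_fun `](0 : R), pi] beta) (b_ge0 : {in `](0 : R), pi], forall t, 0 <= beta t})
  (hG : inverse_angle nu beta G Cr Cd k1) (hI : orthogonal_selection I).
Local Notation V := (vec R).
Local Notation R' := (measurableTypeR R).
Local Notation A := (collision_op gamma beta I).

Definition collision_mean (f : probability V R) (phi : V -> R) : R :=
  \int[f]_v \int[f]_w A phi v w.

Let k10 : 0 <= k1. Proof. by case: hG => -[]. Qed.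

Let mA K phi : lipv K phi -> measurable_fun setT (fun z : V * V => A phi z.1 z.2 : R').
Proof. move=> phiK; exact: (measurable_collision_op gamma mb hI phiK). Qed.

Let mw1 : measurable_fun setT (fun x : V => 1 + enorm x : R').
Proof. by apply: measurable_funD => //; exact: measurable_enorm. Qed.

Let ge1e (x : V) : 0 <= 1 + enorm x.
Proof. by rewrite addr_ge0 ?enorm_ge0. Qed.

Lemma collision_mean_le (f : probability V R) K phi D : lipv K phi ->
  (\int[f]_v (1 + enorm v)%:E <= D%:E)%E ->
  `|collision_mean f phi| <= 2 * pi * K * k1 * (D * D).
Proof.
move=> phiK fD; apply: (@tensor_Rintegral_le _ _ _ f (fun v => 1 + enorm v) _ (fun z => A phi z.1 z.2)) => //.
- by rewrite !mulr_ge0 ?pi_ge0// (lipv_ge0 phiK).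
- by apply: le_lt_trans fD _; rewrite ltry.
- exact: mA phiK.
- by move=> z; exact: (collision_op_weight_le hgamma mb b_ge0 hG hI _ _ phiK).
Qed.

Variables (f g : probability V R) (P : probability (V * V)%type R).
Hypothesis cP : coupling f g P.
Local Notation PP := (P \x P)%E.

Let weight_int D : (\int[f]_v (1 + enorm v)%:E <= D%:E)%E -> (\int[g]_v (1 + enorm v)%:E <= D%:E)%E ->
  (\int[P]_z (weight z)%:E <= (2 * D)%:E)%E.
Proof.
move=> fD gD; have mw1' : measurable_fun setT (fun x : V => (1 + enorm x)%:E) by exact/measurable_EFinP.
apply: (@le_trans _ _ (\int[P]_z ((1 + enorm z.1)%:E + (1 + enorm z.2)%:E))%E).
  apply: ge0_le_integral => //.
  - by move=> z _; rewrite lee_fin weight_ge0.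
  - by apply/measurable_EFinP; exact: measurable_weight.
  - by apply: emeasurable_funD; [exact: (measurableT_comp mw1' measurable_fst)|
      exact: (measurableT_comp mw1' measurable_snd)].
  - by move=> z _; rewrite -EFinD lee_fin /weight; have := enorm_ge0 z.1; move: (enorm _) (enorm _) => a b; lra.
rewrite ge0_integralD//; first last.
- exact: (measurableT_comp mw1' measurable_snd).
- by move=> z _; rewrite lee_fin.
- exact: (measurableT_comp mw1' measurable_fst).
- by move=> z _; rewrite lee_fin.
rewrite (coupling_integral1 cP mw1') (coupling_integral2 cP mw1') mulr2n mulrDl mul1r EFinD.
exact: leeD.
Qed.

Let weight_fin D : (\int[f]_v (1 + enorm v)%:E <= D%:E)%E -> (\int[g]_v (1 + enorm v)%:E <= D%:E)%E ->
  (\int[P]_z (weight z)%:E < +oo)%E.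
Proof. by move=> fD gD; apply: le_lt_trans (weight_int fD gD) _; rewrite ltry. Qed.

Section lifted.
Variables (D K : R) (phi psi : V -> R).
Hypotheses (fD : (\int[f]_v (1 + enorm v)%:E <= D%:E)%E) (gD : (\int[g]_v (1 + enorm v)%:E <= D%:E)%E)
  (phiK : lipv K phi) (psiK : lipv K psi).

Let K0 : 0 <= K := lipv_ge0 phiK.
Let L := 2 * pi * K * k1.
Let L0 : 0 <= L. Proof. by rewrite /L !mulr_ge0 ?pi_ge0. Qed.
Let X1 (z : (V * V) * (V * V)) := A phi z.1.1 z.2.1.
Let X2 (z : (V * V) * (V * V)) := A psi z.1.2 z.2.2.

Let m11 : measurable_fun setT (fun z : (V * V) * (V * V) => (z.1.1, z.2.1)).
Proof.
by apply: measurable_fun_pair; apply: measurableT_comp measurable_fst _; [exact: measurable_fst|exact: measurable_snd].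
Qed.

Let m22 : measurable_fun setT (fun z : (V * V) * (V * V) => (z.1.2, z.2.2)).
Proof.
by apply: measurable_fun_pair; apply: measurableT_comp measurable_snd _; [exact: measurable_fst|exact: measurable_snd].
Qed.

Let mX1 : measurable_fun setT (X1 : _ -> R').
Proof. exact: (measurableT_comp (mA phiK) m11). Qed.

Let mX2 : measurable_fun setT (X2 : _ -> R').
Proof. exact: (measurableT_comp (mA psiK) m22). Qed.

Let wle1 (z : V * V) : 1 + enorm z.1 <= weight z.
Proof. by rewrite /weight lerDl enorm_ge0. Qed.

Let wle2 (z : V * V) : 1 + enorm z.2 <= weight z.
Proof. by rewrite /weight addrAC lerDl enorm_ge0. Qed.

Let XL1 z : `|X1 z| <= L * (weight z.1 * weight z.2).
Proof.
apply: (le_trans (collision_op_weight_le hgamma mb b_ge0 hG hI _ _ phiK)).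
by apply: ler_wpM2l => //; apply: ler_pM.
Qed.

Let XL2 z : `|X2 z| <= L * (weight z.1 * weight z.2).
Proof.
apply: (le_trans (collision_op_weight_le hgamma mb b_ge0 hG hI _ _ psiK)).
by apply: ler_wpM2l => //; apply: ler_pM.
Qed.

Let iX1 := tensor_integrable (@measurable_weight R) (@weight_ge0 R) L0 (weight_fin fD gD) mX1 XL1.
Let iX2 := tensor_integrable (@measurable_weight R) (@weight_ge0 R) L0 (weight_fin fD gD) mX2 XL2.

Let mRint (k : probability V R) K' (h : V -> R) : lipv K' h ->
  measurable_fun setT (fun v => \int[k]_w A h v w : R').
Proof. by move=> hK; exact: (measurable_Rintegral_param k measurableT (mA hK)). Qed.

(** Two independent copies (v, w) and (v', w') of the coupled pair: the first components have law f
    (x) f, the second ones g (x) g, so both collision terms become integrals over the same space. *)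
Lemma collision_mean_lift : collision_mean f phi + collision_mean g psi = \int[PP]_z (X1 z + X2 z).
Proof.
rewrite (RintegralD measurableT iX1 iX2).
rewrite -(tensor_Fubini (@measurable_weight R) (@weight_ge0 R) L0 (weight_fin fD gD) mX1 XL1).
rewrite -(tensor_Fubini (@measurable_weight R) (@weight_ge0 R) L0 (weight_fin fD gD) mX2 XL2).
have mslice K' h v : lipv K' h -> measurable_fun setT (fun w => (A h v w)%:E).
  by move=> hK; apply/measurable_EFinP; exact: (measurableT_comp (mA hK) (pair1_measurable v)).
congr (_ + _).
  transitivity (\int[P]_z \int[f]_w A phi z.1 w).
    rewrite /collision_mean /Rintegral; congr fine; apply/esym.
    apply: (coupling_integral1 cP (h := fun v => (\int[f]_w A phi v w)%:E)).
    by apply/measurable_EFinP; exact: mRint phiK.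
  apply: eq_Rintegral => z _; rewrite /Rintegral; congr fine.
  by rewrite -(coupling_integral1 cP (mslice _ _ z.1 phiK)).
transitivity (\int[P]_z \int[g]_w A psi z.2 w).
  rewrite /collision_mean /Rintegral; congr fine; apply/esym.
  apply: (coupling_integral2 cP (h := fun v => (\int[g]_w A psi v w)%:E)).
  by apply/measurable_EFinP; exact: mRint psiK.
apply: eq_Rintegral => z _; rewrite /Rintegral; congr fine.
by rewrite -(coupling_integral2 cP (mslice _ _ z.2 psiK)).
Qed.

Variables (M N S T : R).
Hypotheses (M1 : 1 <= M) (N0 : 0 < N) (KM : K = 12 * M)
  (phipsi : forall x y, phi x + psi y <= tcost M x y)
  (bnd : exists B, forall x, `|phi x| <= B /\ `|psi x| <= B)
  (fS : forall v, (\int[f]_w (enorm (v - w) `^ gamma)%:E <= S%:E)%E)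
  (f_atom : forall v, f [set v] = 0%E)
  (fgT : (\int[f]_v (tail2 M v)%:E + \int[g]_v (tail2 M v)%:E <= T%:E)%E).

Let M0 : 0 <= M. Proof. exact: le_trans M1. Qed.
Let S0 : 0 <= S.
Proof.
rewrite -lee_fin; apply: le_trans (fS 0); apply: integral_ge0 => w _.
by rewrite lee_fin powR_ge0.
Qed.

(** [c] majorizes the squared distance, and [b] below is the duality gap of the pair. *)
Let c (z : V * V) := tcost M z.1 z.2 + 4 * tails M z.
Let b (z : V * V) := tcost M z.1 z.2 - phi z.1 - psi z.2.
Let c0 z : 0 <= c z. Proof. by rewrite addr_ge0 ?tcost_ge0// mulr_ge0 ?tails_ge0. Qed.
Let b0 z : 0 <= b z. Proof. by rewrite /b -addrA -opprD subr_ge0. Qed.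

Let mtc : measurable_fun setT (fun z : V * V => tcost M z.1 z.2 : R').
Proof. by apply: measurable_tcost; [exact: measurable_fst|exact: measurable_snd]. Qed.

Let mc : measurable_fun setT (c : _ -> R').
Proof. by apply: measurable_funD => //; apply: measurable_funM => //; exact: measurable_tails. Qed.

Let mphi : measurable_fun setT (phi : V -> R') := lipv_measurable phiK.
Let mpsi : measurable_fun setT (psi : V -> R') := lipv_measurable psiK.
Let mphi1 : measurable_fun setT (fun z : V * V => phi z.1 : R') := measurableT_comp mphi measurable_fst.
Let mpsi2 : measurable_fun setT (fun z : V * V => psi z.2 : R') := measurableT_comp mpsi measurable_snd.

Let mb' : measurable_fun setT (b : _ -> R').
Proof. by apply: measurable_funB => //; exact: measurable_funB. Qed.

Let itc : P.-integrable setT (fun z => (tcost M z.1 z.2)%:E).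
Proof.
apply: (@bounded_integrable _ _ _ P _ (36 * M ^+ 2)) => // z.
by rewrite ger0_norm ?tcost_ge0// tcost_bound.
Qed.

Lemma gap_integral : (\int[P]_z (b z)%:E =
  (\int[P]_z tcost M z.1 z.2 - \int[f]_v phi v - \int[g]_v psi v)%:E)%E.
Proof.
have [B hB] := bnd.
have i1 : P.-integrable setT (fun z => (phi z.1)%:E).
  by apply: (@bounded_integrable _ _ _ P _ B) => // z; have [] := hB z.1.
have i2 : P.-integrable setT (fun z => (psi z.2)%:E).
  by apply: (@bounded_integrable _ _ _ P _ B) => // z; have [_] := hB z.2.
have i12 : P.-integrable setT (fun z => (tcost M z.1 z.2 - phi z.1)%:E).
  by have := integrableB measurableT itc i1.
rewrite -ge0_Rintegral_EFin; last by have := integrableB measurableT i12 i2.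
rewrite RintegralB// RintegralB//; congr ((_ - _ - _)%:E).
  by congr fine; apply: (coupling_integral1 cP (h := EFin \o phi)); exact/measurable_EFinP.
by congr fine; apply: (coupling_integral2 cP (h := EFin \o psi)); exact/measurable_EFinP.
Qed.

Let mtail : measurable_fun setT (fun v : V => (tail2 M v)%:E).
Proof. by apply/measurable_EFinP; exact: measurable_tail2. Qed.

Lemma tails_integral : (\int[P]_z (tails M z)%:E <= T%:E)%E.
Proof.
apply: le_trans fgT; rewrite /tails; under eq_integral do rewrite EFinD.
rewrite ge0_integralD//; first last.
- exact: (measurableT_comp mtail measurable_snd).
- by move=> z _; rewrite lee_fin tail2_ge0.
- exact: (measurableT_comp mtail measurable_fst).
- by move=> z _; rewrite lee_fin tail2_ge0.
by rewrite (coupling_integral1 cP mtail) (coupling_integral2 cP mtail).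
Qed.

Lemma cost_integral : (\int[P]_z (c z)%:E <= (\int[P]_z tcost M z.1 z.2 + 4 * T)%:E)%E.
Proof.
rewrite /c; under eq_integral do rewrite EFinD EFinM.
have mt : measurable_fun setT (fun z : V * V => (tails M z)%:E).
  by apply/measurable_EFinP; exact: measurable_tails.
have mt4 : measurable_fun setT (fun z : V * V => 4%:E * (tails M z)%:E)%E by exact: emeasurable_funM.
have mtcE : measurable_fun setT (fun z : V * V => (tcost M z.1 z.2)%:E) by exact/measurable_EFinP.
have t40 z : setT z -> (0 <= 4%:E * (tails M z)%:E)%E.
  by move=> _; rewrite mule_ge0 ?lee_fin ?tails_ge0.
have tc0 z : setT z -> (0 <= (tcost M z.1 z.2)%:E)%E by move=> _; rewrite lee_fin tcost_ge0.
rewrite (ge0_integralD P measurableT tc0 mtcE t40 mt4).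
rewrite [leRHS]EFinD; apply: leeD; first by rewrite ge0_Rintegral_EFin.
rewrite ge0_integralZl//; last by move=> z _; rewrite lee_fin tails_ge0.
by rewrite EFinM lee_wpmul2l ?lee_fin// tails_integral.
Qed.

(** Couples a nonnegative majorant with a bound on its integral; closure under sums and multiples
    lets the majorant and its bound be assembled together. *)
Let Q (u : (V * V) * (V * V) -> \bar R) (a : R) :=
  [/\ measurable_fun setT u, (forall z, 0 <= u z)%E & (\int[PP]_z u z <= a%:E)%E].

Let QD u v x y : Q u x -> Q v y -> Q (fun z => u z + v z)%E (x + y).
Proof.
move=> [mu u0 ux] [mv v0 vy]; split; first exact: emeasurable_funD.
  by move=> z; rewrite adde_ge0.
by rewrite ge0_integralD// EFinD leeD.
Qed.

Let QZ u x k : 0 <= k -> Q u x -> Q (fun z => k%:E * u z)%E (k * x).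
Proof.
move=> k0 [mu u0 ux]; split; first exact: emeasurable_funM.
  by move=> z; rewrite mule_ge0 ?lee_fin.
by rewrite ge0_integralZl// EFinM lee_wpmul2l ?lee_fin.
Qed.

Let Qtensor (u v : V * V -> R) x y : measurable_fun setT (u : _ -> R') -> measurable_fun setT (v : _ -> R') ->
  (forall z, 0 <= u z) -> (forall z, 0 <= v z) -> (\int[P]_z (u z)%:E <= x%:E)%E ->
  (\int[P]_z (v z)%:E <= y%:E)%E -> Q (fun z => (u z.1)%:E * (v z.2)%:E)%E (x * y).
Proof.
move=> /measurable_EFinP mu /measurable_EFinP mv u0 v0 ux vy; split.
- by apply: emeasurable_funM; [exact: (measurableT_comp mu measurable_fst)|exact: (measurableT_comp mv measurable_snd)].
- by move=> z; rewrite mule_ge0 ?lee_fin.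
rewrite (@integral_tensor _ _ _ P (fun z => (u z)%:E) (fun z => (v z)%:E))//.
by rewrite EFinM; apply: lee_pmul => //; apply: integral_ge0 => z _; rewrite lee_fin.
Qed.

Let kap (z : (V * V) * (V * V)) : \bar R := (enorm (z.1.1 - z.2.1) `^ gamma)%:E.

Let mdiff : measurable_fun setT (fun z : (V * V) * (V * V) => z.1.1 - z.2.1).
Proof.
apply: measurable_vecB; apply: measurableT_comp measurable_fst _;
  [exact: measurable_fst|exact: measurable_snd].
Qed.

Let mkap : measurable_fun setT kap.
Proof.
apply/measurable_EFinP; apply: (@measurableT_comp _ _ _ _ _ _ (fun x : R' => (x : R) `^ gamma : R')).
  exact: measurable_powR.
exact: (measurable_enorm mdiff).
Qed.

Let mkv (v : V) : measurable_fun setT (fun w : V => (enorm (v - w) `^ gamma)%:E).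
Proof.
apply/measurable_EFinP; apply: (@measurableT_comp _ _ _ _ _ _ (fun x : R' => (x : R) `^ gamma : R')).
  exact: measurable_powR.
by apply: measurable_enorm; apply: measurable_vecB.
Qed.

Let kapS (z : V * V) : (\int[P]_z' kap (z, z') <= S%:E)%E.
Proof.
have := coupling_integral1 cP (mkv z.1); rewrite /kap/= => ->; exact: fS.
Qed.

(** By symmetry of the distance the kernel is controlled in either variable by the law f alone. *)
Let kapS2 (z : V * V) : (\int[P]_z' kap (z', z) <= S%:E)%E.
Proof.
apply: le_trans (kapS z); rewrite le_eqVlt; apply/orP; left; apply/eqP.
apply: eq_integral => z' _; exact: (congr1 (fun x : R => (x `^ gamma)%:E) (enormBC z'.1 z.1)).
Qed.

Let kap0 z : (0 <= kap z)%E. Proof. by rewrite lee_fin powR_ge0. Qed.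
Let cE0 z : (0 <= (c z)%:E)%E. Proof. by rewrite lee_fin. Qed.
Let S0E : (0 <= S%:E)%E. Proof. by rewrite lee_fin. Qed.

Let Qkap1 : Q (fun z => kap z * (c z.1)%:E)%E (S * (\int[P]_z tcost M z.1 z.2 + 4 * T)).
Proof.
have mcE : measurable_fun setT (fun z => (c z)%:E) by exact/measurable_EFinP.
split.
- by apply: emeasurable_funM => //; exact: (measurableT_comp mcE measurable_fst).
- by move=> z; rewrite mule_ge0.
apply: (le_trans (integral_kernel_le mkap mcE kap0 cE0 S0E kapS)).
by rewrite EFinM lee_wpmul2l//; exact: cost_integral.
Qed.

Let Qkap2 : Q (fun z => kap z * (c z.2)%:E)%E (S * (\int[P]_z tcost M z.1 z.2 + 4 * T)).
Proof.
have mcE : measurable_fun setT (fun z => (c z)%:E) by exact/measurable_EFinP.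
split.
- by apply: emeasurable_funM => //; exact: (measurableT_comp mcE measurable_snd).
- by move=> z; rewrite mule_ge0.
apply: (le_trans (integral_kernel_le2 mkap mcE kap0 cE0 S0E kapS2)).
by rewrite EFinM lee_wpmul2l//; exact: cost_integral.
Qed.

(** Infinite where v = v' and 0 elsewhere: added to the majorant it makes the pointwise bound
    trivial on the diagonal, at no cost since f has no atoms. *)
Let del (z : (V * V) * (V * V)) : \bar R := if z.1.1 - z.2.1 == 0 then +oo%E else 0%E.

Let Qdel : Q del 0.
Proof.
have m0 : measurable ([set 0] : set V).
  have -> : [set 0 : V] = ([set (0 : V).1.1] `*` [set (0 : V).1.2]) `*` [set (0 : V).2].
    apply/seteqP; split => [x ->//|[[x1 x2] x3] /= [[-> ->] ->]//].
  by apply: measurableX => //; apply: measurableX.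
have md : measurable_fun setT del.
  apply: measurable_fun_ifT => //; apply: (measurable_fun_bool true).
  rewrite (_ : _ @^-1` _ = (fun z : (V * V) * (V * V) => z.1.1 - z.2.1) @^-1` [set 0]).
    by apply: mdiff.
  by apply/seteqP; split => z /= /eqP.
have d0 z : (0 <= del z)%E by rewrite /del; case: ifP.
split => //; rewrite fubini_tonelli1// integral0_eq// => z _.
rewrite /fubini_F /del/=.
have mz : measurable_fun setT (fun w : V => if z.1 - w == 0 then +oo%E else 0%E : \bar R).
  apply: measurable_fun_ifT => //; apply: (measurable_fun_bool true).
  rewrite (_ : _ @^-1` _ = (fun w : V => z.1 - w) @^-1` [set 0]).
    by apply: measurable_vecB.
  by apply/seteqP; split => w /= /eqP.
rewrite (coupling_integral1 cP mz).
have ms : measurable [set z.1].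
  rewrite (_ : [set z.1] = (fun w : V => z.1 - w) @^-1` [set 0]).
    by rewrite -[X in measurable X]setTI; apply: measurable_vecB.
  by apply/seteqP; split => w /=; [move=> ->; rewrite subrr|move/eqP; rewrite subr_eq0 => /eqP].
transitivity (\int[f]_(w in [set z.1]) (+oo : \bar R))%E.
  rewrite [RHS]integral_mkcond; apply: eq_integral => w _.
  by rewrite patchE; case: ifPn => [|/negP] h; [rewrite mem_set//=; move: h; rewrite subr_eq0 => /eqP|
    rewrite memNset//= => wz; apply: h; rewrite wz subrr].
by rewrite integral_cst// [X in (_ * X)%E](_ : _ = 0%E) ?mule0//; exact: f_atom.
Qed.

Lemma collision_coupling_le : collision_mean f phi + collision_mean g psi <=
  rate Cr k1 * (2 * S * (\int[P]_z tcost M z.1 z.2 + 4 * T)) +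
  N * (2 * pi * (\int[P]_z tcost M z.1 z.2 - \int[f]_v phi v - \int[g]_v psi v)) +
  24 * M * tail_rate nu Cd N * (2 * D * (2 * D)) + far_rate k1 * (T * (2 * D)).
Proof.
have r0 := rate_ge0 hG; have fr0 := far_rate_ge0 hG.
have t0 : 0 <= 24 * M * tail_rate nu Cd N by apply: mulr_ge0; [rewrite mulr_ge0|exact: (tail_rate_ge0 nu01 hG)].
have nn0 : 0 <= N * (2 * pi) by rewrite mulr_ge0 ?mulr_ge0 ?pi_ge0// ltW.
have Qb : Q (fun z => (b z.1)%:E * (1 : R)%:E)%E
    ((\int[P]_z tcost M z.1 z.2 - \int[f]_v phi v - \int[g]_v psi v) * 1).
  apply: (@Qtensor b (fun=> 1)) => //; first by rewrite gap_integral.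
  by rewrite prob_integral_cst.
have Qw : Q (fun z => (weight z.1)%:E * (weight z.2)%:E)%E (2 * D * (2 * D)).
  by apply: Qtensor => //; [exact: measurable_weight|exact: measurable_weight|exact: weight_ge0|exact: weight_ge0|
    exact: weight_int|exact: weight_int].
have Qt : Q (fun z => (tails M z.1)%:E * (weight z.2)%:E)%E (T * (2 * D)).
  by apply: Qtensor => //; [exact: measurable_tails|exact: measurable_weight|exact: tails_ge0|exact: weight_ge0|
    exact: tails_integral|exact: weight_int].
(* In this order: the singular kernel, the duality gap, the collisions beyond the cutoff, the far
   field and the diagonal. *)
have [mG G0 GI] := QD (QD (QD (QD (QZ r0 (QD Qkap1 Qkap2)) (QZ nn0 Qb)) (QZ t0 Qw)) (QZ fr0 Qt)) Qdel.
have iX : PP.-integrable setT (EFin \o (fun z => X1 z + X2 z)).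
  by have := integrableD measurableT iX1 iX2.
rewrite collision_mean_lift -lee_fin.
apply: (le_trans (Rintegral_le_integral iX mG G0 _)).
  move=> [z z']; rewrite /del/=; case: ifPn => zz'; first by rewrite addey ?leey.
  have vv' : z.1 != z'.1 by rewrite -subr_eq0.
  rewrite adde0 mule1.
  pose k := enorm (z.1 - z'.1) `^ gamma.
  apply: (@le_trans _ _ (rate Cr k1 * (k * c z + k * c z') + N * (2 * pi) * b z +
    24 * M * tail_rate nu Cd N * (weight z * weight z') + far_rate k1 * (tails M z * weight z'))%:E); last first.
    exact: lexx.
  rewrite lee_fin.
  have phiK' : lipv (12 * M) phi by rewrite -KM.
  have psiK' : lipv (12 * M) psi by rewrite -KM.
  rewrite -(mulrDr k) -(mulrA N (2 * pi)).
  exact: (collision_pair_le hgamma nu01 hgn mb b_ge0 hG hI phiK' psiK' phipsi M1 N0 vv').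
apply: (le_trans GI); rewrite lee_fin le_eqVlt; apply/orP; left; apply/eqP.
by move: (\int[P]_z _) (\int[f]_v _) (\int[g]_v _) => x y t; ring.
Qed.

End lifted.
End instantaneous_inequality.

(** * Evolution of the optimal cost *)

Section optimal_cost.
Context {R : realType}.
Local Notation V := (vec R).
Local Notation R' := (measurableTypeR R).
Variables (M : R) (f g : probability V R).
Hypothesis M1 : 1 <= M.

Let M0 : 0 < M. Proof. exact: lt_le_trans M1. Qed.

(** A real number because the truncated cost is bounded, whereas the untruncated distance may be
    infinite. *)
Definition Wc : R := inf [set \int[P]_z tcost M z.1 z.2 | P in coupling f g].

Let cost_ge0 (P : probability (V * V)%type R) : 0 <= \int[P]_z tcost M z.1 z.2.
Proof. by apply: Rintegral_ge0 => z _; exact: tcost_ge0. Qed.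

Lemma Wc_le P : coupling f g P -> Wc <= \int[P]_z tcost M z.1 z.2.
Proof.
move=> cP; apply: ge_inf; last by exists P.
by exists 0 => _ [P' _ <-]; exact: cost_ge0.
Qed.

Lemma weak_duality K phi psi : lipv K phi -> lipv K psi ->
  (exists B, forall x, `|phi x| <= B /\ `|psi x| <= B) ->
  (forall x y, phi x + psi y <= tcost M x y) ->
  \int[f]_v phi v + \int[g]_v psi v <= Wc.
Proof.
move=> phiK psiK bnd pp; apply: lb_le_inf.
  have [P [_ [_ [cP _ _ _ _]]]] := approx_duality f g M0 ltr01.
  by exists (\int[P]_z tcost M z.1 z.2), P.
move=> _ [P cP <-]; have := gap_integral cP phiK psiK M1 bnd.
have h : (0 <= \int[P]_z (tcost M z.1 z.2 - phi z.1 - psi z.2)%:E)%E.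
  by apply: integral_ge0 => z _; rewrite lee_fin -addrA -opprD subr_ge0.
by move=> E; move: h; rewrite E lee_fin; move: (\int[P]_z _) (\int[f]_v _) (\int[g]_v _) => *; lra.
Qed.

Lemma Wc_dual e : 0 < e -> exists (P : probability (V * V)%type R) (phi psi : V -> R),
  [/\ coupling f g P, lipv (12 * M) phi /\ lipv (12 * M) psi,
      exists B, forall x, `|phi x| <= B /\ `|psi x| <= B,
      forall x y, phi x + psi y <= tcost M x y &
      \int[P]_z tcost M z.1 z.2 <= Wc + e /\ Wc - e <= \int[f]_x phi x + \int[g]_x psi x].
Proof.
move=> e0; have [P [phi [psi [cP [L1 L2] B pp h]]]] := approx_duality f g M0 e0.
have wd := weak_duality L1 L2 B pp; have wl := Wc_le cP.
exists P, phi, psi; split => //; move: h wd wl.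
by move: (\int[P]_z _) (\int[f]_x _) (\int[g]_x _) Wc => a b c d h1 h2 h3; split; lra.
Qed.

Lemma Wc_ge0 : 0 <= Wc.
Proof.
apply: lb_le_inf; last by move=> _ [P _ <-]; exact: cost_ge0.
have [P [_ [_ [cP _ _ _ _]]]] := approx_duality f g M0 ltr01.
by exists (\int[P]_z tcost M z.1 z.2), P.
Qed.

End optimal_cost.

(** H - F agrees almost everywhere with its positive part, whose integral is nonnegative. It is
    applied in time, where the kernel bound holds only almost everywhere. *)
Lemma ae_le_Rintegral d (T : measurableType d) (R : realType) (mu : {measure set T -> \bar R})
  (D : set T) (F H : T -> R) : measurable D -> mu.-integrable D (EFin \o F) -> mu.-integrable D (EFin \o H) ->
  {ae mu, forall x, D x -> F x <= H x} -> \int[mu]_(x in D) F x <= \int[mu]_(x in D) H x.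
Proof.
move=> mD iF iH FH; rewrite -subr_ge0 -RintegralB//.
have mF := measurable_int _ iF; have mH := measurable_int _ iH.
have mHF : measurable_fun D (fun x => (H x - F x)%:E).
  by apply/measurable_EFinP; apply: measurable_funB; exact/measurable_EFinP.
have -> : \int[mu]_(x in D) (H x - F x) = \int[mu]_(x in D) Num.max (H x - F x) 0.
  rewrite /Rintegral; congr fine; apply: ae_eq_integral => //.
    by apply/measurable_EFinP; apply: measurable_maxr => //; exact/measurable_EFinP.
  by apply: filterS FH => x h Dx; rewrite max_l// subr_ge0 h.
by apply: Rintegral_ge0 => x _; rewrite le_max lexx orbT.
Qed.

Lemma le_addgt0Mr (R : realFieldType) (x y c : R) : 0 <= c -> (forall e, 0 < e -> x <= y + c * e) -> x <= y.
Proof.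
move=> c0 h; apply/ler_addgt0Pr => e e0.
have c1 : 0 < c + 1 by rewrite ltr_wpDl.
apply: (le_trans (h (e / (c + 1)) _)); first by rewrite divr_gt0.
by rewrite lerD2l mulrCA ler_piMr ?(ltW e0)// ler_pdivrMr// mul1r lerDl.
Qed.

Section evolution.
Context {R : realType} (gamma nu : R) (beta G : R -> R) (Cr Cd k1 : R) (I : vec R -> vec R).
Hypotheses (hgamma : -1 < gamma < 0) (nu01 : 0 < nu < 1) (hgn : 0 < gamma + nu)
  (mb : measurable_fun `](0 : R), pi] beta) (b_ge0 : {in `](0 : R), pi], forall t, 0 <= beta t})
  (hG : inverse_angle nu beta G Cr Cd k1) (hI : orthogonal_selection I).
Local Notation V := (vec R).
Local Notation R' := (measurableTypeR R).
Local Notation A := (collision_op gamma beta I).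
Local Notation mean := (collision_mean gamma beta I).
Local Notation mu := (@lebesgue_measure R).

Let k10 : 0 <= k1. Proof. by case: hG => -[]. Qed.

Section single.
Variables (f : R -> probability V R) (D : R).
Hypotheses (mf : forall B, measurable B -> measurable_fun setT (fun t : R' => f t B))
  (fD : forall t, (\int[f t]_v (1 + enorm v)%:E <= D%:E)%E)
  (fw : forall K phi, lipv K phi -> (exists B, forall x, `|phi x| <= B) -> forall t : R, 0 <= t ->
     \int[f t]_v phi v = \int[f 0]_v phi v + \int[mu]_(s in `[0, t]) mean (f s) phi).

Lemma collision_mean_measurable K phi : lipv K phi ->
  measurable_fun setT (fun u : R' => mean (f u) phi : R').
Proof.
move=> phiK.
have mA : measurable_fun setT (fun z : (R' * V) * V => A phi z.1.2 z.2 : R').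
  have mp : measurable_fun setT (fun z : (R' * V) * V => (z.1.2, z.2)).
    apply: measurable_fun_pair; last exact: measurable_snd.
    exact: measurableT_comp measurable_snd measurable_fst.
  exact: (measurableT_comp (measurable_collision_op gamma mb hI phiK) mp).
have mf2 B : measurable B -> measurable_fun setT (fun z : R' * V => f z.1 B).
  by move=> mB; exact: (measurableT_comp (mf mB) measurable_fst).
have m1 := measurable_Rintegral_family mf2 mA.
exact: (measurable_Rintegral_family mf m1).
Qed.

Lemma collision_mean_integrable K phi s t : lipv K phi ->
  mu.-integrable `[s, t] (EFin \o (fun u => mean (f u) phi)).
Proof.
move=> phiK; apply: measurable_bounded_integrable => //.
- by rewrite /= lebesgue_measure_itv/=; case: ifP => // _; rewrite -EFinB ltry.
- by apply: measurable_funTS; exact: collision_mean_measurable phiK.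
exists (2 * pi * K * k1 * (D * D)); split; first by rewrite num_real.
move=> B BM u _ /=; rewrite (le_trans _ (ltW BM))//.
exact: (collision_mean_le hgamma mb b_ge0 hG hI phiK (fD u)).
Qed.

Lemma increment K phi s t : lipv K phi -> (exists B, forall x, `|phi x| <= B) -> 0 <= s -> s <= t ->
  \int[f t]_v phi v = \int[f s]_v phi v + \int[mu]_(u in `]s, t]) mean (f u) phi.
Proof.
move=> phiK bnd s0 st; rewrite (fw phiK bnd (le_trans s0 st)) (fw phiK bnd s0) -addrA; congr (_ + _).
have := @Rintegral_itvB R (fun u => mean (f u) phi) (BLeft 0) (BRight t) s
  (collision_mean_integrable 0 t phiK).
rewrite !bnd_simp => /(_ s0 st) <-; by rewrite addrC subrK.
Qed.

Lemma increment_le K phi s t : lipv K phi -> (exists B, forall x, `|phi x| <= B) -> 0 <= s -> s <= t ->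
  `|\int[f t]_v phi v - \int[f s]_v phi v| <= 2 * pi * K * k1 * (D * D) * (t - s).
Proof.
move=> phiK bnd s0 st; rewrite (increment phiK bnd s0 st) addrC addKr.
have i1 : mu.-integrable `]s, t] (EFin \o (fun u => mean (f u) phi)).
  apply: integrableS (collision_mean_integrable s t phiK) => //.
  by apply: subset_itvr; rewrite bnd_simp.
apply: (le_trans (le_normr_Rintegral _ i1)) => //.
have -> : 2 * pi * K * k1 * (D * D) * (t - s) = \int[mu]_(u in `]s, t]) (2 * pi * K * k1 * (D * D)).
  rewrite Rintegral_cst//= lebesgue_measure_itv/= lte_fin; case: ltP => st'; first by [].
  by rewrite (_ : t = s) ?subrr//; apply/eqP; rewrite eq_le st st'.
apply: le_Rintegral => //; first exact: integrable_norm i1.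
  apply: measurable_bounded_integrable => //.
    by rewrite /= lebesgue_measure_itv/=; case: ifP => // _; rewrite -EFinB ltry.
  exists (`|2 * pi * K * k1 * (D * D)|); split; first by rewrite num_real.
  by move=> B BM u _ /=; rewrite ltW.
move=> u _; exact: (collision_mean_le hgamma mb b_ge0 hG hI phiK (fD u)).
Qed.

End single.
End evolution.

Lemma tail_rate_small (R : realType) (nu Cd e : R) : 0 < nu < 1 -> 0 <= Cd -> 0 < e ->
  exists N, 0 < N /\ tail_rate nu Cd N <= e.
Proof.
move=> /andP[n0 n1] C0 e0; have s0 : 0 < nu^-1 - 1 by rewrite subr_gt0 invf_gt1.
pose c := 2 * pi * Cd / (nu^-1 - 1) + 1.
have c0 : 0 < c by rewrite ltr_wpDl// divr_ge0 ?(ltW s0)// !mulr_ge0 ?pi_ge0.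
have ec : 0 < e / c by rewrite divr_gt0.
exists ((e / c) `^ (- (nu^-1 - 1)^-1)); split; first by rewrite powR_gt0.
rewrite /tail_rate -powRrM (_ : - (nu^-1 - 1)^-1 * (1 - nu^-1) = 1); last first.
  by rewrite -(opprB nu^-1 1) mulrNN mulVf// gt_eqF.
rewrite powRr1 ?(ltW ec)//.
rewrite (_ : _ * _ = (2 * pi * Cd / (nu^-1 - 1)) * (e / c)); last by ring.
rewrite mulrA ler_pdivrMr// mulrC ler_pM2l//.
by rewrite /c lerDl.
Qed.

(** * A Gronwall inequality for the truncated cost *)

Section stability.
Context {R : realType} (gamma nu : R) (beta G : R -> R) (Cr Cd k1 : R) (I : vec R -> vec R).
Hypotheses (hgamma : -1 < gamma < 0) (nu01 : 0 < nu < 1) (hgn : 0 < gamma + nu)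
  (mb : measurable_fun `](0 : R), pi] beta) (b_ge0 : {in `](0 : R), pi], forall t, 0 <= beta t})
  (hG : inverse_angle nu beta G Cr Cd k1) (hI : orthogonal_selection I).
Local Notation V := (vec R).
Local Notation R' := (measurableTypeR R).
Local Notation mean := (collision_mean gamma beta I).
Local Notation mu := (@lebesgue_measure R).
Variables (f g : R -> probability V R) (D : R).
Hypotheses (mf : forall B, measurable B -> measurable_fun setT (fun t : R' => f t B))
  (mg : forall B, measurable B -> measurable_fun setT (fun t : R' => g t B))
  (fD : forall t, (\int[f t]_v (1 + enorm v)%:E <= D%:E)%E)
  (gD : forall t, (\int[g t]_v (1 + enorm v)%:E <= D%:E)%E)
  (fw : forall K phi, lipv K phi -> (exists B, forall x, `|phi x| <= B) -> forall t : R, 0 <= t ->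
     \int[f t]_v phi v = \int[f 0]_v phi v + \int[mu]_(s in `[0, t]) mean (f s) phi)
  (gw : forall K phi, lipv K phi -> (exists B, forall x, `|phi x| <= B) -> forall t : R, 0 <= t ->
     \int[g t]_v phi v = \int[g 0]_v phi v + \int[mu]_(s in `[0, t]) mean (g s) phi).
Variable M : R.
Hypothesis M1 : 1 <= M.

Let k10 : 0 <= k1. Proof. by case: hG => -[]. Qed.
Let M0 : 0 < M. Proof. exact: lt_le_trans M1. Qed.

Let W t := Wc M (f t) (g t).
(** The speed at which the mean of a 12 * M-Lipschitz function can vary. It grows with M, so the
    time mesh is refined at fixed M. *)
Let L := 2 * pi * (12 * M) * k1 * (D * D).
Let L0 : 0 <= L. Proof. by apply: mulr_ge0; [rewrite !mulr_ge0 ?pi_ge0 ?(ltW M0)|rewrite -expr2 sqr_ge0]. Qed.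

Let bnd1 (phi psi : V -> R) : (exists B, forall x, `|phi x| <= B /\ `|psi x| <= B) -> exists B, forall x, `|phi x| <= B.
Proof. by move=> [B h]; exists B => x; have [] := h x. Qed.
Let bnd2 (phi psi : V -> R) : (exists B, forall x, `|phi x| <= B /\ `|psi x| <= B) -> exists B, forall x, `|psi x| <= B.
Proof. by move=> [B h]; exists B => x; have [] := h x. Qed.

Let pot_le phi psi s t : lipv (12 * M) phi -> lipv (12 * M) psi ->
  (exists B, forall x, `|phi x| <= B /\ `|psi x| <= B) -> 0 <= s -> s <= t ->
  `|(\int[f t]_v phi v + \int[g t]_v psi v) - (\int[f s]_v phi v + \int[g s]_v psi v)| <= 2 * L * (t - s).
Proof.
move=> phiK psiK B s0 st.
have h1 := increment_le hgamma mb b_ge0 hG hI mf fD fw phiK (bnd1 B) s0 st.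
have h2 := increment_le hgamma mb b_ge0 hG hI mg gD gw psiK (bnd2 B) s0 st.
rewrite opprD addrACA; apply: (le_trans (ler_normD _ _)); apply: (le_trans (lerD h1 h2)).
by rewrite -/L; move: L => l; rewrite le_eqVlt; apply/orP; left; apply/eqP; ring.
Qed.

(* The potentials are tested at the other time: their means vary at a bounded rate. *)
Lemma Wc_dist s t : 0 <= s -> s <= t -> `|W t - W s| <= 2 * L * (t - s).
Proof.
move=> s0 st.
have aux r u : (forall phi psi, lipv (12 * M) phi -> lipv (12 * M) psi ->
    (exists B, forall x, `|phi x| <= B /\ `|psi x| <= B) ->
    `|(\int[f r]_v phi v + \int[g r]_v psi v) - (\int[f u]_v phi v + \int[g u]_v psi v)| <= 2 * L * (t - s)) ->
    W r - W u <= 2 * L * (t - s).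
  move=> H; apply/ler_addgt0Pr => e e0.
  have [P [phi [psi [_ [phiK psiK] B pp [_ h]]]]] := Wc_dual (f r) (g r) M1 e0.
  have h1 := weak_duality (f u) (g u) M1 phiK psiK B pp.
  have := H _ _ phiK psiK B; rewrite ler_norml => /andP[_].
  rewrite /W; move: h h1; move: (\int[f r]_x _ + _) (\int[f u]_x _ + _) (Wc _ _ _) (Wc _ _ _) (2 * L * _).
  by move=> a b c d l; lra.
have h1 : W t - W s <= 2 * L * (t - s) by apply: aux => phi psi h1 h2 B; exact: pot_le.
have h2 : W s - W t <= 2 * L * (t - s) by apply: aux => phi psi h2 h3 B; rewrite distrC; exact: pot_le.
by rewrite ler_norml h1 andbT lerNl opprB.
Qed.

Variables S T : R -> R.
Hypotheses (S0 : forall u, 0 <= S u) (T0 : forall u, 0 <= T u)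
  (iS : forall t, mu.-integrable `[0, t] (EFin \o S)) (iT : forall t, mu.-integrable `[0, t] (EFin \o T))
  (iST : forall t, mu.-integrable `[0, t] (EFin \o (S \* T)))
  (good : forall t, {ae mu, forall u, u \in `[0, t] ->
     (forall v, (\int[f u]_w (enorm (v - w) `^ gamma)%:E <= (S u)%:E)%E) /\ forall v, f u [set v] = 0%E})
  (hT : forall u, (\int[f u]_v (tail2 M v)%:E + \int[g u]_v (tail2 M v)%:E <= (T u)%:E)%E).

Local Notation r := (rate Cr k1).
Local Notation q N := (96 * M * tail_rate nu Cd N * (D * D)).
(** The growth rate; the 2 counts the squared distances at (v, w) and at (v', w'). The function [b]
    below collects the truncation errors, which are proportional to the tails T. *)
Let a u := 2 * r * S u.
Let b u := 8 * r * (S u * T u) + 2 * far_rate k1 * D * T u.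

Let sub_itv s t : 0 <= s -> ([set` `]s, t]] : set R') `<=` [set` `[0, t]].
Proof. by move=> s0 u /=; rewrite !in_itv/= => /andP[h1 ->]; rewrite andbT (le_trans s0)// ltW. Qed.

Let intS (F : R -> R) s t : 0 <= s -> mu.-integrable `[0, t] (EFin \o F) -> mu.-integrable `]s, t] (EFin \o F).
Proof. by move=> s0; apply: integrableS => //; exact: sub_itv. Qed.

Let mcl (t : R) : measurable ([set` `[0, t]] : set R'). Proof. exact: measurable_itv. Qed.
Let moc (s t : R) : measurable ([set` `]s, t]] : set R'). Proof. exact: measurable_itv. Qed.

Let ia t : mu.-integrable `[0, t] (EFin \o a).
Proof.
have := integrableZl (mcl t) (2 * r) (iS t).
by apply: eq_integrable => // u _ /=.
Qed.

Let ib t : mu.-integrable `[0, t] (EFin \o b).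
Proof.
have h1 := integrableZl (mcl t) (8 * r) (iST t).
have h2 := integrableZl (mcl t) (2 * far_rate k1 * D) (iT t).
have := integrableD (mcl t) h1 h2.
by apply: eq_integrable => // u _ /=.
Qed.

Let icst (c s t : R) : mu.-integrable `]s, t] (EFin \o (fun=> c)).
Proof.
apply: measurable_bounded_integrable => //.
  by rewrite /= lebesgue_measure_itv/=; case: ifP => // _; rewrite -EFinB ltry.
exists `|c|; split; first by rewrite num_real.
by move=> B BM u _ /=; rewrite ltW.
Qed.

Let Rint_cst (c s t : R) : s <= t -> \int[mu]_(u in `]s, t]) c = c * (t - s).
Proof.
move=> st; rewrite Rintegral_cst//= lebesgue_measure_itv/= lte_fin; case: ltP => st'; first by [].
by rewrite (_ : t = s) ?subrr//; apply/eqP; rewrite eq_le st st'.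
Qed.

Let pot_gap (wt e i j l1 l2 : R) : wt - e <= i -> i - j <= l2 -> l2 <= l1 -> wt - e - l1 <= j.
Proof. lra. Qed.

(** The arithmetic of one time u: x and y are the primal and dual values at u, w the optimal cost
    there, ws and wt those at the endpoints, l the variation over the interval and e the optimality
    defect. The gap x - y is at most 2 * e + 2 * l. *)
Let one_step_pointwise (r1 f1 w wt ws l e x y s1 t1 n q1 d : R) :
  0 <= r1 -> 0 <= s1 -> 0 <= n ->
  x <= w + e -> w <= ws + l -> w <= wt + l -> wt - e - l <= y ->
  r1 * (2 * s1 * (x + 4 * t1)) + n * (x - y) + q1 + f1 * (t1 * (2 * d)) <=
  (ws + l + e) * (2 * r1 * s1) + (8 * r1 * (s1 * t1) + 2 * f1 * d * t1) + (n * (2 * e + 2 * l) + q1).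
Proof.
move=> r0 s0 n0 h1 h2 h3 h4.
have i1 : (r1 * s1) * x <= (r1 * s1) * (ws + l + e).
  by apply: ler_wpM2l; [exact: mulr_ge0|lra].
have i2 : n * (x - y) <= n * (2 * e + 2 * l) by apply: ler_wpM2l => //; lra.
rewrite (_ : r1 * (2 * s1 * (x + 4 * t1)) = 2 * (r1 * s1 * x) + 8 * r1 * (s1 * t1)); last by ring.
rewrite (_ : (ws + l + e) * (2 * r1 * s1) = 2 * (r1 * s1 * (ws + l + e))); last by ring.
rewrite (_ : f1 * (t1 * (2 * d)) = 2 * f1 * d * t1); last by ring.
move: i1 i2; move: (r1 * s1 * x) (r1 * s1 * _) (n * (x - y)) (n * _) (2 * f1 * d * t1) (8 * r1 * _).
by move=> *; lra.
Qed.

(** The potentials are nearly optimal at time t and stay fixed on the interval. At each u a nearly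
    optimal plan serves to bound the collision terms by an expression that no longer involves it,
    and this bound is integrated over the interval. *)
Lemma one_step N s t : 0 < N -> 0 <= s -> s <= t ->
  W t <= W s + (W s + 2 * L * (t - s)) * \int[mu]_(u in `]s, t]) a u + \int[mu]_(u in `]s, t]) b u +
    (t - s) * (8 * pi * N * L * (t - s) + q N).
Proof.
move=> N0 s0 st; set h := t - s.
have h0 : 0 <= h by rewrite subr_ge0.
have r0 := rate_ge0 hG.
have a0 : 0 <= \int[mu]_(u in `]s, t]) a u.
  by apply: Rintegral_ge0 => u _; apply: mulr_ge0 => //; apply: mulr_ge0.
(* The coefficient of the optimality defect e: it enters through the cost multiplying a u, through
   the dual value at time t, and through the gap, at the rate 4 * pi * N. *)
pose c := \int[mu]_(u in `]s, t]) a u + 1 + h * (4 * pi * N).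
have c0 : 0 <= c by rewrite /c !addr_ge0 ?mulr_ge0 ?pi_ge0// ltW.
apply: (@le_addgt0Mr _ _ _ c c0) => e e0.
have [P [phi [psi [_ [phiK psiK] B pp [_ hopt]]]]] := Wc_dual (f t) (g t) M1 e0.
have inc1 := increment hgamma mb b_ge0 hG hI mf fD fw phiK (bnd1 B) s0 st.
have inc2 := increment hgamma mb b_ge0 hG hI mg gD gw psiK (bnd2 B) s0 st.
have wd := weak_duality (f s) (g s) M1 phiK psiK B pp.
have i1 := intS s0 (collision_mean_integrable hgamma mb b_ge0 hG hI mf fD 0 t phiK).
have i2 := intS s0 (collision_mean_integrable hgamma mb b_ge0 hG hI mg gD 0 t psiK).
pose C1 := W s + 2 * L * h + e.
pose C2 := N * (2 * pi) * (2 * e + 2 * (2 * L * h)) + q N.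
have key : \int[mu]_(u in `]s, t]) (mean (f u) phi + mean (g u) psi) <=
    \int[mu]_(u in `]s, t]) (C1 * a u + b u + C2).
  have ica : mu.-integrable `]s, t] (EFin \o (fun u => C1 * a u)).
    have := integrableZl (moc s t) C1 (intS s0 (ia t)).
    by apply: eq_integrable => // u _ /=.
  apply: ae_le_Rintegral => //.
  - exact: (integrableD (moc s t) i1 i2).
  - have j1 := integrableD (moc s t) ica (intS s0 (ib t)).
    exact: (integrableD (moc s t) j1 (icst C2 s t)).
  apply: (@filterS _ _ (ae_filter_ringOfSetsType mu) _ _ _ (good t)) => u gu /= ust.
  have /gu[uS uat] : u \in `[0, t] by exact: (sub_itv s0 ust).
  move: ust; rewrite /= in_itv/= => /andP[su ut].
  have u0 : 0 <= u by rewrite (le_trans s0)// ltW.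
  (* Only the plan at time u is kept; its own potentials are dropped. *)
  have [P' [_ [_ [cP' _ _ _ [hP' _]]]]] := Wc_dual (f u) (g u) M1 e0.
  apply: (le_trans (collision_coupling_le hgamma nu01 hgn mb b_ge0 hG hI cP' (fD u) (gD u)
    phiK psiK M1 N0 erefl pp B uS uat (hT u))).
  have ll : 2 * L * (t - u) <= 2 * L * h by apply: ler_wpM2l; [rewrite mulr_ge0|rewrite lerD2l lerN2 ltW].
  have ls : 2 * L * (u - s) <= 2 * L * h by apply: ler_wpM2l; [rewrite mulr_ge0|rewrite lerD2r].
  have := pot_le phiK psiK B u0 ut; rewrite ler_norml => /andP[_ d1].
  have := Wc_dist u0 ut; rewrite ler_norml => /andP[d2 _].
  have := Wc_dist s0 (ltW su); rewrite ler_norml => /andP[_ d3].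
  have -> : 24 * M * tail_rate nu Cd N * (2 * D * (2 * D)) = q N by ring.
  rewrite (mulrA N (2 * pi)) -(addrA (\int[P']_z _)) -opprD.
  apply: (@one_step_pointwise r (far_rate k1) (W u) (W t) (W s) (2 * L * h) e _ _ (S u) (T u)) => //.
  - by rewrite !mulr_ge0 ?pi_ge0// ltW.
  - by rewrite -lerBlDl; exact: le_trans d3 ls.
  - by rewrite -lerBlDl -opprB; apply: le_trans ll; rewrite lerNl.
  - exact: (pot_gap hopt d1 ll).
have ica : mu.-integrable `]s, t] (EFin \o (fun u => C1 * a u)).
  have := integrableZl (moc s t) C1 (intS s0 (ia t)).
  by apply: eq_integrable => // u _ /=.
have j1 : mu.-integrable `]s, t] (EFin \o (fun u => C1 * a u + b u)).
  exact: (integrableD (moc s t) ica (intS s0 (ib t))).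
rewrite (RintegralD (moc s t) i1 i2) (RintegralD (moc s t) j1 (icst C2 s t)) in key.
rewrite (RintegralD (moc s t) ica (intS s0 (ib t))) (RintegralZl C1 (moc s t) (intS s0 (ia t))) in key.
rewrite Rint_cst// -/h in key.
move: hopt key; rewrite inc1 inc2 -/(W t).
move: wd; rewrite -/(W s) /c /C1 /C2.
move: (\int[mu]_(u in _) a u) (\int[mu]_(u in _) b u) (\int[mu]_(u in _) mean (f u) phi) (\int[mu]_(u in _) mean (g u) psi).
move: (\int[f s]_v _) (\int[g s]_v _) (W t) (W s) (q N) L => f1 g1 wt ws qN l al be m1 m2 h1 h2 h3.
have -> : ws + (ws + 2 * l * h) * al + be + h * (8 * pi * N * l * h + qN) + (al + 1 + h * (4 * pi * N)) * e =
  ws + ((ws + 2 * l * h + e) * al + be + (N * (2 * pi) * (2 * e + 2 * (2 * l * h)) + qN) * h) + e by ring.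
by move: h1 h2 h3; move: ((_ + _ + e) * al + be + _) => X; lra.
Qed.

Let al s := \int[mu]_(u in `]0, s]) a u.
Let be s := \int[mu]_(u in `]0, s]) b u.

Let a_ge0 u : 0 <= a u.
Proof. by apply: mulr_ge0 => //; apply: mulr_ge0 => //; exact: (rate_ge0 hG). Qed.

Let D0 : 0 <= D.
Proof.
rewrite -lee_fin; apply: le_trans (fD 0); apply: integral_ge0 => v _.
by rewrite lee_fin addr_ge0 ?enorm_ge0.
Qed.

Let b_ge0' u : 0 <= b u.
Proof.
apply: addr_ge0; first by apply: mulr_ge0; [apply: mulr_ge0 => //; exact: (rate_ge0 hG)|exact: mulr_ge0].
by apply: mulr_ge0 => //; apply: mulr_ge0 => //; apply: mulr_ge0 => //; exact: (far_rate_ge0 hG).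
Qed.

Let split_int (F : R -> R) s t : (forall t, mu.-integrable `[0, t] (EFin \o F)) -> 0 <= s -> s <= t ->
  \int[mu]_(u in `]s, t]) F u = \int[mu]_(u in `]0, t]) F u - \int[mu]_(u in `]0, s]) F u.
Proof.
move=> iF s0 st.
have := @Rintegral_itvB R F (BRight 0) (BRight t) s (intS (lexx 0) (iF t)).
by rewrite !bnd_simp => /(_ s0 st) <-.
Qed.

Let qN_ge0 N : 0 <= q N.
Proof.
apply: mulr_ge0; last exact: mulr_ge0.
by apply: mulr_ge0; [rewrite mulr_ge0 ?(ltW M0)|exact: (tail_rate_ge0 nu01 hG)].
Qed.

(** From 1 + A1 <= exp A1. The additive errors are multiplied by the whole exponential, which is at
    least 1, so that they simply add up over the steps. *)
Let gronwall_step (Y w w' A1 a0 B1 l h rho : R) : 0 <= Y -> 0 <= A1 -> 0 <= a0 -> 0 <= B1 -> 0 <= l ->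
  0 <= h -> 0 <= rho -> w <= Y * expR a0 -> w' <= w + (w + l) * A1 + B1 + h * rho ->
  w' <= (Y + (l * A1 + B1 + h * rho)) * expR (a0 + A1).
Proof.
move=> Y0 A0 a00 B0 l0 h0 rho0 wY ww; apply: (le_trans ww).
have -> : w + (w + l) * A1 + B1 + h * rho = w * (1 + A1) + (l * A1 + B1 + h * rho) by ring.
rewrite mulrDl; apply: lerD.
  apply: (@le_trans _ _ (Y * expR a0 * (1 + A1))); first by rewrite ler_wpM2r// addr_ge0.
  by rewrite expRD mulrA ler_wpM2l ?mulr_ge0 ?expR_ge0// expR_ge1Dx.
by rewrite ler_peMr ?addr_ge0 ?mulr_ge0// -expR0 ler_expR addr_ge0.
Qed.

Let discrete_gronwall N h n : 0 < N -> 0 <= h ->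
  W (n%:R * h) <= (W 0 + (2 * L * h * al (n%:R * h) + be (n%:R * h) + n%:R * h * (8 * pi * N * L * h + q N)))
    * expR (al (n%:R * h)).
Proof.
move=> N0 h0.
have al00 : al 0 = 0 by rewrite /al set_itvoc0 Rintegral_set0.
have be00 : be 0 = 0 by rewrite /be set_itvoc0 Rintegral_set0.
have rho0 : 0 <= 8 * pi * N * L * h + q N.
  apply: addr_ge0 => //; apply: mulr_ge0 => //; apply: mulr_ge0 => //.
  by rewrite !mulr_ge0 ?pi_ge0// ltW.
elim: n => [|n IH].
  by rewrite !mul0r al00 be00 !mulr0 !addr0 expR0 mulr1.
have s0 : 0 <= n%:R * h by rewrite mulr_ge0.
have st : n%:R * h <= n.+1%:R * h by rewrite ler_wpM2r// ler_nat.
have hE : n.+1%:R * h - n%:R * h = h by rewrite -mulrBl -natrB// subSnn mul1r.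
have := one_step N0 s0 st; rewrite hE (split_int ia s0 st) (split_int ib s0 st) -!/(al _) -!/(be _) => H.
have A0 : 0 <= al (n.+1%:R * h) - al (n%:R * h).
  by rewrite /al -(split_int ia s0 st); apply: Rintegral_ge0.
have B0 : 0 <= be (n.+1%:R * h) - be (n%:R * h).
  by rewrite /be -(split_int ib s0 st); apply: Rintegral_ge0.
have aln0 : 0 <= al (n%:R * h) by apply: Rintegral_ge0.
have ben0 : 0 <= be (n%:R * h) by apply: Rintegral_ge0.
have l0 : 0 <= 2 * L * h by apply: mulr_ge0 => //; exact: mulr_ge0.
have Y0 : 0 <= W 0 + (2 * L * h * al (n%:R * h) + be (n%:R * h) + n%:R * h * (8 * pi * N * L * h + q N)).
  apply: addr_ge0; first exact: Wc_ge0.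
  by apply: addr_ge0; [apply: addr_ge0 => //; exact: mulr_ge0|exact: mulr_ge0].
have := gronwall_step Y0 A0 aln0 B0 l0 h0 rho0 IH H.
rewrite [al _ + (_ - _)]addrC subrK => H1; apply: (le_trans H1).
rewrite ler_wpM2r ?expR_ge0// le_eqVlt; apply/orP; left; apply/eqP.
have -> : n.+1%:R * h = n%:R * h + h by rewrite -natr1 mulrDl mul1r.
by move: (W 0) (al _) (al _) (be _) (be _) (8 * _ * _ * _ * _ + _) (2 * L * h) => w x y z v u l; ring.
Qed.

Let final_identity (w l s k x y e N t : R) :
  (w + (2 * l * (t * k) * x + y + t * (8 * pi * N * l * (t * k) + s))) * e =
  (w + y) * e + t * s * e + (2 * l * t * x + t * (8 * pi * N * l * t)) * e * k.
Proof. ring. Qed.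

(* Euler scheme: the uniform mesh h tends to 0 first, then the cutoff N tends to +oo. *)
Lemma Wc_gronwall t : 0 <= t -> W t <= (W 0 + \int[mu]_(u in `]0, t]) b u) * expR (\int[mu]_(u in `]0, t]) a u).
Proof.
move=> t0; rewrite -/(al t) -/(be t).
pose E := expR (al t); have E0 : 0 <= E := expR_ge0 _.
have alt0 : 0 <= al t by apply: Rintegral_ge0.
pose c := t * (96 * M * (D * D)) * E.
have c0 : 0 <= c.
  by apply: mulr_ge0 => //; apply: mulr_ge0 => //; rewrite !mulr_ge0// ltW.
have Cd0 : 0 <= Cd by case: hG => -[].
apply: (@le_addgt0Mr _ _ _ c c0) => e e0.
have [N [N0 Ne]] := tail_rate_small nu01 Cd0 e0.
(* The coefficient of 1 / n once the mesh is t / n and N is fixed. *)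
pose c' := (2 * L * t * al t + t * (8 * pi * N * L * t)) * E.
have c'0 : 0 <= c'.
  rewrite /c'; apply: mulr_ge0 => //; apply: addr_ge0.
    by apply: mulr_ge0 => //; apply: mulr_ge0 => //; exact: mulr_ge0.
  apply: mulr_ge0 => //; apply: mulr_ge0 => //; apply: mulr_ge0 => //.
  by rewrite !mulr_ge0 ?pi_ge0// ltW.
apply: (@le_addgt0Mr _ _ _ c' c'0) => d d0.
pose n := (Num.truncn d^-1).+1.
have n0 : 0 < n%:R :> R by rewrite ltr0n.
have nd : n%:R^-1 <= d.
  rewrite -[leRHS]invrK lef_pV2 ?posrE ?invr_gt0//; apply/ltW; exact: truncnS_gt.
have nt : n%:R * (t / n%:R) = t by rewrite mulrCA divff ?mulr1// gt_eqF.
have := @discrete_gronwall N (t / n%:R) n N0 (divr_ge0 t0 (ltW n0)).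
rewrite nt -/E => H; apply: (le_trans H).
have h1 : t * q N * E <= c * e.
  rewrite /c (_ : t * q N * E = (t * (96 * M * (D * D)) * E) * tail_rate nu Cd N); last by ring.
  by apply: ler_wpM2l.
have h2 : c' * n%:R^-1 <= c' * d by apply: ler_wpM2l.
apply: (@le_trans _ _ ((W 0 + be t) * E + t * q N * E + c' * n%:R^-1)).
  by rewrite le_eqVlt; apply/orP; left; apply/eqP; exact: final_identity.
by apply: lerD => //; apply: lerD.
Qed.

End stability.

(** * From the truncated cost to the Wasserstein distance *)

Section separation.
Context {R : realType}.
Local Notation V := (vec R).
Local Notation R' := (measurableTypeR R).

Let ramp (t : R) : R := Num.min 1 (Num.max 0 t).

Let ramp01 t : 0 <= ramp t <= 1.
Proof. by rewrite /ramp le_min ge_min lexx ler01/= le_max lexx. Qed.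

Let ramp_lip s t : `|ramp s - ramp t| <= `|s - t|.
Proof.
wlog st : s t / s <= t.
  move=> H; have [|/ltW] := leP s t; first exact: H.
  by move=> ts; rewrite -(opprB t s) normrN -(opprB (ramp t)) normrN; exact: H.
rewrite -(opprB t s) normrN (@ger0_norm _ (t - s)) ?subr_ge0// ler_norml /ramp.
have m10 : Num.min 1 0 = 0 :> R by rewrite min_r.
case: (leP 0 s) => h1; case: (leP 0 t) => h2; rewrite ?m10; case: (leP 1 s) => h3; case: (leP 1 t) => h4;
  apply/andP; split; lra.
Qed.

Let coord (i : nat) (x : V) : R := if i is 0 then x.1.1 else if i is 1%N then x.1.2 else x.2.

Let coord_lip i x y : `|coord i x - coord i y| <= enorm (x - y).
Proof. by have [h1 h2 h3] := norm_coord (x - y); case: i => [|[|i]]. Qed.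

Let unit_lip (phi : V -> R) := (exists K, lipv K phi) /\ forall x, 0 <= phi x <= 1.

Let unit_lipM phi psi : unit_lip phi -> unit_lip psi -> unit_lip (fun x => phi x * psi x).
Proof.
move=> [[K1 L1] b1] [[K2 L2] b2]; split.
  exists (K1 + K2) => v w.
  have -> : phi v * psi v - phi w * psi w = (phi v - phi w) * psi v + phi w * (psi v - psi w) by ring.
  rewrite [leRHS]mulrDl; apply: (le_trans (ler_normD _ _)); apply: lerD; rewrite normrM.
    apply: le_trans (L1 v w); rewrite ler_piMr//.
    by have /andP[h0 h1] := b2 v; rewrite ger0_norm.
  apply: le_trans (L2 v w); rewrite ler_piMl//.
  by have /andP[h0 h1] := b1 w; rewrite ger0_norm.
by move=> x; have /andP[h0 h1] := b1 x; have /andP[h2 h3] := b2 x; rewrite mulr_ge0//= mulr_ile1.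
Qed.

Let unit_lip_ramp i (a : R) n : unit_lip (fun x => ramp (n%:R * (coord i x - a))).
Proof.
split; last by move=> x; exact: ramp01.
exists n%:R => v w; apply: (le_trans (ramp_lip _ _)).
rewrite -mulrBr opprB addrA subrK normrM ger0_norm//.
by rewrite ler_wpM2l.
Qed.

Let orthant (a b c : R) : set V := [set x | [/\ a < x.1.1, b < x.1.2 & c < x.2]].
Let Gset : set (set V) := [set A | exists a b c, A = orthant a b c].

(** The open orthants are stable under intersection. The coordinates are measurable for the
    sigma-algebra they generate, since a half-space is a countable union of orthants; hence so is
    the identity into the product sigma-algebra. *)
Let Gset_measurable : @measurable _ V = <<s Gset >>.
Proof.
apply/seteqP; split.
  move=> A mA.
  pose T := g_sigma_algebraType Gset.
  have mo a b c : @measurable _ T (orthant a b c).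
    by apply: sub_sigma_algebra; exists a, b, c.
  have mcoord i : measurable_fun setT (coord i : T -> R').
    move=> mT; apply: (measurability _ (RGenOInfty.measurableE R)) => // _ [_ [a ->] <-].
    rewrite setTI.
    have -> : coord i @^-1` `]a, +oo[ = \bigcup_n orthant (if i is 0 then a else - n%:R)
      (if i is 1%N then a else - n%:R) (if i is n'.+2 then a else - n%:R).
      apply/seteqP; split => x /=.
        rewrite in_itv/= andbT => ax.
        pose n := (Num.truncn (enorm x)).+1.
        have xn : enorm x < n%:R by exact: truncnS_gt.
        have [h1 h2 h3] := norm_coord x.
        have aux (t : R) : `|t| <= enorm x -> - n%:R < t.
          by move=> h; have := le_lt_trans h xn; rewrite ltr_norml => /andP[].
        exists n => //; case: i ax => [|[|i]] /= ax; split => //; exact: aux.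
      by move=> [n _]; case: i => [|[|i]] /= [h1 h2 h3]; rewrite in_itv/= andbT.
    by apply: bigcup_measurable => n _; exact: mo.
  have mid : measurable_fun setT (id : T -> V).
    apply: measurable_vec.
    - exact: (mcoord 0%N).
    - exact: (mcoord 1%N).
    - exact: (mcoord 2%N).
  by have := mid measurableT A mA; rewrite setTI.
apply: smallest_sub; first exact: sigma_algebra_measurable.
move=> _ [a [b [c ->]]].
have mray (t : R) : measurable ([set x | t < x] : set R').
  rewrite (_ : [set x | t < x] = [set` `]t, +oo[]); first exact: measurable_itv.
  by apply/seteqP; split => x /=; rewrite in_itv/= andbT.
have -> : orthant a b c = ([set x | a < x] `*` [set x | b < x]) `*` [set x | c < x].
  by apply/seteqP; split => x /=; [move=> []|move=> [[]]].
by apply: measurableX => //; exact: measurableX.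
Qed.

(** The indicator of an open orthant is the pointwise limit of products of three ramps, which are
    Lipschitz with values in [0, 1]; the orthants form a generating pi-system. *)
Lemma lipschitz_separates (f g : probability V R) :
  (forall K phi, lipv K phi -> (forall x, 0 <= phi x <= 1) -> \int[f]_x phi x = \int[g]_x phi x) ->
  same_measure f g.
Proof.
move=> H; have orth a b c : f (orthant a b c) = g (orthant a b c).
  pose phi n x := ramp (n%:R * (coord 0 x - a)) * (ramp (n%:R * (coord 1 x - b)) * ramp (n%:R * (coord 2 x - c))).
  have uphi n : unit_lip (phi n).
    by apply: unit_lipM; [|apply: unit_lipM]; exact: unit_lip_ramp.
  have mo : measurable (orthant a b c).
    by rewrite Gset_measurable; apply: sub_sigma_algebra; exists a, b, c.
  have mphi n : measurable_fun setT (fun x => (phi n x)%:E).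
    by have [[K L] _] := uphi n; apply/measurable_EFinP; exact: lipv_measurable L.
  have ramp_cvg (t : R) : ramp (n%:R * t) @[n --> \oo] --> ((0 < t)%R%:R : R).
    have [t0|t0] := ltP 0 t.
      apply: cvg_near_cst; near=> n.
      rewrite /ramp min_l// le_max; apply/orP; right.
      rewrite -ler_pdivrMr// div1r; near: n.
      exists (Num.truncn t^-1).+1 => // n /= hn; apply/ltW.
      by apply: lt_le_trans (truncnS_gt _) _; rewrite ler_nat.
    rewrite (_ : (fun n => _) = fun=> 0); first exact: cvg_cst.
    apply/funext => n; rewrite /ramp max_l ?min_r//.
    by rewrite mulr_ge0_le0.
  have cphi (k : probability V R) : (\int[k]_x (phi n x)%:E @[n --> \oo] --> k (orthant a b c))%E.
    have mi : measurable_fun setT (fun x => (\1_(orthant a b c) x)%:E : \bar R).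
      by apply/measurable_EFinP; exact: measurable_indic.
    have cv : {ae k, forall x, setT x -> ((phi n x)%:E @[n --> \oo] --> (\1_(orthant a b c) x)%:E)%E}.
      apply: aeW => x _; apply/fine_cvgP; split; first by near=> n.
      rewrite (_ : \1__ x = (0 < coord 0 x - a)%R%:R * ((0 < coord 1 x - b)%R%:R * (0 < coord 2 x - c)%R%:R)).
        by apply: cvgM; [|apply: cvgM]; exact: ramp_cvg.
      have -> : \1_(orthant a b c) x = [&& a < coord 0 x, b < coord 1 x & c < coord 2 x]%:R :> R.
        by rewrite indicE; congr (nat_of_bool _)%:R; apply/idP/and3P; rewrite inE.
      rewrite !subr_gt0; case: (a < _); case: (b < _); case: (c < _);
        by rewrite /= ?mulr1 ?mulr0 ?mul0r.
    have i1 : k.-integrable setT (fun=> 1%E : \bar R) by exact: finite_measure_integrable_cst.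
    have bd : {ae k, forall x n, setT x -> (`|(phi n x)%:E| <= 1)%E}.
      apply: aeW => x n _; have [_ /(_ x) /andP[h0 h1]] := uphi n.
      by rewrite /= lee_fin ger0_norm.
    have [_ _] := dominated_convergence measurableT mphi mi cv i1 bd.
    by rewrite integral_indic// setIT.
  have E n : (\int[f]_x (phi n x)%:E = \int[g]_x (phi n x)%:E)%E.
    have [[K L] b01] := uphi n.
    have ib (k : probability V R) : k.-integrable setT (EFin \o phi n).
      apply: (@bounded_integrable _ _ _ k _ 1); first exact: lipv_measurable L.
      by move=> x; have /andP[h0 h1] := b01 x; rewrite ger0_norm.
    by rewrite -(ge0_Rintegral_EFin (ib f)) -(ge0_Rintegral_EFin (ib g)) (H _ _ L b01).
  have h1 := cphi f; rewrite (_ : (fun n => _) = (fun n => \int[g]_x (phi n x)%:E)%E) in h1; last exact/funext.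
  exact: (cvg_unique _ h1 (cphi g)).
move=> A mA; apply: (@measure_unique _ _ _ Gset (fun n => orthant (- n%:R) (- n%:R) (- n%:R)) Gset_measurable).
- move=> _ _ [a [b [c ->]]] [a' [b' [c' ->]]].
  exists (Num.max a a'), (Num.max b b'), (Num.max c c'); apply/seteqP; split => x /=.
    by move=> [[h1 h2 h3] [k1 k2 k3]]; split; rewrite gt_max ?h1 ?h2 ?h3.
  by rewrite /orthant/= !gt_max => -[/andP[? ?] /andP[? ?] /andP[? ?]].
- by move=> n; exists (- n%:R), (- n%:R), (- n%:R).
- apply/seteqP; split => // x _; pose n := (Num.truncn (enorm x)).+1.
  have xn : enorm x < n%:R by exact: truncnS_gt.
  have [h1 h2 h3] := norm_coord x; exists n => //; split;
    [have := le_lt_trans h1 xn|have := le_lt_trans h2 xn|have := le_lt_trans h3 xn]; by rewrite ltr_norml => /andP[].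
- by move=> _ [a [b [c ->]]]; exact: orth.
- move=> k; rewrite ltey_eq fin_num_measure//.
  by rewrite Gset_measurable; apply: sub_sigma_algebra; exists (- k%:R), (- k%:R), (- k%:R).
- exact: mA.
Unshelve. all: by end_near.
Qed.

End separation.

Section squared_distance.
Context {R : realType}.
Local Notation V := (vec R).
Local Notation R' := (measurableTypeR R).
Implicit Types (f g : probability V R).

Let msq : measurable_fun setT (fun z : V * V => (enorm (z.1 - z.2) ^+ 2)%:E).
Proof.
apply/measurable_EFinP; apply: measurable_funX; apply: measurable_enorm.
by apply: measurable_vecB; [exact: measurable_fst|exact: measurable_snd].
Qed.

Let mtc M : measurable_fun setT (fun z : V * V => tcost M z.1 z.2 : R').
Proof. by apply: measurable_tcost; [exact: measurable_fst|exact: measurable_snd]. Qed.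

Let itc M (P : probability (V * V)%type R) : 1 <= M -> P.-integrable setT (fun z => (tcost M z.1 z.2)%:E).
Proof.
move=> M1; have M0 : 0 <= M by exact: le_trans M1.
apply: (@bounded_integrable _ _ _ P _ (36 * M ^+ 2)) => [|z]; first exact: mtc.
by rewrite ger0_norm ?tcost_ge0// tcost_bound.
Qed.

Lemma W2_sq_ge0 f g : (0 <= W2_sq f g)%E.
Proof.
apply: le_ereal_inf_tmp => _ [P _ <-]; apply: integral_ge0 => z _.
by rewrite lee_fin sqr_ge0.
Qed.

Lemma Wc_le_W2_sq M f g : 1 <= M -> ((Wc M f g)%:E <= W2_sq f g)%E.
Proof.
move=> M1; apply: le_ereal_inf_tmp => _ [P cP <-].
apply: (@le_trans _ _ (\int[P]_z (tcost M z.1 z.2)%:E)%E).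
  by rewrite -ge0_Rintegral_EFin ?lee_fin; [exact: Wc_le|exact: itc].
apply: ge0_le_integral => //.
- by move=> z _; rewrite lee_fin tcost_ge0.
- by apply/measurable_EFinP; exact: mtc.
- by move=> z _; rewrite lee_fin tcost_le.
Qed.

(** A plan nearly optimal for the truncated cost is tested against the full cost; the difference is
    carried by the tails of its marginals. *)
Lemma W2_sq_le_Wc M f g T : 1 <= M ->
  (\int[f]_v (tail2 M v)%:E + \int[g]_v (tail2 M v)%:E <= T%:E)%E ->
  (W2_sq f g <= (Wc M f g + 4 * T)%:E)%E.
Proof.
move=> M1 hT; apply/lee_addgt0Pr => e e0.
have [P [_ [_ [cP _ _ _ [hP _]]]]] := Wc_dual f g M1 e0.
apply: (@le_trans _ _ (\int[P]_z (enorm (z.1 - z.2) ^+ 2)%:E)%E).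
  by apply: ereal_inf_lbound; exists P.
apply: (@le_trans _ _ (\int[P]_z (tcost M z.1 z.2 + 4 * tails M z)%:E)%E).
  apply: ge0_le_integral => //.
  - by move=> z _; rewrite lee_fin sqr_ge0.
  - apply/measurable_EFinP; apply: measurable_funD; first exact: mtc.
    apply: measurable_funM => //; exact: measurable_tails.
  - by move=> z _; rewrite lee_fin; exact: sqr_le_tcost.
apply: (le_trans (cost_integral cP M1 hT)).
by rewrite -EFinD lee_fin addrAC lerD2r.
Qed.

(** The coupling is the image of f under the diagonal map. *)
Lemma W2_sq_diag f g : same_measure f g -> (W2_sq f g <= 0)%E.
Proof.
move=> fg; pose dg (x : V) := (x, x).
have md : measurable_fun setT dg by exact: measurable_fun_pair.
pose m := measure_function_pushforward__canonical__measure_function_Measure f md.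
have mT : m setT = 1%E by rewrite /m /= /pushforward preimage_setT; exact: (probability_setT f).
have [P PE] := mass1_probability (f \x f)%E mT.
have cP : coupling f g P.
  move=> A mA; split; rewrite (etrans (PE _) erefl) /= /pushforward.
    by congr (f _); apply/seteqP; split => x //= [].
  rewrite -(fg A mA); by congr (f _); apply/seteqP; split => x //= [].
apply: (@le_trans _ _ (\int[P]_z (enorm (z.1 - z.2) ^+ 2)%:E)%E).
  by apply: ereal_inf_lbound; exists P.
rewrite (eq_measure_integral m); last by move=> A _ _; exact: PE.
rewrite ge0_integral_pushforward//; last by move=> z _; rewrite lee_fin sqr_ge0.
by rewrite integral0_eq// => x _; rewrite /= subrr enorm0 expr0n.
Qed.

(** No optimal coupling is needed: with one of cost below d^2, the bound |x - y| <= d + |x - y|^2 /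
    d shows that the means of a K-Lipschitz function differ by at most 2 * K * d. *)
Lemma W2_sq0_same f g : (W2_sq f g <= 0)%E -> same_measure f g.
Proof.
move=> W0; apply: lipschitz_separates => K phi phiK b01.
have K0 := lipv_ge0 phiK.
have mphi := lipv_measurable phiK.
have mphiE : measurable_fun setT (EFin \o phi) by exact/measurable_EFinP.
apply/eqP; rewrite -subr_eq0 -normr_le0.
have K20 : 0 <= K * 2 by rewrite mulr_ge0.
apply: (le_addgt0Mr K20) => d d0; rewrite add0r.
have [_ [P cP <-] hP] : exists2 y, [set (\int[P]_z (enorm (z.1 - z.2) ^+ 2)%:E)%E | P in coupling f g] y
    & (y < (d ^+ 2)%:E)%E.
  by apply: ereal_inf_lt; apply: (le_lt_trans W0); rewrite lte_fin exprn_gt0.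
have i1 : P.-integrable setT (fun z => (phi z.1)%:E).
  apply: (@bounded_integrable _ _ _ P _ 1); first exact: (measurableT_comp mphi measurable_fst).
  by move=> z; have /andP[h0 h1] := b01 z.1; rewrite ger0_norm.
have i2 : P.-integrable setT (fun z => (phi z.2)%:E).
  apply: (@bounded_integrable _ _ _ P _ 1); first exact: (measurableT_comp mphi measurable_snd).
  by move=> z; have /andP[h0 h1] := b01 z.2; rewrite ger0_norm.
have -> : \int[f]_x phi x - \int[g]_x phi x = \int[P]_z (phi z.1 - phi z.2).
  rewrite (RintegralB measurableT i1 i2); congr (fine _ - fine _).
    by apply/esym; exact: (coupling_integral1 cP mphiE).
  by apply/esym; exact: (coupling_integral2 cP mphiE).
have i12 : P.-integrable setT (EFin \o (fun z => phi z.1 - phi z.2)).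
  exact: (integrableB measurableT i1 i2).
apply: (le_trans (le_normr_Rintegral measurableT i12)); rewrite -lee_fin.
have kd0 : 0 <= K / d by rewrite divr_ge0// ltW.
have mE : measurable_fun setT (fun z : V * V => (K / d)%:E * (enorm (z.1 - z.2) ^+ 2)%:E)%E.
  exact: emeasurable_funM.
apply: (@le_trans _ _ (\int[P]_z ((K * d)%:E + (K / d)%:E * (enorm (z.1 - z.2) ^+ 2)%:E))%E).
  apply: Rintegral_le_integral.
  - exact: (integrable_norm i12).
  - exact: emeasurable_funD.
  - by move=> z; rewrite adde_ge0 ?mule_ge0 ?lee_fin ?sqr_ge0// mulr_ge0// ltW.
  - move=> z; rewrite -EFinM -EFinD lee_fin; apply: (le_trans (phiK z.1 z.2)).
    rewrite -mulrA -mulrDr ler_wpM2l//.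
    have [h|h] := leP (enorm (z.1 - z.2)) d.
      by rewrite (le_trans h)// lerDl mulr_ge0 ?invr_ge0 ?sqr_ge0// ltW.
    rewrite (@le_trans _ _ (d^-1 * enorm (z.1 - z.2) ^+ 2))//; last by rewrite lerDr ltW.
    by rewrite expr2 mulrA ler_peMl ?enorm_ge0// ler_pdivlMl// mulr1 ltW.
rewrite ge0_integralD//; first last.
- by move=> z _; rewrite mule_ge0 ?lee_fin ?sqr_ge0.
- by move=> z _; rewrite lee_fin mulr_ge0// ltW.
rewrite prob_integral_cst ge0_integralZl//; last by move=> z _; rewrite lee_fin sqr_ge0.
apply: (@le_trans _ _ ((K * d)%:E + (K / d)%:E * (d ^+ 2)%:E)%E).
  by rewrite leeD2l// lee_wpmul2l ?lee_fin// ltW.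
rewrite -EFinM -EFinD lee_fin le_eqVlt; apply/orP; left; apply/eqP.
by field; rewrite gt_eqF.
Qed.

Definition tail_mass M f : R := fine (\int[f]_v (tail2 M v)%:E)%E.

Let mtail M : measurable_fun setT (fun v : V => (tail2 M v)%:E).
Proof. by apply/measurable_EFinP; exact: measurable_tail2. Qed.

Let mn2 : measurable_fun setT (fun v : V => (enorm v ^+ 2)%:E).
Proof. by apply/measurable_EFinP; apply: measurable_funX; exact: measurable_enorm. Qed.

Lemma tail_integral_le M f : (\int[f]_v (tail2 M v)%:E <= \int[f]_v (enorm v ^+ 2)%:E)%E.
Proof.
apply: ge0_le_integral => //; first by move=> v _; rewrite lee_fin tail2_ge0.
by move=> v _; rewrite lee_fin /tail2; case: ifP => // _; exact: sqr_ge0.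
Qed.

Lemma tail_massE M f : (\int[f]_v (enorm v ^+ 2)%:E < +oo)%E ->
  (\int[f]_v (tail2 M v)%:E = (tail_mass M f)%:E)%E.
Proof.
move=> f2; rewrite fineK// ge0_fin_numE; first exact: le_lt_trans (tail_integral_le M f) f2.
by apply: integral_ge0 => v _; rewrite lee_fin tail2_ge0.
Qed.

Lemma tail_mass_ge0 M f : 0 <= tail_mass M f.
Proof. by apply: fine_ge0; apply: integral_ge0 => v _; rewrite lee_fin tail2_ge0. Qed.

(** Dominated convergence: at each v the tail vanishes once the level exceeds |v|, and |v|^2 is an
    integrable majorant. *)
Lemma tail_mass_cvg f : (\int[f]_v (enorm v ^+ 2)%:E < +oo)%E ->
  tail_mass n.+1%:R f @[n --> \oo] --> (0 : R).
Proof.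
move=> f2.
have i2 : f.-integrable setT (fun v => (enorm v ^+ 2)%:E).
  apply/integrableP; split => //; apply: le_lt_trans f2; apply: ge0_le_integral => //.
    exact: (measurableT_comp _ mn2).
  by move=> v _; rewrite /= lee_fin ger0_norm// sqr_ge0.
have cv : {ae f, forall v, setT v -> ((tail2 n.+1%:R v)%:E @[n --> \oo] --> (0 : \bar R))%E}.
  apply: aeW => v _; apply: cvg_near_cst; exists (Num.truncn (enorm v)) => // n /= hn.
  rewrite /tail2 ifT//; apply/ltW; apply: (lt_le_trans (truncnS_gt _)).
  by rewrite ler_nat ltnS.
have bd : {ae f, forall v n, setT v -> (`|(tail2 n.+1%:R v)%:E| <= (enorm v ^+ 2)%:E)%E}.
  apply: aeW => v n _; rewrite /= lee_fin ger0_norm ?tail2_ge0// /tail2.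
  by case: ifP => // _; exact: sqr_ge0.
have [_ _] := dominated_convergence measurableT (fun n => mtail n.+1%:R) (measurable_cst (0%E : \bar R)) cv i2 bd.
rewrite integral0 => h; have := fine_cvg h; exact.
Qed.

End squared_distance.

Section weak_solutions.
Context {R : realType} (gamma : R) (beta : R -> R) (I : vec R -> vec R).
Local Notation V := (vec R).
Local Notation R' := (measurableTypeR R).
Local Notation mu := (@lebesgue_measure R).
Variable f : R -> probability V R.
Hypothesis wf : weak_solution gamma beta I f.

(* Freezing the family at negative times makes it a kernel on the whole line. *)
Definition nonneg_times (t : R) : probability V R := f (Num.max t 0).

Lemma nonneg_timesE t : 0 <= t -> nonneg_times t = f t.
Proof. by move=> t0; rewrite /nonneg_times max_l. Qed.

Lemma nonneg_times_measurable B : measurable B -> measurable_fun setT (fun t : R' => nonneg_times t B).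
Proof.
move=> mB; have [mf _ _ _] := wf.
apply: (@measurable_comp _ _ _ _ _ _ ([set` `[0, +oo[] : set R') (fun t : R' => f t B) _ (fun t : R' => Num.max t 0 : R')).
- exact: measurable_itv.
- by move=> _ [t _ <-] /=; rewrite in_itv/= andbT le_max lexx orbT.
- exact: mf.
- by apply: measurable_maxr.
Qed.

Let powR2 (g : probability V R) : moment 2 g = (\int[g]_v (enorm v ^+ 2)%:E)%E.
Proof. by apply: eq_integral => v _; rewrite -powR_mulrn ?enorm_ge0. Qed.

Lemma energy_finite : (\int[f 0]_v (enorm v ^+ 2)%:E < +oo)%E.
Proof. by have [_ _ [h _] _] := wf; rewrite -powR2. Qed.

Lemma energy_conserved t : (\int[nonneg_times t]_v (enorm v ^+ 2)%:E = \int[f 0]_v (enorm v ^+ 2)%:E)%E.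
Proof.
have [_ _ [_ h] _] := wf.
by rewrite -!powR2 /nonneg_times h// le_max lexx orbT.
Qed.

Lemma weight_bound t : (\int[nonneg_times t]_v (1 + enorm v)%:E <= 2 + \int[f 0]_v (enorm v ^+ 2)%:E)%E.
Proof.
have mn2 : measurable_fun setT (fun v : V => (enorm v ^+ 2)%:E).
  by apply/measurable_EFinP; apply: measurable_funX; exact: measurable_enorm.
rewrite -(energy_conserved t) -[X in (X + _)%E](prob_integral_cst (nonneg_times t)) -ge0_integralD//; last first.
  by move=> v _; rewrite lee_fin sqr_ge0.
apply: ge0_le_integral => //.
- by move=> v _; rewrite lee_fin addr_ge0 ?enorm_ge0.
- by apply/measurable_EFinP; apply: measurable_funD => //; exact: measurable_enorm.
- exact: emeasurable_funD.
- by move=> v _; rewrite -EFinD lee_fin; have := sqr_ge0 (enorm v - 1); rewrite sqrrB1; move: (enorm v) => x; nra.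
Qed.

Lemma nonneg_times_weak K phi : lipv K phi -> (exists B, forall x, `|phi x| <= B) -> forall t : R, 0 <= t ->
  \int[nonneg_times t]_v phi v = \int[nonneg_times 0]_v phi v +
    \int[mu]_(s in `[0, t]) collision_mean gamma beta I (nonneg_times s) phi.
Proof.
move=> phiK bnd t t0; have [_ _ _ h] := wf.
have -> := nonneg_timesE t0.
rewrite (h phi bnd (ex_intro (fun K => forall v w, `|phi v - phi w| <= K * enorm (v - w)) K phiK) t t0).
have -> := nonneg_timesE (lexx 0); congr (_ + _).
apply: eq_Rintegral => s; rewrite inE/= in_itv/= => /andP[s0 _].
by rewrite nonneg_timesE.
Qed.

End weak_solutions.

Lemma Lp_norm_ge0 (R : realType) (p : R) (f : probability (vec R) R) : (0 <= Lp_norm p f)%E.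
Proof. by apply: le_ereal_inf_tmp => _ [h _ <-]; exact: Lnorm_ge0. Qed.

(** * Removal of the truncation and the stability estimate *)

Section main.
Context {R : realType} (gamma nu p Cp : R) (beta G : R -> R) (Cr Cd k1 : R) (I : vec R -> vec R).
Hypotheses (hgamma : -1 < gamma < 0) (nu01 : 0 < nu < 1) (hgn : 0 < gamma + nu)
  (mb : measurable_fun `](0 : R), pi] beta) (b_ge0 : {in `](0 : R), pi], forall t, 0 <= beta t})
  (hG : inverse_angle nu beta G Cr Cd k1) (hI : orthogonal_selection I)
  (hp : 3 / (3 + gamma) < p) (Cp0 : 0 < Cp)
  (hCp : forall (f : probability (vec R) R) v,
    (\int[f]_w (enorm (v - w) `^ gamma)%:E <= Cp%:E * (1 + Lp_norm p f))%E).
Local Notation V := (vec R).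
Local Notation R' := (measurableTypeR R).
Local Notation mu := (@lebesgue_measure R).
Local Notation r := (rate Cr k1).
Variables (f g : R -> probability V R).
Hypotheses (wf : weak_solution gamma beta I f) (wg : weak_solution gamma beta I g) (fp : L1loc_Lp p f).

Let F := nonneg_times f.
Let H := nonneg_times g.
(** [fine] sends an infinite norm to 0; the times at which this happens form a null set, excluded in
    [good]. *)
Let S u := Cp * (1 + fine (Lp_norm p (F u))).
Let T n u := tail_mass n.+1%:R (F u) + tail_mass n.+1%:R (H u).
Let ef := fine (\int[f 0]_v (enorm v ^+ 2)%:E)%E.
Let eg := fine (\int[g 0]_v (enorm v ^+ 2)%:E)%E.
Let D := 2 + (ef + eg).
Let B := ef + eg.

Let en_ge0 (h : probability V R) : (0 <= \int[h]_v (enorm v ^+ 2)%:E)%E.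
Proof. by apply: integral_ge0 => v _; rewrite lee_fin sqr_ge0. Qed.

Let efE : (\int[f 0]_v (enorm v ^+ 2)%:E = ef%:E)%E.
Proof. by rewrite fineK// ge0_fin_numE//; exact: energy_finite wf. Qed.

Let egE : (\int[g 0]_v (enorm v ^+ 2)%:E = eg%:E)%E.
Proof. by rewrite fineK// ge0_fin_numE//; exact: energy_finite wg. Qed.

Let ef0 : 0 <= ef. Proof. exact: fine_ge0. Qed.
Let eg0 : 0 <= eg. Proof. exact: fine_ge0. Qed.

Let FD t : (\int[F t]_v (1 + enorm v)%:E <= D%:E)%E.
Proof. by apply: (le_trans (weight_bound wf t)); rewrite efE -EFinD lee_fin /D lerD2l lerDl. Qed.

Let HD t : (\int[H t]_v (1 + enorm v)%:E <= D%:E)%E.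
Proof. by apply: (le_trans (weight_bound wg t)); rewrite egE -EFinD lee_fin /D lerD2l lerDr. Qed.

Let F2 t : (\int[F t]_v (enorm v ^+ 2)%:E < +oo)%E.
Proof. by rewrite (energy_conserved wf); exact: energy_finite wf. Qed.

Let H2 t : (\int[H t]_v (enorm v ^+ 2)%:E < +oo)%E.
Proof. by rewrite (energy_conserved wg); exact: energy_finite wg. Qed.

Let T_ge0 n u : 0 <= T n u. Proof. by rewrite addr_ge0 ?tail_mass_ge0. Qed.

Let T_le n u : T n u <= B.
Proof.
rewrite /T /B; apply: lerD; rewrite -lee_fin.
  by rewrite -(tail_massE _ (F2 u)) -efE -(energy_conserved wf u); exact: tail_integral_le.
by rewrite -(tail_massE _ (H2 u)) -egE -(energy_conserved wg u); exact: tail_integral_le.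
Qed.

Let T_hyp n u : (\int[F u]_v (tail2 n.+1%:R v)%:E + \int[H u]_v (tail2 n.+1%:R v)%:E <= (T n u)%:E)%E.
Proof. by rewrite (tail_massE _ (F2 u)) (tail_massE _ (H2 u)). Qed.

Let mtail_mass M (h : R -> probability V R) :
  (forall A, measurable A -> measurable_fun setT (fun t : R' => h t A)) ->
  measurable_fun setT (fun u : R' => tail_mass M (h u) : R').
Proof.
move=> mh; apply: (measurableT_comp (fine_measurable measurableT)).
have mF : measurable_fun setT (fun z : R' * V => (tail2 M z.2)%:E).
  by apply/measurable_EFinP; exact: (measurableT_comp (measurable_tail2 M) measurable_snd).
by apply: (measurable_integral_family mh mF) => z; rewrite lee_fin tail2_ge0.
Qed.

Let mT n : measurable_fun setT (T n : R' -> R').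
Proof.
by apply: measurable_funD; apply: mtail_mass; [exact: nonneg_times_measurable wf|exact: nonneg_times_measurable wg].
Qed.

Let S_ge0 u : 0 <= S u.
Proof. by rewrite mulr_ge0 ?(ltW Cp0)// addr_ge0// fine_ge0// Lp_norm_ge0. Qed.

Let mcl (t : R) : measurable ([set` `[0, t]] : set R'). Proof. exact: measurable_itv. Qed.
Let moc (t : R) : measurable ([set` `]0, t]] : set R'). Proof. exact: measurable_itv. Qed.

Let icst (c t : R) : mu.-integrable `[0, t] (EFin \o (fun=> c)).
Proof.
apply: measurable_bounded_integrable => //.
  by rewrite /= lebesgue_measure_itv/=; case: ifP => // _; rewrite -EFinB ltry.
exists `|c|; split; first by rewrite num_real.
by move=> b Bb u _ /=; rewrite ltW.
Qed.

Let iLp t : mu.-integrable `[0, t] (fun u => Lp_norm p (F u)).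
Proof.
have t0 : 0 <= Num.max t 0 by rewrite le_max lexx orbT.
have st : ([set` `[0, t]] : set R') `<=` [set` `[0, Num.max t 0]].
  by move=> u /=; rewrite !in_itv/= le_max => /andP[-> ->].
apply: (integrableS (mcl (Num.max t 0)) (mcl t) st).
apply: (@eq_integrable _ _ _ mu _ (mcl (Num.max t 0)) (fun u => Lp_norm p (f u))).
  by move=> u; rewrite inE/= in_itv/= => /andP[u0 _]; rewrite /F nonneg_timesE.
exact: fp t0.
Qed.

Let iS t : mu.-integrable `[0, t] (EFin \o S).
Proof.
have mL := measurable_int _ (iLp t).
have ifine : mu.-integrable `[0, t] (fun u => (fine (Lp_norm p (F u)))%:E).
  apply: (le_integrable (mcl t) _ _ (iLp t)).
    by apply/measurable_EFinP; exact: (measurableT_comp (fine_measurable measurableT) mL).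
  move=> u _; rewrite [leRHS]gee0_abs ?Lp_norm_ge0// /= ger0_norm ?fine_ge0 ?Lp_norm_ge0//.
  by have := Lp_norm_ge0 p (F u); case: (Lp_norm p (F u)) => //= _; rewrite leey.
exact: (integrableZl (mcl t) Cp (integrableD (mcl t) (icst 1 t) ifine)).
Qed.

Let iT n t : mu.-integrable `[0, t] (EFin \o T n).
Proof.
apply: (le_integrable (mcl t) _ _ (icst B t)).
  by apply/measurable_EFinP; exact: (measurable_funTS (mT n)).
by move=> u _; rewrite /= lee_fin (ger0_norm (T_ge0 n u)) (le_trans (T_le n u))// ler_norm.
Qed.

Let iST n t : mu.-integrable `[0, t] (EFin \o (S \* T n)).
Proof.
have iBS : mu.-integrable `[0, t] (fun u => B%:E * (S u)%:E)%E := integrableZl (mcl t) B (iS t).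
apply: (le_integrable (mcl t) _ _ iBS).
  apply/measurable_EFinP; apply: measurable_funM; last exact: (measurable_funTS (mT n)).
  by apply/measurable_EFinP; exact: (measurable_int _ (iS t)).
move=> u _; rewrite /= lee_fin (ger0_norm (mulr_ge0 (S_ge0 u) (T_ge0 n u))) mulrC.
by apply: le_trans (ler_norm _); apply: ler_wpM2r; [exact: S_ge0|exact: T_le].
Qed.

(** Integrability in time makes the norm finite at almost every time, and then [S] is the genuine
    bound and f has no atoms. *)
Let good t : {ae mu, forall u, u \in `[0, t] ->
   (forall v, (\int[F u]_w (enorm (v - w) `^ gamma)%:E <= (S u)%:E)%E) /\ forall v, F u [set v] = 0%E}.
Proof.
have := integrable_ae (mcl t) (iLp t); apply: (@filterS _ _ (ae_filter_ringOfSetsType mu)) => u h ut.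
have fin := h ut; split => v.
  apply: (le_trans (hCp (F u) v)); rewrite /S EFinM EFinD fineK//.
by apply: (density_no_atom hgamma hp); rewrite -ge0_fin_numE// Lp_norm_ge0.
Qed.

Let b n u := 8 * r * (S u * T n u) + 2 * far_rate k1 * D * T n u.

Let gronwall n t : 0 <= t -> Wc n.+1%:R (F t) (H t) <=
  (Wc n.+1%:R (F 0) (H 0) + \int[mu]_(u in `]0, t]) b n u) * expR (\int[mu]_(u in `]0, t]) (2 * r * S u)).
Proof.
have n1 : 1 <= n.+1%:R :> R by rewrite ler1n.
exact: (Wc_gronwall hgamma nu01 hgn mb b_ge0 hG hI (nonneg_times_measurable wf) (nonneg_times_measurable wg)
  FD HD (nonneg_times_weak wf) (nonneg_times_weak wg) n1 S_ge0 (T_ge0 n) iS (iT n) (iST n) good (T_hyp n)).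
Qed.

Let T_cvg u : T n u @[n --> \oo] --> (0 : R).
Proof. by rewrite -(addr0 0); apply: cvgD; apply: tail_mass_cvg; [exact: F2|exact: H2]. Qed.

(** At each time the tails vanish as the level grows. Conservation of energy bounds them by B
    uniformly in time, which provides the integrable majorant. *)
Let b_cvg t : \int[mu]_(u in `]0, t]) b n u @[n --> \oo] --> (0 : R).
Proof.
have soc : ([set` `]0, t]] : set R') `<=` [set` `[0, t]].
  by move=> u /=; rewrite !in_itv/= => /andP[/ltW -> ->].
have ib n : mu.-integrable `[0, t] (fun u => (b n u)%:E).
  have h1 := integrableZl (mcl t) (8 * r) (iST n t).
  have h2 := integrableZl (mcl t) (2 * far_rate k1 * D) (iT n t).
  exact: (integrableD (mcl t) h1 h2).
have r0 := rate_ge0 hG; have fr0 := far_rate_ge0 hG.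
have D0 : 0 <= D by rewrite /D addr_ge0// addr_ge0.
pose c1 := 8 * r * B; pose c2 := 2 * far_rate k1 * D * B.
have idom : mu.-integrable `]0, t] (fun u => c1%:E * (S u)%:E + c2%:E)%E.
  apply: (integrableS (mcl t) (moc t) soc).
  exact: (integrableD (mcl t) (integrableZl (mcl t) c1 (iS t)) (icst c2 t)).
have mbn n : measurable_fun `]0, t] (fun u => (b n u)%:E).
  exact: (measurable_int _ (integrableS (mcl t) (moc t) soc (ib n))).
have cv : {ae mu, forall u, `]0, t]%classic u -> ((b n u)%:E @[n --> \oo] --> (0 : \bar R))%E}.
  apply: aeW => u _; apply/fine_cvgP; split; first by near=> n.
  rewrite -[X in _ --> X](_ : 8 * r * (S u * 0) + 2 * far_rate k1 * D * 0 = 0 :> R); last by rewrite !mulr0 addr0.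
  by apply: cvgD; apply: cvgMr; [apply: cvgMr|]; exact: T_cvg.
have bd : {ae mu, forall u n, `]0, t]%classic u -> (`|(b n u)%:E| <= c1%:E * (S u)%:E + c2%:E)%E}.
  apply: aeW => u n _; rewrite /= -EFinM -EFinD lee_fin.
  have i1 : 0 <= 8 * r by rewrite mulr_ge0.
  have i2 : 0 <= 2 * far_rate k1 * D by rewrite mulr_ge0// mulr_ge0.
  rewrite ger0_norm; last by apply: addr_ge0; apply: mulr_ge0 => //; exact: mulr_ge0.
  rewrite /c1 /c2; apply: lerD; last by apply: ler_wpM2l => //; exact: T_le.
  rewrite -(mulrA (8 * r) B); apply: ler_wpM2l => //; rewrite mulrC; apply: ler_wpM2r; [exact: S_ge0|exact: T_le].
have [_ _] := dominated_convergence (moc t) mbn (measurable_cst (0%E : \bar R)) cv idom bd.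
by rewrite integral0 => h; exact: (fine_cvg h).
Unshelve. all: by end_near.
Qed.

(** The level n + 1 tends to infinity at fixed t. The summand 1 makes the constant positive even if
    [rate] is zero, so that an infinite norm gives an infinite right-hand side. *)
Lemma W2_stability t : 0 <= t ->
  (W2_sq (f t) (g t) <= W2_sq (f 0%R) (g 0%R) *
    expeR ((2 * r * Cp + 1)%:E * \int[mu]_(s in `[0%R, t]) (1 + Lp_norm p (f s))))%E.
Proof.
move=> t0; have r0 := rate_ge0 hG.
pose E := expR (\int[mu]_(u in `]0, t]) (2 * r * S u)).
set X := (_ * \int[mu]_(s in _) _)%E.
have soc : ([set` `]0, t]] : set R') `<=` [set` `[0, t]].
  by move=> u /=; rewrite !in_itv/= => /andP[/ltW -> ->].
(* The real exponent involves [fine] of the norm over the half-open interval; enlarging the domain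
   and the integrand gives the extended exponent of the statement. *)
have EX : (E%:E <= expeR X)%E.
  have -> : E%:E = expeR (\int[mu]_(u in `]0, t]) (2 * r * S u))%:E by [].
  rewrite lee_expeR /Rintegral fineK; last first.
    apply: integrable_fin_num => //; apply: (integrableS (mcl t) (moc t) soc).
    exact: (integrableZl (mcl t) (2 * r) (iS t)).
  have mL : measurable_fun `[0, t] (fun s => Lp_norm p (f s)) by exact: (measurable_int _ (fp t0)).
  have m1L : measurable_fun `[0, t] (fun s => 1 + Lp_norm p (f s))%E by exact: emeasurable_funD.
  have L0 s : (0 <= 1 + Lp_norm p (f s))%E by rewrite adde_ge0// Lp_norm_ge0.
  have c0 : 0 <= 2 * r * Cp + 1 by rewrite addr_ge0// mulr_ge0 ?(ltW Cp0)// mulr_ge0.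
  rewrite /X -ge0_integralZl//.
  have mS : measurable_fun `[0, t] (fun u => (2 * r * S u)%:E).
    by have := measurable_int _ (integrableZl (mcl t) (2 * r) (iS t)).
  have S0' u : (0 <= (2 * r * S u)%:E)%E by rewrite lee_fin mulr_ge0// mulr_ge0.
  apply: (@le_trans _ _ (\int[mu]_(u in `[0%R, t]) (2 * r * S u)%:E)%E).
    by apply: ge0_subset_integral.
  apply: ge0_le_integral => //; first exact: emeasurable_funM.
  move=> u; rewrite /= in_itv/= => /andP[u0 _]; rewrite /S /F nonneg_timesE//.
  have := Lp_norm_ge0 p (f u); case: (Lp_norm p (f u)) => [x x0| _|//].
    rewrite -EFinD -EFinM lee_fin /= mulrA ler_wpM2r//; last by rewrite lerDl.
    by rewrite addr_ge0.
  by rewrite addey// gt0_muley ?leey// lte_fin ltr_wpDl// mulr_ge0 ?(ltW Cp0)// mulr_ge0.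
have E0 : 0 < E by exact: expR_gt0.
have X0 : (0 < expeR X)%E by apply: lt_le_trans EX; rewrite lte_fin.
(* An infinite initial distance makes the right-hand side infinite, since the exponential factor is
   positive. *)
have [w0|] := eqVneq (W2_sq (f 0) (g 0)) +oo%E; first by rewrite w0 gt0_mulye// leey.
rewrite -ltey => w0.
have [w wE] : exists w, W2_sq (f 0) (g 0) = w%:E.
  by exists (fine (W2_sq (f 0) (g 0))); rewrite fineK// ge0_fin_numE// W2_sq_ge0.
have wge0 : 0 <= w by rewrite -lee_fin -wE W2_sq_ge0.
rewrite wE; apply: (@le_trans _ _ (w * E)%:E); last by rewrite EFinM lee_wpmul2l ?lee_fin.
have bound n : (W2_sq (f t) (g t) <=
    ((w + \int[mu]_(u in `]0, t]) b n u) * E + 4 * T n t)%:E)%E.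
  have n1 : 1 <= n.+1%:R :> R by rewrite ler1n.
  have := W2_sq_le_Wc n1 (T_hyp n t); rewrite {1}/F {1}/H !nonneg_timesE// => h.
  apply: (le_trans h); rewrite lee_fin lerD2r.
  have := gronwall n t0; rewrite -/E /F /H !nonneg_timesE// => h'; apply: (le_trans h').
  rewrite ler_wpM2r ?(ltW E0)// lerD2r -lee_fin -wE; exact: Wc_le_W2_sq.
have cv : (w + \int[mu]_(u in `]0, t]) b n u) * E + 4 * T n t @[n --> \oo] --> w * E.
  rewrite -[X in _ --> X](_ : (w + 0) * E + 4 * 0 = w * E); last by rewrite addr0 mulr0 addr0.
  apply: cvgD; last by apply: cvgMr; exact: T_cvg.
  by apply: cvgMl; apply: cvgD; [exact: cvg_cst|exact: b_cvg].
apply/lee_addgt0Pr => e e0.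
have /cvgrPdist_le /(_ _ e0) [n _ /(_ n (leqnn n))] := cv.
rewrite ler_norml => /andP[h _]; apply: (le_trans (bound n)).
rewrite -EFinD lee_fin; move: h; move: (_ * E + _) (w * E) => x y; lra.
Qed.

End main.

Theorem theorem1p3 (R : realType) (gamma nu : R) (beta : R -> R) (p : R)
    (hgamma : -1 < gamma < 0) (hnu : 0 < nu < 1) (hgn : 0 < gamma + nu)
    (hbeta : angular_kernel nu beta) :
  exists C : R, 0 < C /\
  forall (I : vec R -> vec R) (q : R) (f0 : probability (vec R) R)
    (f : R -> probability (vec R) R),
    orthogonal_selection I ->
    2 <= q -> gamma ^+ 2 / (gamma + nu) < q ->
    3 / (3 + gamma) < p < p0 gamma nu q ->
    (moment q f0 < +oo)%E -> finite_entropy f0 ->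
    weak_solution gamma beta I f -> Linfty_P2 f -> L1loc_Lp p f ->
    same_measure (f 0) f0 ->
    (forall g : R -> probability (vec R) R,
      weak_solution gamma beta I g -> Linfty_P2 g ->
      forall t : R, 0 <= t ->
      (W2_sq (f t) (g t) <=
       W2_sq (f 0%R) (g 0%R) *
       expeR (C%:E * \int[lebesgue_measure]_(s in `[0%R, t])
                       (1 + Lp_norm p (f s))))%E) /\
    (forall g : R -> probability (vec R) R,
      weak_solution gamma beta I g -> same_measure (g 0) f0 ->
      forall t : R, 0 <= t -> same_measure (g t) (f t)).
Proof.
have [G [Cr [Cd [k1 hG]]]] := angular_inverse hnu hbeta.
have [mb b_ge0 _ _] := hbeta.
have r0 := rate_ge0 hG.
(* The constant is chosen before the range of p is assumed; if p is too small no data satisfy the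
   hypotheses and any positive constant serves. *)
have [hp|hp] := ltP (3 / (3 + gamma)) p; last first.
  exists 1; split => // I q f0 f _ _ _ /andP[h _]; by move: (lt_le_trans h hp); rewrite ltxx.
have [Cp [Cp0 hCp]] := density_kernel_bound hgamma hp.
exists (2 * rate Cr k1 * Cp + 1); split.
  by rewrite ltr_wpDl// mulr_ge0 ?(ltW Cp0)// mulr_ge0.
move=> I q f0 f hI _ _ _ _ _ wf _ fp f00.
have stab g t : weak_solution gamma beta I g -> 0 <= t -> _ :=
  fun wg t0 => W2_stability hgamma hnu hgn mb b_ge0 hG hI hp Cp0 hCp wf wg fp t0.
split; first by move=> g wg _ t; exact: stab.
move=> g wg g00 t t0.
(* Equal initial laws are at distance 0 by the diagonal coupling, and the estimate propagates the
   value 0. *)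
have d0 : (W2_sq (f 0%R) (g 0%R) <= 0)%E by apply: W2_sq_diag => A mA; rewrite (f00 A mA) (g00 A mA).
have W0 : W2_sq (f 0%R) (g 0%R) = 0%E by apply/eqP; rewrite eq_le d0 W2_sq_ge0.
have := stab g t wg t0; rewrite W0 mul0e => h A mA; apply/esym.
exact: (W2_sq0_same h mA).
Qed.
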